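(* Consider the zero-sum differential game of time to reach the antipodal point $E=(\mu,\pi)$ (defined in the context), with initial state $(r,\theta)\in\mathcal D$. Its solution is given by the following state-feedback equilibrium control strategies $\psi^*$ (for $L$) and $\omega^*$ (for $M$) and associated Value function $t_f^*$: $$ (\cos\psi^*,\ \sin\psi^* )=\begin{cases}\left(\sqrt{1-\frac{r^2}{\mu^2}},\ \frac{r}{\mu}\right) & \text{if }\theta=\pi,\\[4pt] (-1,\ 0) & \text{if }\theta\le \frac{r}{\mu},\\[4pt] \left(\pm\sqrt{1-\frac{s^4}{\mu^2r^2}},\ \frac{s^2}{\mu r}\right) & \text{otherwise,}\end{cases} $$ $$ \omega^*=\begin{cases}1 & \text{if }\theta>\frac{r}{\mu},\\ 0 & \text{if }\theta=0,\\ \text{undefined (not uniquely determined)} & \text{otherwise,}\end{cases} $$ $$ t_f^*=\begin{cases}\frac{\pi}{2}-\sin^{-1}\left(\frac{r}{\mu}\right) & \text{if }\theta=\pi,\\[4pt] \frac{\pi}{2}+\frac{r}{\mu} & \text{if }\theta\le\frac{r}{\mu},\\[4pt] \frac{\pi}{2}-\sin^{-1}\left(\frac{s}{\mu}\right)+t_L(s) & \text{otherwise.}\end{cases} $$ In the ''otherwise'' cases, $s=s(r,\theta)$, $t_L(s)$ and the sign $\pm$ are determined from the current state $(r,\theta)$ as follows. Case 1 ($L$'s equilibrium heading has a component towards the center of the lake; the sign of $\cos\psi^*$ is $-$): $$t_L(s)=\frac1\mu\left(\sqrt{r^2-\frac{s^4}{\mu^2}}+\sqrt{s^2-\frac{s^4}{\mu^2}}\right),\qquad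 t_M(s)=\theta+\cos^{-1}\left(\frac{s^2}{\mu r}\right)+\cos^{-1}\left(\frac{s}{\mu}\right)-\pi .$$ Case 2 ($L$'s equilibrium heading has a component away from the center of the lake; the sign of $\cos\psi^*$ is $+$): $$t_L(s)=\frac1\mu\left(\sqrt{s^2-\frac{s^4}{\mu^2}}-\sqrt{r^2-\frac{s^4}{\mu^2}}\right),\qquad t_M(s)=\theta-\cos^{-1}\left(\frac{s^2}{\mu r}\right)+\cos^{-1}\left(\frac{s}{\mu}\right)-\pi .$$ In each case $s$ is the smallest $s\in(0,\mu]$ (for which the expressions are defined) with $\delta(s):=t_L(s)-t_M(s)=0$. Case 1 applies if its equation $\delta(s)=0$ has such a solution; otherwise Case 2 applies.
   Context: The Lady $L$ swims with speed $\mu$ in a circular lake of radius $1$; the Man $M$ moves with maximum speed $1$ along the perimeter. The state is $(r,\theta)$, where $r\in[0,1]$ is $L$'s distance from the center and $\theta$ is the angle of $L$ relative to $M$; by reflection symmetry $\theta$ is taken in $[0,\pi]$ without loss of generality. The dynamics are $$\dot r=\mu\cos\psi,\qquad \dot\theta=\frac{\mu}{r}\sin\psi-\omega,$$ with $L$ controlling the heading $\psi\in[-\pi,\pi]$ and $M$ controlling $\omega\in[-1,1]$. On $\theta=\pi$, $L$ is allowed to know $M$'s instantaneous control. When $r=0$ the angle is immaterial and the state is identified with $(0,\pi)$. Standing assumption on the speed: $\mu_{\rm crit}<\mu<1$, where $\mu_{\rm crit}\approx 0.21723$ is the value of $\mu$ at which $\theta_T:=\pi-\sqrt{1/\mu^2-1}+\cos^{-1}\mu$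 vanishes ($\theta_T>0$ for $\mu>\mu_{\rm crit}$). The barrier is the curve $B(r)=\pi-\sqrt{r^2/\mu^2-1}+\cos^{-1}(\mu/r)$, $r\in[\mu,1]$. The region of interest is the part of the state space below the barrier: $$\mathcal D=\{(r,\theta): 0\le r\le 1,\ 0\le\theta\le\pi,\ \text{and } \theta<B(r)\text{ if } r>\mu\}.$$ The game: starting from a state in $\mathcal D$, $L$ minimizes and $M$ maximizes the time $t_f$ at which the state reaches the antipodal point $E=(\mu,\pi)$ (i.e. $L$ is diametrically opposite $M$ at radius $\mu$). The Value function is $t_f^*(r,\theta)=\min_{\psi(\cdot)}\max_{\omega(\cdot)}t_f=\max_{\omega(\cdot)}\min_{\psi(\cdot)}t_f$, and equilibrium strategies are those realizing this saddle point. Where $\omega^*$ is ''undefined'', every $\omega\in[-1,1]$ is regarded as equally optimal.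
   Formalization: Roots s of δ(s)=0 are also required to satisfy t_L(s) ≥ 0 (in Case 2, s ≥ r); without this the smallest root can have negative swimming time and give a wrong Value when π−θ < r/μ, e.g. r = 0.9μ, θ = π−0.001. *)

(* Defs.v *)
From HB Require Import structures.
From mathcomp Require Export all_boot all_order all_algebra.
From mathcomp Require Export all_classical all_reals all_analysis.

Set Implicit Arguments.
Unset Strict Implicit.
Unset Printing Implicit Defensive.

Import Order.TTheory GRing.Theory Num.Theory.
Import numFieldNormedType.Exports.

Local Open Scope classical_set_scope.
Local Open Scope ring_scope.

Section Formulas.
Context {R : realType}.
Implicit Types mu r theta s t : R.

Definition theta_T mu : R := pi - Num.sqrt (1 / mu ^+ 2 - 1) + acos mu.

Definition barrier mu r : R :=
  pi - Num.sqrt (r ^+ 2 / mu ^+ 2 - 1) + acos (mu / r).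

Definition below_barrier mu r theta : Prop :=
  [/\ 0 <= r <= 1, 0 <= theta <= pi & mu < r -> theta < barrier mu r].

(* At the center the angle is immaterial: the state is (0, pi). *)
Definition angle r theta : R := if r == 0 then pi else theta.

(* [inw] tells whether L's straight path first approaches the center (true) or
   leads away from it throughout (false). *)
Definition t_L mu r (inw : bool) s : R :=
  if inw then
    1 / mu * (Num.sqrt (r ^+ 2 - s ^+ 4 / mu ^+ 2)
              + Num.sqrt (s ^+ 2 - s ^+ 4 / mu ^+ 2))
  else
    1 / mu * (Num.sqrt (s ^+ 2 - s ^+ 4 / mu ^+ 2)
              - Num.sqrt (r ^+ 2 - s ^+ 4 / mu ^+ 2)).

Definition t_M mu r theta (inw : bool) s : R :=
  if inw then theta + acos (s ^+ 2 / (mu * r)) + acos (s / mu) - pi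
  else theta - acos (s ^+ 2 / (mu * r)) + acos (s / mu) - pi.

Definition delta mu r theta inw s : R := t_L mu r inw s - t_M mu r theta inw s.

(* The condition [s ^+ 2 <= mu * r], with [0 < s <= mu], is what makes all the
   square roots and arc cosines above defined.  The condition [0 <= t_L] says
   that t_L is a duration.  It is automatic for [inw = true].  For
   [inw = false] it means [r <= s] and discards roots with s < r, where L would have to travel
   backwards in time; such roots do occur when pi - theta < r / mu, and they
   are then smaller than the root that describes the motion of L. *)
Definition switch_radius mu r theta (inw : bool) s : Prop :=
  [/\ 0 < s <= mu, s ^+ 2 <= mu * r, 0 <= t_L mu r inw s
    & delta mu r theta inw s = 0].

Definition least_switch_radius mu r theta inw s : Prop :=
  switch_radius mu r theta inw s /\
  (forall s', switch_radius mu r theta inw s' -> s <= s').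

Definition inward mu r theta : bool :=
  `[< exists s, switch_radius mu r theta true s >].

Definition s_star mu r theta : R :=
  xget 0 [set s | least_switch_radius mu r theta (inward mu r theta) s].

(* (cos psi, sin psi) *)
Definition psi_star mu r theta : R * R :=
  if theta == pi then (Num.sqrt (1 - r ^+ 2 / mu ^+ 2), r / mu)
  else if theta <= r / mu then (-1, 0)
  else let s := s_star mu r theta in
       let c := Num.sqrt (1 - s ^+ 4 / (mu ^+ 2 * r ^+ 2)) in
       (if inward mu r theta then - c else c, s ^+ 2 / (mu * r)).

(* The set of optimal controls of M; it is all of [-1, 1] where the optimal
   control is not uniquely determined. *)
Definition omega_star mu r theta : set R :=
  if r / mu < theta then [set 1]
  else if theta == 0 then [set 0]
  else [set w | -1 <= w <= 1].

Definition tf_star mu r theta : R :=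
  if theta == pi then pi / 2 - asin (r / mu)
  else if theta <= r / mu then pi / 2 + r / mu
  else let s := s_star mu r theta in
       pi / 2 - asin (s / mu) + t_L mu r (inward mu r theta) s.

End Formulas.

Section Game.
Context {R : realType}.
Implicit Types mu r theta t T : R.

(* The motions of the players are kept apart: L has polar coordinates
   (rad, azi) and heading psi relative to the outward radial direction, M has
   angular position pos and control omega, with
     rad' = mu cos psi,  azi' = (mu / rad) sin psi,  pos' = omega,
   so that the relative angle azi - pos obeys
     (azi - pos)' = (mu / rad) sin psi - omega.
   Controls are measurable and the equations hold in integrated form; azi is
   unconstrained while rad = 0. *)
Record lady := Lady { rad : R -> R; azi : R -> R; psi : R -> R }.
Record man := Man { pos : R -> R; omega : R -> R }.

Definition lady_motion mu r0 theta0 T (l : lady) : Prop :=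
  [/\ rad l 0 = r0 /\ azi l 0 = theta0,
      measurable_fun (`[0, T] : set R) (psi l) /\
      (forall t, 0 <= t <= T -> - pi <= psi l t <= pi),
      forall t, 0 <= t <= T -> 0 <= rad l t <= 1,
      forall a b, 0 <= a -> a <= b -> b <= T ->
        rad l b - rad l a
        = \int[lebesgue_measure]_(t in `[a, b]) (mu * cos (psi l t))
    & forall a b, 0 <= a -> a <= b -> b <= T ->
        (forall t, a <= t <= b -> 0 < rad l t) ->
        azi l b - azi l a
        = \int[lebesgue_measure]_(t in `[a, b]) (mu / rad l t * sin (psi l t))].

Definition man_motion T (m : man) : Prop :=
  [/\ pos m 0 = 0,
      measurable_fun (`[0, T] : set R) (omega m),
      forall t, 0 <= t <= T -> -1 <= omega m t <= 1
    & forall t, 0 <= t <= T ->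
        pos m t = \int[lebesgue_measure]_(u in `[0, t]) omega m u].

(* Reduction by reflection: acos (cos phi) is the angle in [0, pi] between the
   two players, and [orient] is -1 exactly when reaching it from the relative
   angle phi takes a reflection, which also changes the sign of the angular
   part of both controls. *)
Definition rel_angle (l : lady) (m : man) t : R :=
  angle (rad l t) (acos (cos (azi l t - pos m t))).

Definition orient (l : lady) (m : man) t : R :=
  if (rad l t == 0) || (0 <= sin (azi l t - pos m t)) then 1 else -1.

(* State feedback of L: heading from (r, theta) and, on theta = pi only, the
   current control of M. *)
Definition lady_feedback (k : R -> R -> R -> R) : Prop :=
  (forall r theta w, - pi <= k r theta w <= pi) /\
  (forall r theta w w', theta != pi -> k r theta w = k r theta w').

Definition lady_follows k T l m : Prop :=
  forall t, 0 <= t < T ->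
    psi l t = orient l m t
              * k (rad l t) (rel_angle l m t) (orient l m t * omega m t).

(* Set-valued state feedback of M. *)
Definition man_follows (W : R -> R -> set R) T l m : Prop :=
  forall t, 0 <= t < T ->
    W (rad l t) (rel_angle l m t) (orient l m t * omega m t).

Definition at_E mu l m t : Prop := rad l t = mu /\ rel_angle l m t = pi.

Definition final_time mu l m T : Prop :=
  [/\ 0 <= T, at_E mu l m T & forall t, 0 <= t < T -> ~ at_E mu l m t].

Definition lady_agree T (l l' : lady) : Prop :=
  (forall t, 0 <= t <= T -> rad l t = rad l' t /\ azi l t = azi l' t) /\
  (forall t, 0 <= t < T -> psi l t = psi l' t).

Definition man_agree T (m m' : man) : Prop :=
  (forall t, 0 <= t <= T -> pos m t = pos m' t) /\
  (forall t, 0 <= t < T -> omega m t = omega m' t).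

(* t_f <= V against every motion of M: each play of k that has not yet reached
   E can be continued (in particular a play exists), and continues to E no
   later than V. *)
Definition lady_secures mu r0 theta0 k V : Prop :=
  forall m, (forall T, man_motion T m) ->
  forall T l, 0 <= T ->
    lady_motion mu r0 theta0 T l -> lady_follows k T l m ->
    (forall t, 0 <= t < T -> ~ at_E mu l m t) ->
  exists T' l',
    [/\ T <= T' <= V, lady_motion mu r0 theta0 T' l', lady_follows k T' l' m,
        lady_agree T l l' & final_time mu l' m T'].

(* t_f >= V against every motion of L: W can be played, and continued, along
   any motion of L, and E is never reached before V. *)
Definition man_secures mu r0 theta0 W V : Prop :=
  forall T l, 0 <= T -> lady_motion mu r0 theta0 T l ->
    (forall S m, 0 <= S <= T -> man_motion S m -> man_follows W S l m ->
       exists m',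
         [/\ man_motion T m', man_follows W T l m' & man_agree S m m']) /\
    (forall m, man_motion T m -> man_follows W T l m ->
       final_time mu l m T -> V <= T).

(* Saddle point with value V:
   t_f (k, omega) <= t_f (k, W) = V <= t_f (psi, W). *)
Definition saddle_point mu r0 theta0 k W V : Prop :=
  [/\ lady_secures mu r0 theta0 k V,
      man_secures mu r0 theta0 W V
    & exists l m,
        [/\ lady_motion mu r0 theta0 V l, man_motion V m,
            lady_follows k V l m, man_follows W V l m & final_time mu l m V]].

End Game.

(* Main.v *)
(* Put rho = r / mu, so that rho' = cos psi and theta' = sin psi / rho - omega.
   Outside the zone theta <= rho, L swims along the straight line that makes the
   angle beta with the tangential direction and leaves it where it is reached
   together with the antipode, at radius s = mu cos alpha with
   cos^2 alpha = rho cos beta. The equation delta(s) = 0 becomes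
   theta = Th rho beta, where Th is strictly decreasing in beta; hence beta, the
   smallest s and the case distinction are determined, and the value is
   alpha + t_L(s).
     Lower bound. After the last time at which theta <= rho, M runs towards L at
   full speed, and V - t + rho sin (V - t - 2 alpha - theta) does not increase,
   whatever L does; when V - t < alpha, take alpha = V - t instead. This excludes
   that E is reached before the time V.
     Upper bound. By the envelope theorem the value, which is stationary in
   alpha, decreases at unit rate along the feedback of L; this is proved for a
   continuous extension of the feedback beyond the barrier. After the
   players are opposite L copies the angular velocity of M, and arccos rho
   decreases at least at unit rate.
     Plays exist by Peano's theorem away from theta = pi, and by an existence
   theorem for discontinuous scalar equations on theta = pi and for M. *)
Require Import Defs.
From mathcomp Require Import all_boot all_order all_algebra.
From mathcomp Require Import all_classical all_reals all_analysis.
From mathcomp Require Import measurable_realfun ring lra.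
Require Import Defs.
Import Order.TTheory GRing.Theory Num.Theory.
Import numFieldNormedType.Exports.
Local Open Scope classical_set_scope.
Local Open Scope ring_scope.

Set Implicit Arguments.
Unset Strict Implicit.
Unset Printing Implicit Defensive.

(** Controls are only measurable, so theta and the value need have no derivative along a play. The
    lower bound therefore works with primitives, and the upper bound with Dini estimates from the
    right, for which omega <= 1 suffices because the value decreases in theta. In the lower bound,
    while M runs at full speed, theta + t changes like the azimuth of L in space. So rho sin (V - t
    - 2 alpha - theta) is a coordinate of L in a fixed direction, in units of mu, and grows at rate
    at most 1. M need not play well, and the state may then cross the barrier; the bound for L has
    to go on there. The value of the state projected onto the barrier still decreases, because L
    moves inwards there and the barrier is a decreasing function of r. The jump of the feedback of L
    at theta = pi, r <= mu is harmless for r < mu: beta lies in [- acos rho, 0] near such a state,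
    so L turns at the rate cos beta / rho >= 1, M cannot leave the antipode, and theta stays pi. *)

Ltac keep_comparisons := repeat match goal with H : ?P |- _ =>
  match type of P with Prop =>
    lazymatch P with
    | is_true _ => fail | _ = _ => fail | _ /\ _ => fail
    | lady_motion _ _ _ _ _ => fail | man_motion _ _ => fail
    | lady_follows _ _ _ _ => fail
    | _ => clear H
    end
  end end.
Ltac keep_motions := repeat match goal with H : ?P |- _ =>
  match type of P with Prop =>
    lazymatch P with
    | lady_motion _ _ _ _ _ => fail | man_motion _ _ => fail
    | lady_follows _ _ _ _ => fail
    | _ => clear H
    end
  end end.
(** Large contexts burden [lra]. [lin] keeps comparisons, equations and conjunctions; [lin_goal]
    relies on the premises of the goal alone. *)
Ltac lin := intros; keep_comparisons; lra.
Ltac lin_goal := keep_motions; intros; lra.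

(** * Integrals of bounded measurable functions *)

Section integrals.
Context {R : realType}.
Implicit Types (f g : R -> R) (a b c K M t : R).

Definition ig f a b : R := \int[lebesgue_measure]_(t in `[a, b]) f t.

(** Unlike integrability, this class is closed under products. *)
Definition bm f a b : Prop :=
  measurable_fun (`[a, b] : set R) f /\
  exists M, forall t, a <= t <= b -> `|f t| <= M.

Lemma bmW f a b a' b' : bm f a b -> a <= a' -> b' <= b -> bm f a' b'.
Proof.
move=> [mf [M fM]] aa bb; split.
  apply: measurable_funS mf => //.
  by apply: subset_itv; rewrite bnd_simp.
exists M => t /andP[t1 t2]; apply: fM.
by rewrite (le_trans aa t1) (le_trans t2 bb).
Qed.

Lemma bm_cst c a b : bm (fun=> c) a b.
Proof. by split; [exact: measurable_cst | exists `|c|]. Qed.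

Lemma bmD f g a b : bm f a b -> bm g a b -> bm (fun t => f t + g t) a b.
Proof.
move=> [mf [M fM]] [mg [N gN]]; split; first exact: measurable_funD.
exists (M + N) => t tab; apply: le_trans (ler_normD _ _) _.
by apply: lerD; [exact: fM | exact: gN].
Qed.

Lemma bmM f g a b : bm f a b -> bm g a b -> bm (fun t => f t * g t) a b.
Proof.
move=> [mf [M fM]] [mg [N gN]]; split; first exact: measurable_funM.
exists (M * N) => t tab; rewrite normrM.
by apply: ler_pM => //; [exact: fM | exact: gN].
Qed.

Lemma bmZ c f a b : bm f a b -> bm (fun t => c * f t) a b.
Proof. by move=> fab; apply: bmM => //; exact: bm_cst. Qed.

Lemma bmN f a b : bm f a b -> bm (fun t => - f t) a b.
Proof.
move=> [mf [M fM]]; split; first exact: measurableT_comp.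
by exists M => t tab; rewrite normrN; exact: fM.
Qed.

Lemma bmB f g a b : bm f a b -> bm g a b -> bm (fun t => f t - g t) a b.
Proof. by move=> fab gab; apply: bmD => //; exact: bmN. Qed.

Lemma bm_integrable f a b : bm f a b ->
  lebesgue_measure.-integrable (`[a, b] : set R) (EFin \o f).
Proof.
move=> [mf [M fM]]; apply: measurable_bounded_integrable => //.
  by rewrite /= lebesgue_measure_itv/=; case: ifP => // _; rewrite -EFinB ltry.
exists `|M|; split; first exact: num_real.
by move=> x Mx y /=; rewrite in_itv/= => yab; apply: le_trans (fM _ yab) _; rewrite (le_trans (ler_norm M)) // ltW.
Qed.

Lemma continuous_bm f a b : {within `[a, b], continuous f} -> bm f a b.
Proof.
move=> cf; split.
  exact: subspace_continuous_measurable_fun.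
have /= [|M [_ H]] := @compact_bounded _ _ (f @` `[a, b]).
  by apply: continuous_compact => //; exact: segment_compact.
exists (M + 1) => t tab; apply: (H (M + 1)); first by rewrite ltrDl.
by exists t => //=; rewrite in_itv.
Qed.

(** Feedback laws are imposed before the final time only, and glued motions change their formula at
    single instants; hence end points must not matter. *)
Lemma eq_ig_oo f g a b : bm f a b -> bm g a b ->
  (forall t, a < t < b -> f t = g t) -> ig f a b = ig g a b.
Proof.
move=> fab gab fg; rewrite /ig.
have key h : bm h a b -> \int[lebesgue_measure]_(t in `[a, b]) h t =
    \int[lebesgue_measure]_(t in `]a, b[) h t.
  move=> hab; have ih := bm_integrable hab.
  rewrite -Rintegral_itv_obnd_cbnd; last first.
    by apply: integrableS ih => //; apply: subset_itv; rewrite bnd_simp.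
  rewrite -Rintegral_itv_bndo_bndc//.
  by apply: integrableS ih => //; apply: subset_itv; rewrite bnd_simp.
rewrite !key//; apply: eq_Rintegral => t; rewrite inE/= in_itv/=; exact: fg.
Qed.

Lemma eq_ig f g a b : (forall t, a <= t <= b -> f t = g t) ->
  ig f a b = ig g a b.
Proof. by move=> fg; apply: eq_Rintegral => t; rewrite inE/= in_itv/=; exact: fg. Qed.

Lemma eq_bm f g a b : (forall t, a <= t <= b -> f t = g t) ->
  bm f a b -> bm g a b.
Proof.
move=> fg [mf [M fM]]; split.
  apply: eq_measurable_fun mf => t; rewrite inE/= in_itv/=; exact: fg.
by exists M => t tab; rewrite -fg//; exact: fM.
Qed.

Lemma ig_cst c a b : a <= b -> ig (fun=> c) a b = c * (b - a).
Proof.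
move=> ab; rewrite /ig Rintegral_cst//= lebesgue_measure_itv/= lte_fin.
move: ab; rewrite le_eqVlt => /predU1P[->|ab]; first by rewrite ltxx subrr.
by rewrite ab.
Qed.

Lemma ig0 f a : ig f a a = 0.
Proof. by rewrite /ig set_itv1 Rintegral_set1. Qed.

Lemma igD f g a b : bm f a b -> bm g a b ->
  ig (fun t => f t + g t) a b = ig f a b + ig g a b.
Proof. by move=> fab gab; rewrite /ig RintegralD//; exact: bm_integrable. Qed.

Lemma igB f g a b : bm f a b -> bm g a b ->
  ig (fun t => f t - g t) a b = ig f a b - ig g a b.
Proof. by move=> fab gab; rewrite /ig RintegralB//; exact: bm_integrable. Qed.

Lemma igZ c f a b : bm f a b -> ig (fun t => c * f t) a b = c * ig f a b.
Proof. by move=> fab; rewrite /ig RintegralZl//; exact: bm_integrable. Qed.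

Lemma ig_cat f a c b : bm f a b -> a <= c -> c <= b ->
  ig f a b = ig f a c + ig f c b.
Proof.
move=> fab ac cb; have ifab := bm_integrable fab.
have := @Rintegral_itvB _ f (BLeft a) (BRight b) c ifab.
rewrite !bnd_simp => /(_ ac cb).
rewrite Rintegral_itv_obnd_cbnd; last first.
  by apply: integrableS ifab => //; apply: subset_itvr; rewrite bnd_simp.
by rewrite /ig => <-; rewrite addrC subrK.
Qed.

Lemma le_ig f g a b : bm f a b -> bm g a b ->
  (forall t, a < t < b -> f t <= g t) -> ig f a b <= ig g a b.
Proof.
move=> fab gab fg.
(* The maximum dominates f everywhere and agrees with g in the interior. *)
pose h t := Num.max (g t) (f t).
have hab : bm h a b.
  case: (fab) (gab) => mf [M fM] [mg [N gN]]; split; first exact: measurable_maxr.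
  exists (Num.max N M) => t tab; rewrite /h.
  by case: (leP (g t) (f t)) => _; rewrite le_max ?(fM _ tab) ?(gN _ tab) ?orbT.
have -> : ig g a b = ig h a b.
  by apply: eq_ig_oo => // t /fg; rewrite /h; case: leP => // fgt gft; apply/eqP; rewrite eq_le ltW.
apply: le_Rintegral => //; try exact: bm_integrable.
by move=> t _; rewrite le_max lexx orbT.
Qed.

Lemma ig_le_cst f a b M : a <= b -> bm f a b ->
  (forall t, a < t < b -> f t <= M) -> ig f a b <= M * (b - a).
Proof. by move=> ab fab fM; rewrite -ig_cst//; apply: le_ig => //; exact: bm_cst. Qed.

Lemma ig_ge_cst f a b M : a <= b -> bm f a b ->
  (forall t, a < t < b -> M <= f t) -> M * (b - a) <= ig f a b.
Proof. by move=> ab fab fM; rewrite -ig_cst//; apply: le_ig => //; exact: bm_cst. Qed.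

Lemma ig_norm_le f a b M : a <= b -> bm f a b ->
  (forall t, a < t < b -> `|f t| <= M) -> `|ig f a b| <= M * (b - a).
Proof.
move=> ab fab fM; rewrite ler_norml -mulNr; apply/andP; split.
  by apply: ig_ge_cst => // t /fM; rewrite ler_norml => /andP[].
by apply: ig_le_cst => // t /fM; rewrite ler_norml => /andP[].
Qed.

Lemma bm_oo f g a b : bm f a b -> (forall t, a < t < b -> f t = g t) ->
  bm g a b.
Proof.
move=> [mf [M fM]] fg; split; last first.
  exists (Num.max M (Num.max `|g a| `|g b|)) => t /andP[].
  rewrite le_eqVlt => /predU1P[<- _|at_]; first by rewrite !le_max lexx !orbT.
  rewrite le_eqVlt => /predU1P[->|tb]; first by rewrite !le_max lexx !orbT.
  by rewrite -fg ?at_// le_max fM// !ltW.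
have [ba|ab] := ltP b a; first by rewrite set_itv_ge ?bnd_simp -?ltNge//; exact: measurable_fun_set0.
apply/measurable_fun_itv_bndo_bndcP.
apply/measurable_fun_itv_obnd_cbndP.
apply: (@eq_measurable_fun _ _ _ _ _ f).
  by move=> t; rewrite inE/= in_itv/=; exact: fg.
by apply: measurable_funS mf => //; apply: subset_itv; rewrite bnd_simp.
Qed.

Lemma bm_cat f a c b : bm f a c -> bm f c b -> bm f a b.
Proof.
move=> [mf [M fM]] [mg [N gN]]; split; last first.
  exists (Num.max M N) => t /andP[ta tb]; rewrite le_max.
  by have [tc|/ltW ct] := leP t c; [rewrite fM ?ta|rewrite gN ?ct ?orbT].
suff : measurable_fun (`[a, c] `|` `[c, b]) f.
  apply: measurable_funS; first exact: measurableU.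
  move=> t /=; rewrite !in_itv/= => /andP[-> ->].
  by rewrite andbT; have [tc|/ltW ct] := leP (t : R) c; [left|right].
by apply/measurable_funU.
Qed.

(** Dominated convergence. That the limit is bounded and measurable is part of the conclusion, since
    limits of controls have to be admissible again. *)
Lemma ig_cvg (f : nat -> R -> R) g a b K :
  (forall n, bm (f n) a b) ->
  (forall n t, a <= t <= b -> `|f n t| <= K) ->
  (forall t, a <= t <= b -> f n t @[n --> \oo] --> g t) ->
  bm g a b /\ ig (f n) a b @[n --> \oo] --> ig g a b.
Proof.
move=> mf fK fg.
have mg : measurable_fun (`[a, b] : set R) g.
  apply: (@measurable_fun_cvg _ _ _ _ f) => //; first by move=> n; case: (mf n).
have bg : bm g a b.
  split=> //; exists K => t tab.
  have fg' : `|f n t| @[n --> \oo] --> `|g t| by apply: cvg_norm; exact: fg.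
  by apply: (cvgr_to_le fg'); apply: nearW => n; exact: fK.
split => //.
pose D : set R := `[a, b]%classic.
have mD : measurable D by exact: measurable_itv.
have H1 n : measurable_fun D (EFin \o f n).
  by apply/measurable_EFinP; case: (mf n).
have H2 : measurable_fun D (EFin \o g) by exact/measurable_EFinP.
have H3 : {ae lebesgue_measure, forall x : R, D x ->
    (fun n => (EFin \o f n) x) @ \oo --> (EFin \o g) x}.
  apply/aeW => t; rewrite /D /= in_itv/= => tab.
  by apply: cvg_EFin; [exact: nearW|exact: fg].
have H4 : lebesgue_measure.-integrable D (EFin \o fun=> K).
  exact: bm_integrable (bm_cst K a b).
have H5 : {ae lebesgue_measure, forall (x : R) n, D x ->
    (`|(EFin \o f n) x| <= (EFin \o fun=> K) x)%E}.
  by apply/aeW => t n; rewrite /D /= in_itv/= lee_fin; exact: fK.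
have [_ _ H] := @dominated_convergence _ _ R lebesgue_measure D mD (fun n => EFin \o f n) _ _ H1 H2 H3 H4 H5.
apply: fine_cvg; rewrite fineK; first exact: H.
by apply: integrable_fin_num => //; exact: bm_integrable.
Qed.

Lemma ig_lip f a b K : bm f a b ->
  (forall t, a <= t <= b -> `|f t| <= K) ->
  forall s t, a <= s -> s <= t -> t <= b -> `|ig f a t - ig f a s| <= K * (t - s).
Proof.
move=> fab fK s t as_ st tb.
have sb := le_trans st tb.
rewrite (@ig_cat f a s t)//; last exact: (bmW fab).
rewrite addrC addKr; apply: ig_norm_le => //; first exact: (bmW fab).
by move=> u /andP[u1 u2]; apply: fK; rewrite (le_trans as_) ?(le_trans (ltW u2))// ltW.
Qed.

End integrals.

(** * Extremal times and comparison by one-sided slopes *)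

Section real_line.
Context {R : realType}.
Implicit Types (P : R -> Prop) (N : R -> R) (a b t s : R).

Lemma near_rightP t (P : R -> Prop) :
  (\forall s \near t^'+, P s) <->
  exists2 d : R, 0 < d & forall s, t < s < t + d -> P s.
Proof.
split=> [|[d d0 H]].
  move=> [d /= d0 H]; exists d => // s /andP[ts st]; apply: H => //=.
  by rewrite distrC gtr0_norm ?subr_gt0// ltrBlDl.
exists d => //= s /= + ts; rewrite distrC gtr0_norm ?subr_gt0// ltrBlDl => st.
by apply: H; rewrite ts.
Qed.

Lemma near_leftP t (P : R -> Prop) :
  (\forall s \near t^'-, P s) <->
  exists2 d : R, 0 < d & forall s, t - d < s < t -> P s.
Proof.
split=> [|[d d0 H]].
  move=> [d /= d0 H]; exists d => // s /andP[ts st]; apply: H => //=.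
  by rewrite gtr0_norm ?subr_gt0// ltrBlDr -ltrBlDl.
exists d => //= s /= + ts; rewrite gtr0_norm ?subr_gt0// => st.
by apply: H; rewrite ts andbT ltrBlDr -ltrBlDl.
Qed.

(** The supremum of the times with P is such a time, because the failure of P is open to the
    left. *)
Lemma last_time P a b : a <= b -> P a ->
  (forall t, a < t <= b -> ~ P t -> \forall s \near t^'-, ~ P s) ->
  exists t, [/\ a <= t <= b, P t & forall s, t < s <= b -> ~ P s].
Proof.
move=> ab Pa Pcl; pose S := [set t | a <= t <= b /\ P t].
have Sa : S a by split => //; rewrite lexx.
have Sub : ubound S b by move=> t [/andP[]].
have hS : has_sup S by split; [exists a | exists b].
have aS : a <= sup S by apply: sup_upper_bound.
have Sb : sup S <= b by apply: ge_sup => //; exists a.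
exists (sup S); split; first by rewrite aS.
  apply: contrapT => nP; have ltaS : a < sup S.
    by rewrite lt_neqAle aS andbT; apply/eqP => E; apply: nP; rewrite -E.
  have /near_leftP[d d0 H] := Pcl _ (introT andP (conj ltaS Sb)) nP.
  have [t [tab Pt] St] := sup_adherent d0 hS.
  have tS : t <= sup S by apply: sup_upper_bound.
  apply: (H t) => //; rewrite St/= lt_neqAle tS andbT.
  by apply/eqP => E; apply: nP; rewrite -E.
move=> s /andP[Ss sb] Ps; have := Ss; apply/negP; rewrite -leNgt.
apply: sup_upper_bound => //; split => //; rewrite sb andbT.
exact: le_trans aS (ltW Ss).
Qed.

Lemma first_time P a b : a <= b -> P b ->
  (forall t, a <= t < b -> ~ P t -> \forall s \near t^'+, ~ P s) ->
  exists t, [/\ a <= t <= b, P t & forall s, a <= s < t -> ~ P s].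
Proof.
move=> ab Pb Pcl.
(* Time reversal turns the last time into the first one. *)
have [|||t [tab Pt tP]] := @last_time (P \o -%R) (- b) (- a).
- by rewrite lerN2.
- by rewrite /= opprK.
- move=> t /andP[bt ta] nP.
  have [|d d0 H] := (near_rightP _ _).1 (Pcl (- t) _ nP).
    by rewrite lerNr ta/= ltrNl.
  apply/near_leftP; exists d => // s /andP[s1 s2]; apply: H.
  by rewrite ltrN2 s2/= ltrNl opprD opprK.
- exists (- t); split => //; first by move: tab; rewrite lerNl lerNr andbC.
  move=> s /andP[s1 s2] Ps; apply: (tP (- s)); last by rewrite /= opprK.
  by rewrite ltrNr s2 lerN2.
Qed.

(** Continuous induction on N s <= N a + e (s - a), then e tends to 0. The slope condition prolongs
    the inequality to the right; the second condition forbids an upward jump when a time is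
    approached from the left. *)
Lemma dini_le N a b : a <= b ->
  (forall t e, a <= t < b -> 0 < e ->
     \forall s \near t^'+, N s <= N t + e * (s - t)) ->
  (forall t e, a < t <= b -> 0 < e -> \forall s \near t^'-, N t <= N s + e) ->
  N b <= N a.
Proof.
move=> ab Nr Nl; suff H e : 0 < e -> N b <= N a + e * (b - a).
  apply/ler_addgt0Pr => e e0.
  have k0 : 0 < b - a + 1 by rewrite ltr_wpDl// subr_ge0.
  apply: le_trans (H (e / (b - a + 1)) _) _; first by rewrite divr_gt0.
  rewrite lerD2l mulrAC ler_pdivrMr// ler_pM2l// lerDl//.
move=> e0; pose P t := forall s, a <= s <= t -> N s <= N a + e * (s - a).
have Pa : P a by move=> s /le_anti <-; rewrite subrr mulr0 addr0.
have [//|//||t [/andP[at_ tb] Pt tP]] := @last_time P a b.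
  move=> t /andP[lat tb] nP; apply: contrapT => nnear; apply: nP => s /andP[as_].
  rewrite le_eqVlt => /predU1P[->|st]; last first.
    apply: contrapT => nNs; apply: nnear; apply/near_leftP.
    exists (t - s); first by rewrite subr_gt0.
    move=> u; rewrite subKr => /andP[su ut] Pu; apply: nNs; apply: Pu.
    by rewrite as_ ltW.
  apply/ler_addgt0Pr => h h0.
  have /near_leftP[d d0 H] := Nl t h (introT andP (conj lat tb)) h0.
  apply: contrapT => /negP; rewrite -ltNge => NtE; apply: nnear; apply/near_leftP.
  pose d' := Num.min d (t - a).
  exists d'; first by rewrite lt_min d0 subr_gt0.
  move=> u /andP[u1 ut] Pu.
  have au : a <= u.
    rewrite ltW// (le_lt_trans _ u1)// lerBrDr -lerBrDl ge_min lexx orbT//.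
  have : N t <= N u + h.
    by apply: H; rewrite ut andbT (le_lt_trans _ u1)// lerD2l lerN2 ge_min lexx.
  have : N u <= N a + e * (u - a) by apply: Pu; rewrite au lexx.
  have : e * (u - a) <= e * (t - a) by rewrite ler_pM2l// lerD2r ltW.
  lin.
move: tb; rewrite le_eqVlt => /predU1P[tb|tb].
  by apply: Pt; rewrite tb lexx ab.
exfalso; have /near_rightP[d d0 H] := Nr t e (introT andP (conj at_ tb)) e0.
pose u := Num.min (t + d / 2) b.
have tu : t < u by rewrite lt_min tb andbT ltrDl divr_gt0.
apply: (tP u); first by rewrite tu ge_min lexx orbT.
move=> s /andP[as_ su]; have [st|ts] := leP s t; first by apply: Pt; rewrite as_.
have -> : e * (s - a) = e * (t - a) + e * (s - t) by ring.
have : N s <= N t + e * (s - t).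
  apply: H; rewrite ts/= (le_lt_trans su)// (@le_lt_trans _ _ (t + d / 2))//.
    by rewrite ge_min lexx.
  by rewrite ltrD2l; lin.
have : N t <= N a + e * (t - a) by apply: Pt; rewrite at_ lexx.
lin.
Qed.

End real_line.

(** * Existence theorems for differential equations *)

Section euler.
Context {R : realType}.
Implicit Types (a b c K t s : R).

Section polygon.
Variables (F1 F2 : R -> R -> R * R -> R) (t0 x0 y0 h : R).

Definition grid (k : nat) : R := t0 + k%:R * h.

(** In [F u s X] the time u and the point X are frozen at the last grid point while s runs. Peano's
    theorem freezes the time as well; the scalar equation freezes X only, because its right-hand
    side is merely measurable in time. *)
Fixpoint node (k : nat) : R * R :=
  if k is k'.+1 then
    ((node k').1 + ig (fun s => F1 (grid k') s (node k')) (grid k') (grid k'.+1),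
     (node k').2 + ig (fun s => F2 (grid k') s (node k')) (grid k') (grid k'.+1))
  else (x0, y0).

Definition cell s : nat := Num.truncn ((s - t0) / h).

Definition vel (F : R -> R -> R * R -> R) s : R :=
  F (grid (cell s)) s (node (cell s)).

Hypothesis h0 : 0 < h.

Lemma grid_le k k' : (grid k <= grid k') = (k <= k')%N.
Proof. by rewrite lerD2l ler_pM2r// ler_nat. Qed.

Lemma grid0 : grid 0 = t0.
Proof. by rewrite /grid mul0r addr0. Qed.

Lemma cellP k s : grid k <= s < grid k.+1 -> cell s = k.
Proof.
move=> /andP[ks sk]; apply: truncn_def.
rewrite ler_pdivlMr// ltr_pdivrMr//.
by rewrite lerBrDl ks ltrBlDl.
Qed.

Lemma cell_itv s : t0 <= s -> grid (cell s) <= s < grid (cell s).+1.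
Proof.
move=> ts; have /andP[c1 c2] : (cell s)%:R <= (s - t0) / h < (cell s).+1%:R.
  by apply: truncn_itv; rewrite divr_ge0 ?subr_ge0// ltW.
move: c1 c2; rewrite ler_pdivlMr// ltr_pdivrMr// /grid.
by rewrite lerBrDl ltrBlDl => -> ->.
Qed.

Lemma vel_bm F b : (forall u X, bm (fun s => F u s X) t0 b) -> bm (vel F) t0 b.
Proof.
move=> mF; have [bt|tb] := ltP b t0.
  split; last by exists 0 => s /andP[s1 s2]; have := lt_le_trans bt (le_trans s1 s2); rewrite ltxx.
  by rewrite set_itv_ge ?bnd_simp -?ltNge//; exact: measurable_fun_set0.
have piece k c : c <= grid k.+1 -> c <= b -> bm (vel F) (grid k) c.
  move=> ck cb; apply: (@bm_oo _ (fun s => F (grid k) s (node k))).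
    by apply: (bmW (mF _ _)) => //; rewrite -grid0 grid_le.
  by move=> s /andP[s1 s2]; rewrite /vel (@cellP k)// ltW//= (lt_le_trans s2).
have all k : grid k <= b -> bm (vel F) t0 (grid k).
  elim: k => [_|k IH kb].
    rewrite grid0; have := @piece 0%N t0; rewrite grid0; apply=> //.
    by rewrite -grid0 grid_le.
  have kb' : grid k <= b by rewrite (le_trans _ kb)// grid_le.
  by apply: (bm_cat (IH kb')); apply: piece.
have /andP[c1 c2] := cell_itv tb.
by apply: (bm_cat (all _ c1)); apply: piece => //; exact: ltW.
Qed.

Hypothesis mF1 : forall u X b, bm (fun s => F1 u s X) t0 b.
Hypothesis mF2 : forall u X b, bm (fun s => F2 u s X) t0 b.

Lemma node_ig k : node k = (x0 + ig (vel F1) t0 (grid k), y0 + ig (vel F2) t0 (grid k)).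
Proof.
elim: k => [|k IH]; first by rewrite grid0 !ig0 !addr0.
have step F : (forall u X b, bm (fun s => F u s X) t0 b) ->
    ig (vel F) t0 (grid k.+1) = ig (vel F) t0 (grid k) +
      ig (fun s => F (grid k) s (node k)) (grid k) (grid k.+1).
  move=> mF; rewrite (@ig_cat _ _ _ (grid k)) ?grid_le//; last 2 first.
  - exact: vel_bm.
  - by rewrite -{1}grid0 grid_le.
  congr (_ + _); apply: eq_ig_oo.
  - by apply: (bmW (@vel_bm F (grid k.+1) (fun u X => mF u X _))) => //; rewrite -{1}grid0 grid_le.
  - by apply: (bmW (mF _ _ (grid k.+1))) => //; rewrite -{1}grid0 grid_le.
  by move=> s /andP[s1 s2]; rewrite /vel (@cellP k)// ltW.
by rewrite [LHS]/= -/(node k) !step// {1 3}IH /= !addrA.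
Qed.

End polygon.

Lemma euler_polygon (F1 F2 : R -> R -> R * R -> R) t0 x0 y0 h : 0 < h ->
  (forall u X b, bm (fun s => F1 u s X) t0 b) ->
  (forall u X b, bm (fun s => F2 u s X) t0 b) ->
  exists v1 v2 tau : R -> R,
    let x t := x0 + ig v1 t0 t in let y t := y0 + ig v2 t0 t in
    [/\ forall b, bm v1 t0 b, forall b, bm v2 t0 b,
      forall s, t0 <= s -> t0 <= tau s <= s /\ s - tau s < h,
      forall s, t0 <= s -> v1 s = F1 (tau s) s (x (tau s), y (tau s)) &
      forall s, t0 <= s -> v2 s = F2 (tau s) s (x (tau s), y (tau s))].
Proof.
move=> h0 mF1 mF2.
pose X := node F1 F2 t0 x0 y0 h.
exists (vel F1 F2 t0 x0 y0 h F1), (vel F1 F2 t0 x0 y0 h F2),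
  (fun s => grid t0 h (cell t0 h s)) => x y; split.
- by move=> b; exact: vel_bm.
- by move=> b; exact: vel_bm.
- move=> s ts; have /andP[c1 c2] := cell_itv h0 ts; rewrite c1 andbT; split.
    by rewrite -{1}(grid0 t0 h) grid_le.
  move: c2; rewrite /grid -natr1 mulrDl mul1r; lin.
- by move=> s ts; rewrite /vel {1}node_ig.
- by move=> s ts; rewrite /vel {1}node_ig.
Qed.

End euler.

(** * Peano's theorem for two unknowns *)

Section peano.
Context {R : realType}.
Implicit Types (a b c d e K t s : R).

(** Along an ultrafilter all bounded sequences converge at once, so no subsequence of polygons has
    to be extracted. *)
Lemma ultra_bounded_cvg (U : set_system nat) (u : nat -> R) (M : R) :
  UltraFilter U -> (forall n, `|u n| <= M) -> cvg (u n @[n --> U]).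
Proof.
move=> UU uM.
have cM : compact (`[- M, M] : set R) by exact: segment_compact.
rewrite compact_ultra in cM.
have UF : UltraFilter (u @ U).
  split; first exact: fmap_proper_filter.
  move=> G GG sG; apply/seteqP; split => // A GA.
  have [//|UA] := in_ultra_setVsetC (u @^-1` A) UU.
  have GnA : G (~` A) by exact: sG.
  have [] := @filter_not_empty _ G GG.
  by rewrite -(setICr A); exact: filterI.
have [|p [_ Up]] := cM (u @ U) UF.
  apply: (@filterE _ U) => n; rewrite /= in_itv/=.
  by have := uM n; rewrite ler_norml.
by apply/cvg_ex; exists p.
Qed.

Lemma ig_close (v : R -> R) a b c e : a <= b -> bm v a b ->
  (forall s, a < s < b -> `|v s - c| <= e) -> `|ig v a b - (b - a) * c| <= e * (b - a).
Proof.
move=> ab bv vc; rewrite (mulrC _ c) -(@ig_cst _ c)// -igB//; last exact: bm_cst.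
by apply: ig_norm_le => //; apply: bmB => //; exact: bm_cst.
Qed.

(** The field may be discontinuous. The equation is claimed at those times only at which the field
    is jointly continuous at the point of the curve, and there as a strict derivative, with both
    ends of the increment varying. *)
Theorem peano (f1 f2 : R -> R -> R -> R) K t0 x0 y0 : 0 <= K ->
  (forall t p q, `|f1 t p q| <= K) -> (forall t p q, `|f2 t p q| <= K) ->
  exists x y : R -> R,
    [/\ x t0 = x0, y t0 = y0,
      forall a b, t0 <= a -> a <= b -> `|x b - x a| <= K * (b - a),
      forall a b, t0 <= a -> a <= b -> `|y b - y a| <= K * (b - a) &
      forall t, t0 <= t ->
        (forall e, 0 < e -> exists2 d : R, 0 < d & forall s p q, `|s - t| < d ->
          `|p - x t| < d -> `|q - y t| < d ->
          `|f1 s p q - f1 t (x t) (y t)| <= e /\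
          `|f2 s p q - f2 t (x t) (y t)| <= e) ->
        forall e, 0 < e -> exists2 d : R, 0 < d & forall a b, t0 <= a -> a <= b ->
          t - d < a -> b < t + d ->
          `|x b - x a - (b - a) * f1 t (x t) (y t)| <= e * (b - a) /\
          `|y b - y a - (b - a) * f2 t (x t) (y t)| <= e * (b - a)].
Proof.
move=> K0 f1K f2K.
pose F1 (u s : R) (X : R * R) := f1 u X.1 X.2.
pose F2 (u s : R) (X : R * R) := f2 u X.1 X.2.
have /choice[v1 H] : forall n : nat, exists v1, exists v2 tau : R -> R,
    let x t := x0 + ig v1 t0 t in let y t := y0 + ig v2 t0 t in
    [/\ forall b, bm v1 t0 b, forall b, bm v2 t0 b,
      forall s, t0 <= s -> t0 <= tau s <= s /\ s - tau s < n.+1%:R^-1,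
      forall s, t0 <= s -> v1 s = F1 (tau s) s (x (tau s), y (tau s)) &
      forall s, t0 <= s -> v2 s = F2 (tau s) s (x (tau s), y (tau s))].
  by move=> n; apply: euler_polygon => // u X b; exact: bm_cst.
have {H} /choice[v2 /choice[tau H]] := H.
pose xn n t := x0 + ig (v1 n) t0 t; pose yn n t := y0 + ig (v2 n) t0 t.
have v1K n s : t0 <= s -> `|v1 n s| <= K by case: (H n) => _ _ _ E _ /E ->; exact: f1K.
have v2K n s : t0 <= s -> `|v2 n s| <= K by case: (H n) => _ _ _ _ E /E ->; exact: f2K.
have xnD n a b : t0 <= a -> a <= b -> xn n b - xn n a = ig (v1 n) a b.
  move=> ta ab; case: (H n) => mv1 _ _ _ _.
  by rewrite /xn (@ig_cat _ _ _ a b (mv1 b))//; ring.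
have ynD n a b : t0 <= a -> a <= b -> yn n b - yn n a = ig (v2 n) a b.
  move=> ta ab; case: (H n) => _ mv2 _ _ _.
  by rewrite /yn (@ig_cat _ _ _ a b (mv2 b))//; ring.
have xnL n a b : t0 <= a -> a <= b -> `|xn n b - xn n a| <= K * (b - a).
  move=> ta ab; rewrite /xn opprD addrACA subrr add0r.
  case: (H n) => mv1 _ _ _ _.
  by apply: (ig_lip (mv1 b)) => // t /andP[? _]; exact: v1K.
have ynL n a b : t0 <= a -> a <= b -> `|yn n b - yn n a| <= K * (b - a).
  move=> ta ab; rewrite /yn opprD addrACA subrr add0r.
  case: (H n) => _ mv2 _ _ _.
  by apply: (ig_lip (mv2 b)) => // t /andP[? _]; exact: v2K.
have [U [UU subU]] := ultraFilterLemma (@eventually_filter).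
have xcvg t : t0 <= t -> cvg (xn n t @[n --> U]).
  move=> tt; apply: (@ultra_bounded_cvg _ _ (`|x0| + K * (t - t0))) => // n.
  have := xnL n _ _ (lexx t0) tt; rewrite {2}/xn ig0 addr0 => E.
  rewrite -(subrK x0 (xn n t)) addrC; apply: le_trans (ler_normD _ _) _.
  by rewrite lerD2l.
have ycvg t : t0 <= t -> cvg (yn n t @[n --> U]).
  move=> tt; apply: (@ultra_bounded_cvg _ _ (`|y0| + K * (t - t0))) => // n.
  have := ynL n _ _ (lexx t0) tt; rewrite {2}/yn ig0 addr0 => E.
  rewrite -(subrK y0 (yn n t)) addrC; apply: le_trans (ler_normD _ _) _.
  by rewrite lerD2l.
pose x t : R := lim (xn n t @[n --> U]); pose y t : R := lim (yn n t @[n --> U]).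
have xlim t : t0 <= t -> xn n t @[n --> U] --> x t by move=> tt; exact: xcvg.
have ylim t : t0 <= t -> yn n t @[n --> U] --> y t by move=> tt; exact: ycvg.
have xL a b : t0 <= a -> a <= b -> `|x b - x a| <= K * (b - a).
  move=> ta ab; have tb := le_trans ta ab.
  have C : `|xn n b - xn n a| @[n --> U] --> `|x b - x a|.
    by apply: cvg_norm; apply: cvgB; exact: xlim.
  by apply: (cvgr_to_le C); apply: filterE => n; exact: xnL.
have yL a b : t0 <= a -> a <= b -> `|y b - y a| <= K * (b - a).
  move=> ta ab; have tb := le_trans ta ab.
  have C : `|yn n b - yn n a| @[n --> U] --> `|y b - y a|.
    by apply: cvg_norm; apply: cvgB; exact: ylim.
  by apply: (cvgr_to_le C); apply: filterE => n; exact: ynL.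
exists x, y; split => //.
- rewrite /x; have -> : xn ^~ t0 = fun=> x0 by apply/funext => n; rewrite /xn ig0 addr0.
  exact: lim_cst.
- rewrite /y; have -> : yn ^~ t0 = fun=> y0 by apply/funext => n; rewrite /yn ig0 addr0.
  exact: lim_cst.
move=> t tt cont e e0.
have [d d0 fd] := cont e e0.
(* The delayed time lies within 2 d' of t, one d' for s and one for the lag. In that time a polygon
   moves by at most 2 K d' = d / 2 - 2 d', which together with the distance d / 2 to the limit stays
   below d. *)
pose d' := d / (2 * (2 * K + 2)).
have d'0 : 0 < d' by rewrite divr_gt0// mulr_gt0// ltr_wpDl// mulr_ge0.
have Ed' : d' * (2 * K + 2) = d / 2.
  by rewrite /d'; field; apply/eqP; lin.
have Kd' : 0 <= d' * K by rewrite mulr_ge0// ltW.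
exists d' => // a b ta ab ta' tb'.
have tb := le_trans ta ab.
have good : \forall n \near U, forall s, a <= s <= b ->
    `|v1 n s - f1 t (x t) (y t)| <= e /\ `|v2 n s - f2 t (x t) (y t)| <= e.
  have N1 : \forall n \near U, n.+1%:R^-1 < d'.
    apply: subU; exact: near_infty_natSinv_lt (PosNum d'0).
  have N2 : \forall n \near U, `|x t - xn n t| < d / 2.
    by have /cvgrPdist_lt := xlim _ tt; apply; rewrite divr_gt0.
  have N3 : \forall n \near U, `|y t - yn n t| < d / 2.
    by have /cvgrPdist_lt := ylim _ tt; apply; rewrite divr_gt0.
  near=> n => s /andP[as_ sb].
  have n1 : n.+1%:R^-1 < d' by near: n.
  have n2 : `|x t - xn n t| < d / 2 by near: n.
  have n3 : `|y t - yn n t| < d / 2 by near: n.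
  have ts := le_trans ta as_.
  case: (H n) => _ _ /(_ _ ts)[/andP[tau1 tau2] tau3] E1 E2.
  rewrite E1// E2//.
  set u := tau n s in tau1 tau2 tau3 *.
  have {}tau3 := lt_trans tau3 n1.
  have ut : `|u - t| < 2 * d'.
    by move: tau1 tau2 tau3 as_ sb ta' tb' d'0; rewrite ltr_norml; lin_goal.
  have dK : K * (2 * d') = d / 2 - d' * 2 by rewrite -Ed'; ring.
  have tri (z : R -> R) (zn : R -> R) : (forall a b, t0 <= a -> a <= b -> `|zn b - zn a| <= K * (b - a)) ->
      `|z t - zn t| < d / 2 -> `|zn u - z t| < d.
    move=> zL zt.
    have : `|zn u - zn t| <= K * (2 * d').
      have [ut'|/ltW ut'] := leP u t.
        rewrite distrC; apply: le_trans (zL _ _ _ _) _ => //.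
        by rewrite ler_wpM2l//; move: ut; rewrite ltr_norml; lin_goal.
      apply: le_trans (zL _ _ _ _) _ => //.
      by rewrite ler_wpM2l//; move: ut; rewrite ltr_norml; lin_goal.
    have := ler_normD (zn u - zn t) (zn t - z t).
    by rewrite addrA subrK (distrC (zn t)) dK; move: zt d'0; lin_goal.
  apply: fd => //=.
  - have : d' * 2 <= d / 2 by lin.
    lin.
  - exact: (tri x (xn n) (xnL n) n2).
  - exact: (tri y (yn n) (ynL n) n3).
have ab' : 0 <= b - a by rewrite subr_ge0.
split.
- have C : `|xn n b - xn n a - (b - a) * f1 t (x t) (y t)| @[n --> U] -->
      `|x b - x a - (b - a) * f1 t (x t) (y t)|.
    by apply: cvg_norm; apply: cvgB; [apply: cvgB; exact: xlim|exact: cvg_cst].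
  apply: (cvgr_to_le C); near=> n.
  have g : forall s, a <= s <= b ->
    `|v1 n s - f1 t (x t) (y t)| <= e /\ `|v2 n s - f2 t (x t) (y t)| <= e by near: n.
  case: (H n) => mv1 mv2 _ _ _.
  rewrite xnD//.
  apply: ig_close => //; first exact: (bmW (mv1 b)).
  by move=> s /andP[s1 s2]; have /g[] : a <= s <= b by rewrite !ltW.
- have C : `|yn n b - yn n a - (b - a) * f2 t (x t) (y t)| @[n --> U] -->
      `|y b - y a - (b - a) * f2 t (x t) (y t)|.
    by apply: cvg_norm; apply: cvgB; [apply: cvgB; exact: ylim|exact: cvg_cst].
  apply: (cvgr_to_le C); near=> n.
  have g : forall s, a <= s <= b ->
    `|v1 n s - f1 t (x t) (y t)| <= e /\ `|v2 n s - f2 t (x t) (y t)| <= e by near: n.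
  case: (H n) => mv1 mv2 _ _ _.
  rewrite ynD//.
  apply: ig_close => //; first exact: (bmW (mv2 b)).
  by move=> s /andP[s1 s2]; have /g[] : a <= s <= b by rewrite !ltW.
Unshelve. all: by end_near.
Qed.

End peano.

(** * Scalar equations with a semicontinuous right-hand side *)

Section scalar_ode.
Context {R : realType}.
Implicit Types (a b c d e K B w t s x y : R).

Section window.
Variables (g : R -> R -> R) (K : R).
Hypothesis gK : forall t x, `|g t x| <= K.

(** The default [- K] is below every value of g and leaves the supremum unchanged. *)
Definition win_seq w c (n : nat) t : R :=
  if @unpickle rat n is Some q then
    if `|ratr q - c| < w then g t (ratr q) else - K
  else - K.

(* Ranging over rational points only keeps [win w c] measurable in [t]. *)
Definition win w c t : R := sups (fun n => win_seq w c n t) 0%N.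

Lemma win_seqK w c n t : - K <= win_seq w c n t <= K.
Proof.
have K0 : 0 <= K by exact: le_trans (normr_ge0 _) (gK 0 0).
rewrite /win_seq; case: unpickle => [q|]; last by rewrite lexx ge0_cp.
case: ifP => _; last by rewrite lexx ge0_cp.
by rewrite -ler_norml.
Qed.

Lemma win_seq_ub w c t : has_ubound (range (fun n => win_seq w c n t)).
Proof. by exists K => _ [n _ <-]; case/andP: (win_seqK w c n t). Qed.

(** Lower semicontinuity from the right carries the value at y over to a rational point just above
    y. *)
Lemma win_ge w c t y : (forall e, 0 < e -> exists2 d : R, 0 < d &
    forall z, y <= z < y + d -> g t y <= g t z + e) ->
  `|y - c| < w -> g t y <= win w c t.
Proof.
move=> rc yw; apply/ler_addgt0Pr => e e0.
have [d d0 dP] := rc e e0.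
have lt1 : y < Num.min (y + d) (c + w).
  rewrite lt_min ltrDl d0/=; move: yw; rewrite ltr_norml => /andP[_]; lin.
have [q] := rat_in_itvoo lt1; rewrite in_itv/= lt_min => /and3P[q1 q2 q3].
apply: le_trans (dP (ratr q) _) _; first by rewrite ltW.
rewrite lerD2r; apply: (@le_trans _ _ (win_seq w c (pickle q) t)).
  rewrite /win_seq pickleK ifT//; move: yw; rewrite !ltr_norml => /andP[y1 y2].
  by apply/andP; split; lin.
apply: ub_le_sup; first exact/has_ubound_sdrop/win_seq_ub.
by exists (pickle q).
Qed.

Lemma win_le w c t B : 0 < w -> (forall y, `|y - c| < w -> g t y <= B) ->
  win w c t <= B.
Proof.
move=> w0 gB; apply: ge_sup.
  by exists (win_seq w c 0 t), 0%N.
have KB : - K <= B.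
  apply: le_trans (gB c _); last by rewrite subrr normr0.
  by have := gK t c; rewrite ler_norml => /andP[].
move=> _ [n _ <-]; rewrite /win_seq; case: unpickle => // q.
by case: ifP => // qw; exact: gB.
Qed.

Lemma winK w c t : `|win w c t| <= K.
Proof.
rewrite ler_norml; apply/andP; split.
  have /andP[h _] := win_seqK w c 0 t.
  apply: le_trans h _; apply: ub_le_sup; last by exists 0%N.
  exact/has_ubound_sdrop/win_seq_ub.
apply: ge_sup; first by exists (win_seq w c 0 t), 0%N.
by move=> _ [n _ <-]; case/andP: (win_seqK w c n t).
Qed.

Lemma win_bm w c a b : (forall x, bm (fun t => g t x) a b) -> bm (win w c) a b.
Proof.
move=> mg; split; last by exists K => t _; exact: winK.
apply: measurable_fun_sups => [t _|n]; first exact: win_seq_ub.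
rewrite /win_seq; case: unpickle => [q|]; last exact: measurable_cst.
case: (`|ratr q - c| < w); last exact: measurable_cst.
by case: (mg (ratr q)).
Qed.

End window.

(* The Euler polygons with right-hand side [win w] decrease as the mesh and the
   window [w] shrink together. Their limit satisfies the equation: upper
   semicontinuity bounds its velocity from above, and since it is approached from
   above, lower semicontinuity from the right bounds it from below. *)
Theorem usc_ode (g : R -> R -> R) K T0 T1 x0 : T0 <= T1 ->
  (forall t x, `|g t x| <= K) ->
  (forall x, bm (fun t => g t x) T0 T1) ->
  (forall t x e, T0 <= t <= T1 -> 0 < e -> exists2 d : R, 0 < d &
     forall y, `|y - x| < d -> g t y <= g t x + e) ->
  (forall t x e, T0 <= t <= T1 -> 0 < e -> exists2 d : R, 0 < d &
     forall y, x <= y < x + d -> g t x <= g t y + e) ->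
  exists p : R -> R, bm (fun t => g t (p t)) T0 T1 /\
    forall t, T0 <= t <= T1 -> p t = x0 + ig (fun s => g s (p s)) T0 t.
Proof.
move=> T01 gK mg usc rc.
have K0 : 0 <= K by exact: le_trans (normr_ge0 _) (gK 0 0).
(* The velocity of polygon k is at least g within [q k] of the polygon, and at most the supremum of
   g within [3 * q k]. Since 3 q (k+1) + q k / 4 = q k, polygon k+1 cannot overtake polygon k while
   the two are at most q k / 4 apart; hence the ratio 1/4. *)
pose q (k : nat) : R := 4^-1 ^+ k.
have q0 k : 0 < q k by rewrite exprn_gt0// invr_gt0.
have qS k : q k.+1 = q k / 4 by rewrite /q exprS mulrC.
pose h k := q k / (K + 1).
have K1 : 0 < K + 1 by lin.
have h0 k : 0 < h k by rewrite divr_gt0.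
have hK k : K * h k <= q k.
  rewrite /h mulrCA; apply: ler_piMr; first exact: ltW.
  by rewrite ler_pdivrMr//; lin.
(* The last node lies within [q k] of the current point, so a window of twice that size covers the
   radius [q k] around it. Measurability of g is known up to T1 only. *)
pose F k (u s : R) (X : R * R) := if s <= T1 then win g K (2 * q k) X.1 s else 0.
have mF k u X b : bm (fun s => F k u s X) T0 b.
  apply: (@bm_cat _ _ _ T1).
    apply: (@eq_bm _ (win g K (2 * q k) X.1)); last exact: win_bm.
    by move=> t /andP[_ t1]; rewrite /F t1.
  apply: (@bm_oo _ (fun=> 0)); first exact: bm_cst.
  by move=> t /andP[t1 _]; rewrite /F leNgt t1.
have /choice[v H] : forall k : nat, exists v1, exists2 tau : R -> R,
    (forall b, bm v1 T0 b) &
    forall s, T0 <= s -> [/\ T0 <= tau s <= s, s - tau s < h k &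
      v1 s = F k (tau s) s (x0 + ig v1 T0 (tau s), 0)].
  move=> k.
  have [||v1 [v2 [tau [m1 _ t1 E1 _]]]] := @euler_polygon _ (F k) (fun _ _ _ => 0) T0 x0 0 (h k) (h0 k).
  - by move=> u X b; exact: mF.
  - by move=> u X b; exact: bm_cst.
  exists v1, tau => // s Ts; have [t2 t3] := t1 s Ts; split => //.
  by rewrite E1//.
pose p k t := x0 + ig (v k) T0 t.
have vb k b : bm (v k) T0 b by case: (H k).
have vK k s : T0 <= s -> `|v k s| <= K.
  case: (H k) => tau _ E Ts; have [_ _ ->] := E s Ts; rewrite /F.
  by case: ifP => _; rewrite ?normr0//; exact: winK.
have pD k a b : T0 <= a -> a <= b -> p k b - p k a = ig (v k) a b.
  by move=> ta ab; rewrite /p (@ig_cat _ _ _ a b (vb k b))//; ring.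
have pL k a b : T0 <= a -> a <= b -> `|p k b - p k a| <= K * (b - a).
  move=> ta ab; rewrite pD//; apply: ig_norm_le => //.
    exact: bmW (vb k b) ta (lexx _).
  by move=> s /andP[s1 _]; apply: vK; rewrite (le_trans ta)// ltW.
have near_tau k s : T0 <= s -> exists u, [/\ T0 <= u, `|p k u - p k s| < q k & v k s = F k u s (p k u, 0)].
  move=> Ts; case: (H k) => tau _ /(_ s Ts)[/andP[t1 t2] t3 E].
  exists (tau s); split => //; rewrite distrC; apply: le_lt_trans (pL _ _ _ _ _) _ => //.
  have [Kp|Kp] := ltP 0 K.
    by apply: lt_le_trans (hK k); rewrite ltr_pM2l.
  have -> : K = 0 by apply/eqP; rewrite eq_le Kp K0.
  by rewrite mul0r.
have lower k s y : T0 <= s <= T1 -> `|y - p k s| < q k -> g s y <= v k s.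
  move=> /andP[s1 s2] ys; have [u [u1 u2 ->]] := near_tau k s s1.
  rewrite /F s2; apply: (@win_ge _ _ gK).
    by move=> e e0; apply: rc => //; rewrite s1.
  have := ler_normD (y - p k s) (p k s - p k u).
  rewrite addrA subrK (distrC (p k s)); rewrite /=; move: ys u2; lin.
have upper k s B : T0 <= s <= T1 ->
    (forall y, `|y - p k s| < 3 * q k -> g s y <= B) -> v k s <= B.
  move=> /andP[s1 s2] gB; have [u [u1 u2 ->]] := near_tau k s s1.
  rewrite /F s2; apply: (win_le gK); first by rewrite mulr_gt0.
  move=> y /= yu; apply: gB.
  have := ler_normD (y - p k u) (p k u - p k s).
  rewrite addrA subrK; move: yu u2; lin.
have decr k t : T0 <= t <= T1 -> p k.+1 t <= p k t.
  move=> /andP[t1 t2]; rewrite leNgt; apply/negP => lt.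
  pose P s := p k.+1 s <= p k s.
  have [||s0 [/andP[s1 s2] s3 s4]] := @last_time _ P T0 t t1.
  - by rewrite /P /p !ig0.
  - move=> s /andP[sT st] /negP; rewrite -ltNge => ps.
    pose D := p k.+1 s - p k s.
    have D0 : 0 < D by rewrite subr_gt0.
    apply/near_leftP; exists (Num.min (s - T0) (D / (2 * K + 1))).
      by rewrite lt_min subr_gt0 sT divr_gt0//; lin.
    move=> u /andP[u1 u2]; apply/negP; rewrite -ltNge.
    have Tu : T0 <= u.
      have : Num.min (s - T0) (D / (2 * K + 1)) <= s - T0 by rewrite ge_min lexx.
      lin.
    have uD : (s - u) * (2 * K + 1) < D.
      rewrite -ltr_pdivlMr//; last by lin.
      have : Num.min (s - T0) (D / (2 * K + 1)) <= D / (2 * K + 1) by rewrite ge_min lexx orbT.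
      lin.
    have := pL k u s Tu (ltW u2); have := pL k.+1 u s Tu (ltW u2).
    rewrite !ler_norml => /andP[_ h1] /andP[h2 _].
    have su : 0 < s - u by rewrite subr_gt0.
    rewrite /D in uD; lin.
  have s0t : s0 < t.
    rewrite lt_neqAle s2 andbT; apply/eqP => E; move: s3; rewrite /P E leNgt lt//.
  (* Polygons that meet at s0 are at most 2 K d <= q k / 4 apart during the time d. *)
  pose d := q k / (8 * K + 8).
  have d0 : 0 < d by rewrite divr_gt0//; lin.
  have Ed : d * (8 * K + 8) = q k by rewrite /d; field; apply/eqP; lin.
  pose s5 := Num.min t (s0 + d).
  have s05 : s0 < s5 by rewrite lt_min s0t ltrDl.
  have s5t : s5 <= t by rewrite ge_min lexx.
  have s5d : s5 <= s0 + d by rewrite ge_min lexx orbT.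
  have dK : 0 <= d * K by rewrite mulr_ge0// ltW.
  apply: (s4 s5); first by rewrite s05.
  rewrite /P; have := pD k s0 s5 s1 (ltW s05); have := pD k.+1 s0 s5 s1 (ltW s05).
  have : ig (v k.+1) s0 s5 <= ig (v k) s0 s5.
    apply: le_ig; [exact: bmW (vb _ s5) s1 (lexx _)|exact: bmW (vb _ s5) s1 (lexx _)|].
    move=> s /andP[ss1 ss2].
    have Ts : T0 <= s by rewrite (le_trans s1)// ltW.
    have sT1 : s <= T1 by rewrite (le_trans _ t2)// (le_trans _ s5t)// ltW.
    apply: upper; first by rewrite Ts.
    move=> y ys; apply: lower; first by rewrite Ts.
    have : `|p k.+1 s - p k s| <= q k / 4.
      have lt' : p k s < p k.+1 s.
        by rewrite ltNge; apply/negP; apply: s4; rewrite ss1 (le_trans _ s5t)// ltW.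
      rewrite gtr0_norm ?subr_gt0//.
      have := pL k s0 s s1 (ltW ss1); have := pL k.+1 s0 s s1 (ltW ss1).
      rewrite !ler_norml => /andP[_ h1] /andP[h2 _].
      have : K * (s - s0) <= d * K by rewrite mulrC ler_wpM2r//; lin.
      move: s3; rewrite /P; lin.
    have := ler_normD (y - p k.+1 s) (p k.+1 s - p k s).
    rewrite addrA subrK; move: ys; rewrite qS; have := q0 k; lin.
  by move: s3; rewrite /P; lin.
have pcvg t : T0 <= t <= T1 -> cvgn (p ^~ t).
  move=> tT; apply: nonincreasing_is_cvgn.
    by apply/nonincreasing_seqP => k; exact: decr.
  exists (x0 - K * (t - T0)) => _ [k _ <-].
  have /andP[t1 t2] := tT.
  have := pL k T0 t (lexx _) t1; rewrite {2}/p ig0 addr0 ler_norml => /andP[]; lin.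
pose P t : R := lim (p k t @[k --> \oo]).
have plim t : T0 <= t <= T1 -> p k t @[k --> \oo] --> P t by move=> /pcvg.
have pge t k : T0 <= t <= T1 -> P t <= p k t.
  move=> tT; apply: (@nonincreasing_cvgn_ge _ (p ^~ t)); last exact: pcvg.
  by apply/nonincreasing_seqP => j; exact: decr.
have qlim : q k @[k --> \oo] --> (0 : R).
  by apply: cvg_expr; rewrite ger0_norm ?invr_ge0// invf_lt1// ltr1n.
have vlim t : T0 <= t <= T1 -> v k t @[k --> \oo] --> g t (P t).
  move=> tT; apply/cvgrPdist_le => e e0.
  have [d1 d10 H1] := usc t (P t) e tT e0.
  have [d2 d20 H2] := rc t (P t) e tT e0.
  have N1 : \forall k \near \oo, `|0 - q k| < d1 / 6.
    by move/cvgrPdist_lt : qlim; apply; rewrite divr_gt0.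
  have N2 : \forall k \near \oo, `|P t - p k t| < Num.min (d1 / 2) d2.
    by move/cvgrPdist_lt : (plim t tT); apply; rewrite lt_min d20 divr_gt0.
  near=> k.
  have n1 : `|0 - q k| < d1 / 6 by near: k.
  have : `|P t - p k t| < Num.min (d1 / 2) d2 by near: k.
  rewrite lt_min => /andP[n2 n3].
  rewrite sub0r normrN gtr0_norm// in n1.
  have pg := pge t k tT.
  rewrite ler_norml lerBlDr lerNl opprB lerBlDl; apply/andP; split.
    apply: upper => // y yp; apply: H1.
    have := ler_normD (y - p k t) (p k t - P t).
    rewrite addrA subrK (distrC (p k t)); move: yp n2; lin.
  apply: le_trans (H2 (p k t) _) _.
    by rewrite pg/=; move: n3; rewrite distrC ger0_norm ?subr_ge0//; lin.
  by rewrite addrC lerD2l; apply: lower => //; rewrite subrr normr0.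
have mgP t : T0 <= t <= T1 -> bm (fun t => g t (P t)) T0 t /\
    ig (v k) T0 t @[k --> \oo] --> ig (fun t => g t (P t)) T0 t.
  move=> /andP[t1 t2]; apply: (@ig_cvg _ v _ _ _ K).
  - by move=> k; exact: vb.
  - by move=> k s /andP[s1 _]; exact: vK.
  - by move=> s /andP[s1 s2]; apply: vlim; rewrite s1 (le_trans s2).
exists P; split; first by have [] := mgP T1; rewrite ?T01 ?lexx.
move=> t tT; have [_ L] := mgP t tT.
have L' : p k t @[k --> \oo] --> x0 + ig (fun t => g t (P t)) T0 t.
  by apply: cvgD => //; exact: cvg_cst.
by apply: cvg_unique (plim t tT) L'.
Unshelve. all: by end_near.
Qed.

End scalar_ode.

(** * Integral form of derivatives *)

Section primitives.
Context {R : realType}.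
Implicit Types (a b c d e s t x y z A B K : R) (f g w : R -> R).

(** Increments replace a pointwise derivative, which need not exist when f' comes from a measurable
    control. *)
Definition der f f' A B : Prop :=
  bm f' A B /\ forall a b, A <= a -> a <= b -> b <= B -> f b - f a = ig f' a b.

Lemma der_bm f f' A B : der f f' A B -> bm f' A B.
Proof. by case. Qed.

Lemma derW f f' A B a b : der f f' A B -> A <= a -> b <= B -> der f f' a b.
Proof.
move=> [mf E] Aa bB; split; first exact: bmW mf Aa bB.
by move=> s t as_ st tb; apply: E => //; [exact: le_trans as_|exact: le_trans bB].
Qed.

Lemma eq_der f f' g g' A B : (forall t, A <= t <= B -> f t = g t) ->
  (forall t, A <= t <= B -> f' t = g' t) -> der f f' A B -> der g g' A B.
Proof.
move=> fg fg' [mf E]; split; first exact: eq_bm mf.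
move=> a b Aa ab bB; rewrite -!fg ?E ?Aa ?bB ?andbT ?(le_trans ab)//; last first.
  exact: le_trans ab.
by apply: eq_ig => t /andP[t1 t2]; apply: fg'; rewrite (le_trans Aa)// (le_trans t2).
Qed.

Lemma der_lip f f' A B : der f f' A B ->
  exists2 K, 0 <= K & forall a b, A <= a -> a <= b -> b <= B ->
    `|f b - f a| <= K * (b - a).
Proof.
move=> [[mf [K fK]] E]; exists `|K| => // a b Aa ab bB; rewrite E//.
apply: ig_norm_le => //; first exact: bmW (conj mf (ex_intro _ K fK)) Aa bB.
move=> t /andP[t1 t2]; apply: le_trans (fK _ _) (ler_norm _).
by rewrite (le_trans Aa) ?(ltW t1)// (le_trans (ltW t2)).
Qed.

Lemma lip_cvgr f K t b : t < b ->
  (forall s, t <= s <= b -> `|f s - f t| <= K * (s - t)) ->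
  f s @[s --> t^'+] --> f t.
Proof.
move=> tb fK; apply/cvgrPdist_lt => e e0.
apply/near_rightP; exists (Num.min (b - t) (e / (`|K| + 1))).
  by rewrite lt_min subr_gt0 tb divr_gt0// ltr_wpDl.
move=> s /andP[ts]; rewrite -ltrBlDl lt_min => /andP[s1].
rewrite ltr_pdivlMr ?ltr_wpDl// => s2; rewrite distrC.
apply: le_lt_trans (fK _ _) _; first by rewrite (ltW ts)/=; lin.
apply: le_lt_trans s2; rewrite mulrC ler_wpM2l ?subr_ge0 ?(ltW ts)//.
by apply: le_trans (ler_norm _) _; rewrite lerDl.
Qed.

Lemma lip_cvgl f K t a : a < t ->
  (forall s, a <= s <= t -> `|f t - f s| <= K * (t - s)) ->
  f s @[s --> t^'-] --> f t.
Proof.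
move=> at_ fK; apply/cvgrPdist_lt => e e0.
apply/near_leftP; exists (Num.min (t - a) (e / (`|K| + 1))).
  by rewrite lt_min subr_gt0 at_ divr_gt0// ltr_wpDl.
move=> s /andP[+ st]; rewrite ltrBlDr -ltrBlDl lt_min => /andP[s1].
rewrite ltr_pdivlMr ?ltr_wpDl// => s2.
apply: le_lt_trans (fK _ _) _; first by rewrite (ltW st) andbT; lin.
apply: le_lt_trans s2; rewrite mulrC ler_wpM2l ?subr_ge0 ?(ltW st)//.
by apply: le_trans (ler_norm _) _; rewrite lerDl.
Qed.

Lemma lip_continuous f K A B : 0 <= K ->
  (forall a b, A <= a -> a <= b -> b <= B -> `|f b - f a| <= K * (b - a)) ->
  {within `[A, B], continuous f}.
Proof.
move=> K0 fK; apply/subspace_continuousP => t; rewrite /= in_itv/= => /andP[At tB].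
apply/cvgrPdist_lt => e e0; rewrite near_withinE.
have d0 : 0 < e / (K + 1) by rewrite divr_gt0// ltr_wpDl.
have := nbhsx_ballx (t : R) _ d0; apply: filterS => s.
rewrite /ball/= ltr_pdivlMr ?ltr_wpDl// => ts; rewrite in_itv/= => /andP[As sB].
apply: le_lt_trans ts.
have [st|/ltW ts] := leP s t.
  apply: le_trans (fK _ _ _ _ _) _ => //; rewrite ger0_norm ?subr_ge0// mulrC.
  by rewrite ler_wpM2l ?subr_ge0// lerDl.
rewrite distrC (distrC t); apply: le_trans (fK _ _ _ _ _) _ => //.
rewrite ger0_norm ?subr_ge0// mulrC.
by rewrite ler_wpM2l ?subr_ge0// lerDl.
Qed.

Lemma der_continuous f f' A B : der f f' A B -> {within `[A, B], continuous f}.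
Proof. by move=> /der_lip[K K0 fK]; exact: lip_continuous fK. Qed.

Lemma der_cvgr f f' A B t : der f f' A B -> A <= t -> t < B ->
  f s @[s --> t^'+] --> f t.
Proof.
move=> /der_lip[K _ fK] At tB; apply: (@lip_cvgr _ K _ _ tB) => s /andP[ts sB].
exact: fK.
Qed.

Lemma der_cvgl f f' A B t : der f f' A B -> A < t -> t <= B ->
  f s @[s --> t^'-] --> f t.
Proof.
move=> /der_lip[K _ fK] At tB; apply: (@lip_cvgl _ K _ _ At) => s /andP[As st].
exact: fK.
Qed.

Lemma der_bm0 f f' A B : der f f' A B -> bm f A B.
Proof. by move=> /der_continuous/continuous_bm. Qed.

Lemma der_cst c A B : der (fun=> c) (fun=> 0) A B.
Proof.
split; first exact: bm_cst.
by move=> a b _ ab _; rewrite subrr ig_cst// mul0r.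
Qed.

Lemma der_id A B : der id (fun=> 1) A B.
Proof. by split=> [|a b _ ab _]; [exact: bm_cst|rewrite ig_cst// mul1r]. Qed.

Lemma derD f f' g g' A B : der f f' A B -> der g g' A B ->
  der (fun t => f t + g t) (fun t => f' t + g' t) A B.
Proof.
move=> [mf Ef] [mg Eg]; split; first exact: bmD.
move=> a b Aa ab bB; rewrite (igD (bmW mf Aa bB) (bmW mg Aa bB)) -Ef// -Eg//; ring.
Qed.

Lemma derZ c f f' A B : der f f' A B -> der (fun t => c * f t) (fun t => c * f' t) A B.
Proof.
move=> [mf Ef]; split; first exact: bmZ.
by move=> a b Aa ab bB; rewrite (igZ _ (bmW mf Aa bB)) -Ef// mulrBr.
Qed.

Lemma derN f f' A B : der f f' A B -> der (fun t => - f t) (fun t => - f' t) A B.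
Proof.
move=> Df; apply: eq_der (derZ (-1) Df) => t _; rewrite mulN1r//.
Qed.

Lemma derB f f' g g' A B : der f f' A B -> der g g' A B ->
  der (fun t => f t - g t) (fun t => f' t - g' t) A B.
Proof. by move=> Df Dg; apply: derD => //; exact: derN. Qed.

Lemma der_le f f' A B : A <= B -> der f f' A B ->
  (forall t, A < t < B -> f' t <= 0) -> f B <= f A.
Proof.
move=> AB [mf E] f0; rewrite -subr_le0 E//.
by apply: le_trans (ig_le_cst AB mf f0) _; rewrite mul0r.
Qed.

Lemma bm_comp (G : R -> R) f f' A B : continuous G -> der f f' A B ->
  bm (fun t => G (f t)) A B.
Proof.
move=> cG /der_continuous cf; apply: continuous_bm => t.
exact: continuous_comp (cf t) (cG _).
Qed.

(** Near each t the mean value theorem for G compares the increment of G (f t) with the integral up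
    to an error of arbitrarily small slope; [dini_le], applied with both signs, turns this into an
    equality. *)
Theorem der_comp (G G' : R -> R) f f' A B :
  (forall x, is_derive x 1 G (G' x)) -> continuous G' ->
  der f f' A B -> der (fun t => G (f t)) (fun t => G' (f t) * f' t) A B.
Proof.
move=> dG cG' Df; have [mf Ef] := Df.
have cG : continuous G.
  by move=> x; apply: differentiable_continuous; apply/derivable1_diffP; case: (dG x).
have mG' := bm_comp cG' Df.
have mw : bm (fun t => G' (f t) * f' t) A B by exact: bmM.
split => // a b Aa ab bB.
(* The condition on sg leaves the two signs 1 and -1. *)
suff H (sg : R) : sg ^+ 2 = 1 -> sg * (G (f b) - ig (fun t => G' (f t) * f' t) a b) <=
    sg * (G (f a) - ig (fun t => G' (f t) * f' t) a a).
  have := H 1 (expr1n _ _); have := H (-1); rewrite sqrrN expr1n => /(_ erefl).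
  rewrite !mulN1r !mul1r ig0 => h1 h2; lin.
move=> sg2; pose N t := sg * (G (f t) - ig (fun t => G' (f t) * f' t) a t).
have Dw : der (ig (fun t => G' (f t) * f' t) a) (fun t => G' (f t) * f' t) a b.
  have mab := bmW mw Aa bB.
  split => // s t as_ st tb.
  rewrite (@ig_cat _ _ a s t)//; first by ring.
  exact: bmW mab (lexx _) tb.
have Dfab := derW Df Aa bB.
apply: (@dini_le _ N) => // t e; last first.
  move=> /andP[at_ tb] e0.
  have cN : N s @[s --> t^'-] --> N t.
    apply: cvgM; first exact: cvg_cst.
    apply: cvgB; last exact: der_cvgl Dw at_ tb.
    by apply: continuous_cvg (der_cvgl Dfab at_ tb); exact: cG.
  move/cvgrPdist_lt : cN => /(_ _ e0); apply: filterS => s.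
  by rewrite ltr_norml => /andP[_]; lin.
move=> /andP[at_ tb] e0.
have [[_ [M fM]] _] := Dfab.
have M0 : 0 <= M.
  by apply: le_trans (normr_ge0 _) (fM t _); rewrite at_ ltW.
pose e1 := e / (2 * (M + 1)).
have e10 : 0 < e1 by rewrite divr_gt0// mulr_gt0// ltr_wpDl.
have e1M : 2 * e1 * M <= e.
  have : e1 * (2 * (M + 1)) = e by rewrite divfK// gt_eqF// mulr_gt0// ltr_wpDl.
  by have := ltW e10; lin.
have [d d0 dG'] : exists2 d : R, 0 < d & forall z, `|z - f t| < d -> `|G' z - G' (f t)| < e1.
  have /cvgrPdist_lt/(_ _ e10) := cG' (f t); move=> [d /= d0 H]; exists d => // z zd.
  by rewrite distrC; apply: H; rewrite /= distrC.
have cf := der_cvgr Dfab at_ tb.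
have /cvgrPdist_lt/(_ _ d0)/near_rightP[h h0 fh] := cf.
apply/near_rightP; exists (Num.min h (b - t)); first by rewrite lt_min h0 subr_gt0.
move=> s /andP[ts]; rewrite -ltrBlDl lt_min => /andP[sh sb].
have sb' : s <= b by lin.
have close u : t <= u <= s -> `|f u - f t| < d.
  move=> /andP[]; rewrite le_eqVlt => /predU1P[<- _|tu us]; first by rewrite subrr normr0.
  by rewrite distrC; apply: fh; rewrite tu/=; lin.
have [xi xid Gxi] : exists2 xi, `|xi - f t| < d & G (f s) - G (f t) = G' xi * (f s - f t).
  have fs : `|f s - f t| < d by apply: close; rewrite lexx (ltW ts).
  have mvt p q : p < q -> exists2 xi, p < xi < q & G q - G p = G' xi * (q - p).
    move=> pq; have H x : x \in `]p, q[ -> is_derive x 1 G (G' x) by move=> _; exact: dG.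
    have [xi] := MVT pq H (continuous_subspaceT cG).
    by rewrite in_itv/= => xi1 E; exists xi.
  have [lt|lt|->] := ltgtP (f t) (f s).
  - have [xi /andP[x1 x2] E] := mvt _ _ lt; exists xi => //.
    by move: fs; rewrite !gtr0_norm ?subr_gt0//; lin.
  - have [xi /andP[x1 x2] E] := mvt _ _ lt; exists xi => //; last by lin.
    by move: fs; rewrite !ltr0_norm ?subr_lt0//; lin.
  - by exists (f s); rewrite ?subrr ?normr0// mulr0.
have Dts := derW Df (le_trans Aa at_) (le_trans sb' bB).
have mts := bmW mw (le_trans Aa at_) (le_trans sb' bB).
have E : N s - N t = sg * ig (fun u => (G' xi - G' (f u)) * f' u) t s.
  rewrite /N (@ig_cat _ _ a t s)//; last 2 first.
  - exact: bmW mw Aa (le_trans sb' bB).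
  - exact: ltW.
  have -> : ig (fun u => (G' xi - G' (f u)) * f' u) t s =
      G' xi * ig f' t s - ig (fun t => G' (f t) * f' t) t s.
    rewrite -(igZ _ (der_bm Dts)) -(igB (bmZ _ (der_bm Dts)) mts).
    by apply: eq_ig => u _; rewrite mulrBl.
  have [_ <-//] := Dts; last exact: ltW.
  by rewrite -Gxi; ring.
rewrite -lerBlDl E; apply: le_trans (ler_norm _) _; rewrite normrM.
have -> : `|sg| = 1.
  by apply/eqP; rewrite -sqrp_eq1// real_normK ?num_real// sg2.
rewrite mul1r.
apply: ig_norm_le; first exact: ltW.
  by apply: bmM; [apply: bmB; [exact: bm_cst|exact: bm_comp cG' Dts]|exact: der_bm Dts].
move=> u /andP[tu us]; rewrite normrM; apply: le_trans e1M; apply: ler_pM => //; last first.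
  by apply: fM; rewrite (le_trans at_)?(ltW tu)//= (le_trans (ltW us)).
have h1 := dG' _ xid; have h2 : `|G' (f u) - G' (f t)| < e1.
  by apply/dG'/close; rewrite !ltW.
have := ler_normB (G' xi - G' (f t)) (G' (f u) - G' (f t)).
have -> : G' xi - G' (f t) - (G' (f u) - G' (f t)) = G' xi - G' (f u) by ring.
lin.
Qed.

Lemma is_derive_sqr x : is_derive x 1 (fun y : R => y ^+ 2) (2 * x).
Proof.
have -> : (fun y : R => y ^+ 2) = id * id by apply/funext => y; rewrite expr2.
have D := is_deriveM (is_derive_id x (1 : R)) (is_derive_id x (1 : R)).
by apply: (is_derive_eq D); rewrite /GRing.scale/= mulr1 mulr_natl mulr2n.
Qed.

Lemma derM f f' g g' A B : der f f' A B -> der g g' A B ->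
  der (fun t => f t * g t) (fun t => f' t * g t + f t * g' t) A B.
Proof.
move=> Df Dg.
(* Polarization, 2 f g = (f + g)^2 - f^2 - g^2, reduces the product rule to the chain rule for
   squares. *)
have sq h h' : der h h' A B -> der (fun t => h t ^+ 2) (fun t => 2 * h t * h' t) A B.
  move=> Dh; apply: (@der_comp (fun x => x ^+ 2) (fun x => 2 * x)) => //.
    exact: is_derive_sqr.
  exact: mulrl_continuous.
have D := derB (sq _ _ (derD Df Dg)) (derD (sq _ _ Df) (sq _ _ Dg)).
by apply: eq_der (derZ 2^-1 D) => t _; field.
Qed.

(** The value 1 at 0 is the one that [orient] takes. *)
Definition sg1 x : R := if 0 <= x then 1 else -1.

(** The arc tangent term is uniformly small but has slope 1 at 0. Owing to it G' tends to [sg1] at 0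
    too, so the zeros of f need no separate argument in [der_abs]. *)
Lemma abs_smoothing e : 0 < e ->
  let G y := Num.sqrt (y ^+ 2 + e ^+ 2) + e * atan (y / e) in
  let G' y := y / Num.sqrt (y ^+ 2 + e ^+ 2) + e ^+ 2 / (y ^+ 2 + e ^+ 2) in
  [/\ forall x, is_derive x 1 G (G' x), continuous G',
      forall x, `|G x - `|x| | <= 3 * e & forall x, `|G' x| <= 2].
Proof.
move=> e0 G G'.
have q0 x : 0 < x ^+ 2 + e ^+ 2 by rewrite ltr_wpDl ?sqr_ge0// exprn_gt0.
have s0 x : 0 < Num.sqrt (x ^+ 2 + e ^+ 2) by rewrite sqrtr_gt0.
have sx x : `|x| <= Num.sqrt (x ^+ 2 + e ^+ 2).
  by rewrite -sqrtr_sqr ler_wsqrtr// lerDl sqr_ge0.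
have cq : continuous (fun x : R => x ^+ 2 + e ^+ 2).
  move=> x; apply: cvgD; [exact: exprn_continuous|exact: cvg_cst].
split.
- move=> x.
  pose g : R -> R := (fun y : R => y ^+ 2) + cst (e ^+ 2).
  have cstd (y : R) : is_derive x 1 (cst y : R -> R) 0 by exact: is_derive_cst.
  have Dg : is_derive x 1 g (2 * x).
    by apply: (is_derive_eq (is_deriveD (is_derive_sqr x) (cstd (e ^+ 2)))); rewrite addr0.
  have Ds := is_derive1_comp (is_derive1_sqrt (q0 x : 0 < g x)) Dg.
  have De := is_deriveM (is_derive_id x (1 : R)) (cstd e^-1).
  have Da := is_derive1_comp (is_derive1_atan ((id * cst e^-1 : R -> R) x)) De.
  have D := is_deriveD Ds (is_deriveM (cstd e) Da).
  apply: (is_derive_eq D); rewrite /GRing.scale/= !mulr0 !addr0 add0r mulr1 /G' /g /=.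
  have := q0 x; have := s0 x; set S := Num.sqrt _ => S0 Q0.
  congr (_ + _); first by field; rewrite gt_eqF.
  rewrite (_ : (id * cst e^-1 : R -> R) x = x / e)//.
  by field; rewrite !gt_eqF// addrC.
- move=> x; apply: cvgD.
    apply: cvgM => //; apply: cvgV; first by rewrite gt_eqF.
    by apply: continuous_cvg (cq x); exact: sqrt_continuous.
  by apply: cvgM; [exact: cvg_cst|apply: cvgV; [rewrite gt_eqF|exact: cq]].
- move=> x; have h1 : Num.sqrt (x ^+ 2 + e ^+ 2) <= `|x| + e.
    rewrite -[X in _ <= X]ger0_norm ?addr_ge0 ?(ltW e0)// -sqrtr_sqr.
    rewrite ler_wsqrtr// sqrrD real_normK ?num_real//.
    have : 0 <= `|x| * e by rewrite mulr_ge0// ltW.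
    by rewrite -mulr_natl; lin.
  have h2 := sx x.
  have h3 : `|e * atan (x / e)| <= e * 2.
    rewrite normrM gtr0_norm// ler_pM2l// ler_norml.
    have := atan_gtNpi2 (x / e); have := atan_ltpi2 (x / e); have := pihalf_lt2 R; lin.
  by move: h3; rewrite !ler_norml /G; lin.
- move=> x; apply: le_trans (ler_normD _ _) _.
  have -> : (2 : R) = 1 + 1 by [].
  apply: lerD.
    rewrite normrM normfV [X in _ / X]gtr0_norm// ler_pdivrMr// mul1r; exact: sx.
  rewrite ger0_norm; last by rewrite divr_ge0 ?sqr_ge0 ?(ltW (q0 _)).
  by rewrite ler_pdivrMr// mul1r lerDr sqr_ge0.
Qed.

Lemma der_abs f w A B : der f w A B ->
  der (fun t => `|f t|) (fun t => sg1 (f t) * w t) A B.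
Proof.
move=> Dx; have [mw Ex] := Dx.
pose en (n : nat) : R := n.+1%:R^-1.
have en0 n : 0 < en n by rewrite invr_gt0.
have enl : en n @[n --> \oo] --> (0 : R) by exact: cvg_harmonic.
pose G n y : R := Num.sqrt (y ^+ 2 + en n ^+ 2) + en n * atan (y / en n).
pose G' n y : R := y / Num.sqrt (y ^+ 2 + en n ^+ 2) + en n ^+ 2 / (y ^+ 2 + en n ^+ 2).
have DG n : der (fun t => G n (f t)) (fun t => G' n (f t) * w t) A B.
  by have [dG cG _ _] := abs_smoothing (en0 n); exact: der_comp.
have [M wM] : exists M : R, forall t, A <= t <= B -> `|w t| <= M by case: mw.
have G'K n t : A <= t <= B -> `|G' n (f t) * w t| <= 2 * M.
  move=> tAB; rewrite normrM; apply: ler_pM => //; last exact: wM.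
  by have [_ _ _] := abs_smoothing (en0 n); apply.
have G'l y : G' n y @[n --> \oo] --> sg1 y.
  have e2 : en n ^+ 2 @[n --> \oo] --> (0 : R).
    have -> : (fun n => en n ^+ 2) = en \* en by apply/funext => n; rewrite expr2.
    by rewrite -[X in _ --> X](mulr0 (0 : R)); exact: cvgM.
  have [->|y0] := eqVneq y 0.
    have -> : G' ^~ 0 = fun=> 1.
      apply/funext => n; rewrite /G' expr0n/= add0r mul0r add0r mulfV//.
      by rewrite gt_eqF// exprn_gt0.
    by rewrite /sg1 lexx; exact: cvg_cst.
  have q2 : y ^+ 2 + en n ^+ 2 @[n --> \oo] --> y ^+ 2.
    by rewrite -[X in _ --> X]addr0; apply: cvgD => //; exact: cvg_cst.
  have -> : sg1 y = y / Num.sqrt (y ^+ 2) + 0 / y ^+ 2.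
    rewrite mul0r addr0 sqrtr_sqr /sg1; case: ifP => [y1|/negbT].
      by rewrite ger0_norm// mulfV.
    by rewrite -ltNge => y1; rewrite ltr0_norm// invrN mulrN mulfV.
  apply: cvgD.
    apply: cvgM; first exact: cvg_cst.
    apply: cvgV; first by rewrite gt_eqF// sqrtr_gt0 exprn_even_gt0.
    by apply: continuous_cvg q2; exact: sqrt_continuous.
  by apply: cvgM => //; apply: cvgV; rewrite // expf_neq0.
have lims a b : A <= a -> b <= B -> bm (fun t => sg1 (f t) * w t) a b /\
    ig (fun t => G' n (f t) * w t) a b @[n --> \oo] --> ig (fun t => sg1 (f t) * w t) a b.
  move=> Aa bB; apply: (@ig_cvg _ (fun n t => G' n (f t) * w t) _ _ _ (2 * M)).
  - by move=> n; apply: bmW (der_bm (DG n)) Aa bB.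
  - by move=> n t /andP[t1 t2]; apply: G'K; rewrite (le_trans Aa)// (le_trans t2).
  - by move=> t _; apply: cvgM; [exact: G'l|exact: cvg_cst].
split; first by have [] := lims A B (lexx _) (lexx _).
move=> a b Aa ab bB; have [_ L] := lims a b Aa bB.
have Gl y : G n y @[n --> \oo] --> `|y|.
  apply/cvgrPdist_le => e e0.
  have e30 : 0 < e / 3 by rewrite divr_gt0.
  have /cvgrPdist_lt/(_ _ e30) := enl; apply: filterS => n.
  rewrite sub0r normrN gtr0_norm// => ne; rewrite distrC.
  by have [_ _ /(_ y) h _] := abs_smoothing (en0 n); apply: le_trans h _; lin.
have L' : ig (fun t => G' n (f t) * w t) a b @[n --> \oo] --> `|f b| - `|f a|.
  have E n : ig (fun t => G' n (f t) * w t) a b = G n (f b) - G n (f a).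
    by have [_ ->] := DG n.
  by under eq_fun do rewrite E; apply: cvgB; exact: Gl.
exact: cvg_unique L' L.
Qed.

End primitives.

(** * The arc cosine as a continuous function on the whole line *)

Section trig.
Context {R : realType}.
Implicit Types (a b c d e r s t x y : R).

Definition clamp x : R := Num.max (-1) (Num.min 1 x).

Lemma clamp_itv x : -1 <= clamp x <= 1.
Proof. by rewrite /clamp le_max lexx/= ge_max ge_min lexx/= andbT; lin. Qed.

Lemma clampE x : -1 <= x <= 1 -> clamp x = x.
Proof. by move=> /andP[x1 x2]; rewrite /clamp (min_idPr x2) (max_idPr x1). Qed.

Lemma clamp_ge1 x : 1 <= x -> clamp x = 1.
Proof. by move=> x1; rewrite /clamp (min_idPl x1) (max_idPr _)//; lin. Qed.

Lemma continuous_clamp : continuous clamp.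
Proof.
move=> x; apply: (@continuous_max _ _ (fun=> -1) (fun y => Num.min 1 y)).
  exact: cst_continuous.
by apply: (@continuous_min _ _ (fun=> 1) id) => //; exact: cst_continuous.
Qed.

(** Constant outside [-1, 1], hence continuous and monotone everywhere; limits can be taken without
    checking the range of the argument. *)
Definition acl x : R := acos (clamp x).

Lemma acl_itv x : 0 <= acl x <= pi.
Proof.
by rewrite /acl; apply/andP; split; [apply: acos_ge0|apply: acos_lepi]; exact: clamp_itv.
Qed.

Lemma aclE x : -1 <= x <= 1 -> acl x = acos x.
Proof. by move=> x1; rewrite /acl clampE. Qed.

Lemma cos_acl x : -1 <= x <= 1 -> cos (acl x) = x.
Proof. by move=> x1; rewrite aclE// acosK// in_itv. Qed.

Lemma acl_ge1 x : 1 <= x -> acl x = 0.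
Proof. by move=> x1; rewrite /acl clamp_ge1// acos1. Qed.

Lemma acl_cos x : 0 <= x <= pi -> acl (cos x) = x.
Proof. by move=> x1; rewrite aclE ?cosK ?in_itv//= cos_geN1 cos_le1. Qed.

Lemma le_cos x y : 0 <= x <= pi -> 0 <= y <= pi -> (cos x <= cos y) = (y <= x).
Proof. by move=> x1 y1; rewrite leNgt ltr_cos ?in_itv// -leNgt. Qed.

Lemma lt_cos x y : 0 <= x <= pi -> 0 <= y <= pi -> (cos x < cos y) = (y < x).
Proof. by move=> x1 y1; rewrite ltr_cos ?in_itv. Qed.

Lemma le_acl x y : x <= y -> acl y <= acl x.
Proof.
move=> xy; rewrite -le_cos ?acl_itv// /acl !acosK ?in_itv/= ?clamp_itv//.
by rewrite /clamp le_max2// le_min2.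
Qed.

Lemma continuous_acl : continuous acl.
Proof.
have cacos : {within `[(-1)%R, 1%R], continuous (@acos R)}.
  have := @segment_can_ge_continuous R 0 pi cos acos (pi_ge0 R).
  rewrite cospi cos0; apply.
    by apply: continuous_subspaceT; exact: continuous_cos.
  exact: cosK.
move=> x; have xi : `[(-1)%R, 1%R]%classic (clamp x) by rewrite /= in_itv/= clamp_itv.
have /subspace_continuousP/(_ _ xi) C := cacos.
apply: cvg_comp C => B /= wB; have := (continuous_clamp wB : nbhs x (fun z => `[(-1)%R, 1%R]%classic (clamp z) -> B (clamp z))).
apply: filterS => z H; apply: H; rewrite /= in_itv/=; exact: clamp_itv.
Qed.

Lemma acl_cvg T (F : set_system T) {FF : Filter F} (f : T -> R) x :
  f @ F --> x -> (fun i => acl (f i)) @ F --> acl x.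
Proof. by move=> fx; apply: continuous_cvg fx; exact: continuous_acl. Qed.

Lemma sin_cvg T (F : set_system T) {FF : Filter F} (f : T -> R) x :
  f @ F --> x -> (fun i => sin (f i)) @ F --> sin x.
Proof. by move=> fx; apply: continuous_cvg fx; exact: continuous_sin. Qed.

Lemma cos_cvg T (F : set_system T) {FF : Filter F} (f : T -> R) x :
  f @ F --> x -> (fun i => cos (f i)) @ F --> cos x.
Proof. by move=> fx; apply: continuous_cvg fx; exact: continuous_cos. Qed.

Lemma is_derive_acl x : -1 < x < 1 ->
  is_derive x 1 acl (- (sin (acl x))^-1).
Proof.
move=> x1; have xw : -1 <= x <= 1 by move: x1 => /andP[? ?]; rewrite !ltW.
rewrite aclE// sin_acos//.
have D := is_derive1_acos x1; apply: near_eq_is_derive D.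
have xi : x \in `](-1)%R, 1%R[ by rewrite in_itv.
have := near_in_itvoo xi; apply: filterS => z.
by rewrite in_itv/= => /andP[z1 z2]; rewrite aclE// !ltW.
Qed.

Lemma derive_lt0_lt (f : R -> R) (df : R -> R) a b : a < b ->
  (forall x, a < x < b -> is_derive x 1 f (df x)) ->
  (forall x, a < x < b -> df x < 0) -> continuous f -> f b < f a.
Proof.
move=> ab fdf df0 cf.
have H x : x \in `]a, b[ -> is_derive x 1 f (df x) by rewrite in_itv; exact: fdf.
have [c] := MVT ab H (continuous_subspaceT cf).
rewrite in_itv/= => /df0 dc0 E; rewrite -subr_lt0 E pmulr_llt0// subr_gt0//.
Qed.

End trig.

(** * Straight lines towards the antipode *)

Section tangent_lines.
Context {R : realType}.
Implicit Types (a b c d e r s t th x y : R).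
Local Notation pi := (@trigo.pi R).

(* With r standing for rho and b for beta: alpha = [al r b], the swimming time
   along the line is [tl r b], and [vv r b] is the value. At b = pi / 2 the
   heading is towards the center, and b < 0 is the heading of Case 2. *)
Definition za r b : R := acl (2 * (r * cos b) - 1).
Definition al r b : R := za r b / 2.
Definition tl r b : R := r * sin b + sin (za r b) / 2.
Definition Th r b : R := pi - b - al r b + tl r b.
Definition vv r b : R := al r b + tl r b.
(** The least admissible beta: for r <= 1 it is - acos r, a line of length 0; for r >= 1 it is acos
    (1 / r), for which r cos beta = 1, so that alpha = 0 and the line ends at radius mu. By clamping
    one of the two terms always vanishes. *)
Definition bmin r : R := acl (r^-1) - acl r.

Lemma bmin_le1 r : 0 < r <= 1 -> bmin r = - acl r.
Proof. by move=> /andP[r0 r1]; rewrite /bmin acl_ge1 ?sub0r// invf_ge1. Qed.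

Lemma bmin_ge1 r : 1 <= r -> bmin r = acl r^-1.
Proof. by move=> r1; rewrite /bmin (acl_ge1 r1) subr0. Qed.

Lemma bmin_itv r : 0 < r -> - (pi / 2) < bmin r < pi / 2.
Proof.
move=> r0; have key x : 0 < x -> acl x < pi / 2.
  move=> x0; have [x1|x1] := leP x 1.
    have p2 : 0 <= pi / 2  <= pi by have := pi_ge0 R; lin.
    by rewrite -lt_cos ?acl_itv// cos_pihalf cos_acl//; lin.
  by rewrite acl_ge1 ?ltW//; have := pi_gt0 R; lin.
rewrite /bmin; have := key _ r0.
have : acl r^-1 < pi / 2 by apply: key; rewrite invr_gt0.
by have /andP[] := acl_itv r; have /andP[] := acl_itv r^-1; lin.
Qed.

Lemma cos_ge0_bmin r b : 0 < r -> bmin r <= b <= pi / 2 -> 0 <= cos b.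
Proof.
move=> r0 /andP[b1 b2]; apply: cos_ge0_pihalf; rewrite b2 andbT.
by have /andP[/ltW h _] := bmin_itv r0; rewrite (le_trans h).
Qed.

Lemma cos_gt0_bmin r b : 0 < r -> bmin r <= b < pi / 2 -> 0 < cos b.
Proof.
move=> r0 /andP[b1 b2]; apply: cos_gt0_pihalf; rewrite b2 andbT.
by have /andP[h _] := bmin_itv r0; rewrite (lt_le_trans h).
Qed.

Lemma rcos_le1 r b : 0 < r -> bmin r <= b <= pi / 2 -> 0 <= r * cos b <= 1.
Proof.
move=> r0 bb; have c0 := cos_ge0_bmin r0 bb; rewrite mulr_ge0 ?(ltW r0)//=.
have [r1|r1] := leP r 1.
  by apply: mulr_ile1; rewrite ?cos_le1 ?(ltW r0).
move: bb; rewrite (bmin_ge1 (ltW r1)) => /andP[b1 b2].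
have ri : -1 <= r^-1 <= 1.
  by rewrite invf_le1 ?(ltW r1)// andbT (@le_trans _ _ 0)// ?invr_ge0 ?(ltW r0)//; lin.
have /andP[a0 _] := acl_itv r^-1.
have : cos b <= cos (acl r^-1).
  by rewrite le_cos ?acl_itv//; have := pi_ge0 R; lin.
by rewrite cos_acl// -ler_pdivlMl// mulr1.
Qed.

Lemma rcos_lt1 r b : 0 < r -> bmin r < b <= pi / 2 -> r * cos b < 1.
Proof.
move=> r0 /andP[b1 b2]; have [r1|r1] := ltP r 1.
  by apply: le_lt_trans r1; rewrite ler_piMr ?(ltW r0) ?cos_le1.
move: b1; rewrite bmin_ge1// => b1.
have ri : -1 <= r^-1 <= 1.
  by rewrite invf_le1 ?r1// andbT (@le_trans _ _ 0)// ?invr_ge0 ?(ltW r0)//; lin.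
have /andP[a0 _] := acl_itv r^-1.
have : cos b < cos (acl r^-1).
  by rewrite lt_cos ?acl_itv//; have := pi_ge0 R; lin.
by rewrite cos_acl// -ltr_pdivlMl// mulr1.
Qed.

Lemma al_itv r b : 0 <= al r b <= pi / 2.
Proof. by rewrite /al /za; have /andP[] := acl_itv (2 * (r * cos b) - 1); lin. Qed.

Lemma cos_al_ge0 r b : 0 <= cos (al r b).
Proof. by apply: cos_ge0_pihalf; have := pi_ge0 R; have /andP[] := al_itv r b; lin. Qed.

Lemma sin_al_ge0 r b : 0 <= sin (al r b).
Proof. by apply: sin_ge0_pi; have := pi_ge0 R; have /andP[] := al_itv r b; lin. Qed.

Lemma cos2half x : cos x = 2 * cos (x / 2) ^+ 2 - 1.
Proof. by rewrite {1}(_ : x = (x / 2) *+ 2) ?cos_mulr2n; [ring|rewrite mulr2n; lin]. Qed.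

Lemma sin2half x : sin x = 2 * (sin (x / 2) * cos (x / 2)).
Proof. by rewrite {1}(_ : x = (x / 2) *+ 2) ?sin_mulr2n; [ring|rewrite mulr2n; lin]. Qed.

Lemma cos_al r b : 0 <= r * cos b <= 1 -> cos (al r b) ^+ 2 = r * cos b.
Proof.
move=> rb; have := cos2half (za r b); rewrite -/(al r b) {1}/za cos_acl; last by lin.
lin.
Qed.

Lemma tlE r b : tl r b = r * sin b + sin (al r b) * cos (al r b).
Proof. by rewrite /tl (sin2half (za r b)) -/(al r b); lin. Qed.

Lemma alP r b x : 0 <= x <= pi / 2 -> cos x ^+ 2 = r * cos b -> al r b = x.
Proof.
move=> /andP[x0 x1] E; rewrite /al /za -E.
have -> : 2 * cos x ^+ 2 - 1 = cos (x *+ 2) by rewrite cos_mulr2n; ring.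
rewrite acl_cos; first by rewrite mulr2n; lin.
by rewrite mulr2n; lin.
Qed.

Lemma al_gt0 r b : 0 < r -> bmin r < b <= pi / 2 -> 0 < al r b.
Proof.
move=> r0 bb; have bb' : bmin r <= b <= pi / 2 by move: bb => /andP[/ltW -> ->].
have := rcos_lt1 r0 bb; rewrite -cos_al ?rcos_le1//.
move=> c1; rewrite lt_neqAle; have /andP[-> _] := al_itv r b; rewrite andbT.
by apply/eqP => E; move: c1; rewrite -E cos0 expr1n ltxx.
Qed.

Lemma al_lt_pihalf r b : 0 < r -> bmin r <= b < pi / 2 -> al r b < pi / 2.
Proof.
move=> r0 bb; have bb' : bmin r <= b <= pi / 2 by move: bb => /andP[-> /ltW ->].
have c0 : 0 < cos (al r b) ^+ 2.
  by rewrite cos_al ?rcos_le1// mulr_gt0// (cos_gt0_bmin r0 bb).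
rewrite lt_neqAle; have /andP[_ ->] := al_itv r b; rewrite andbT.
by apply/eqP => E; move: c0; rewrite E cos_pihalf expr0n ltxx.
Qed.

Lemma al_pihalf r : al r (pi / 2) = pi / 2.
Proof. by apply: alP; rewrite ?cos_pihalf ?mulr0 ?expr0n//; have := pi_ge0 R; lin. Qed.

(** For b <= 0 the range of b gives r < cos b, whence cos^2 al = r cos b < cos^2 b. *)
Lemma alDb_gt0 r b : 0 < r -> bmin r < b <= pi / 2 -> 0 < al r b + b.
Proof.
move=> r0 bb; have a0 := al_gt0 r0 bb.
have [b0|b0] := leP 0 b; first exact: ltr_wpDr.
have bb' : bmin r <= b <= pi / 2 by move: bb => /andP[/ltW -> ->].
move: bb => /andP[b1 b2]; have r1 : r < 1.
  rewrite ltNge; apply/negP => r1; move: b1; rewrite bmin_ge1//.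
  by have /andP[h _] := acl_itv r^-1; lin.
move: b1; rewrite bmin_le1 ?r0 ?ltW// => b1.
have /andP[c1 c2] := acl_itv r.
have cb : r < cos b.
  rewrite -cosN -[X in X < _](@cos_acl _ r); last by lin.
  by rewrite lt_cos ?acl_itv//; lin.
have : cos (al r b) < cos (- b).
  rewrite cosN -ltr_sqr ?nnegrE ?cos_al_ge0//; last exact: ltW (lt_trans r0 cb).
  rewrite cos_al ?rcos_le1// expr2 ltr_pM2r//; exact: lt_trans cb.
have /andP[h1 h2] := al_itv r b; have pi0 := pi_gt0 R.
rewrite lt_cos; last 2 first.
- by lin.
- by lin.
lin.
Qed.

Lemma al_bmin_le1 r : 0 < r <= 1 -> al r (bmin r) = acl r.
Proof.
move=> r1; have /andP[h1 h2] := acl_itv r.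
have /andP[h3 h4] := bmin_itv (proj1 (andP r1)).
apply: alP; first by move: h3; rewrite bmin_le1//; lin.
rewrite bmin_le1// cosN cos_acl ?expr2//; lin.
Qed.

(** Law of sines in the triangle formed by the center, L and the end of the line; the angle at the
    center is alpha + beta. *)
Lemma tl_cos r b : 0 < r -> bmin r <= b <= pi / 2 ->
  tl r b * cos b = cos (al r b) * sin (al r b + b).
Proof.
move=> r0 bb; rewrite tlE sinD mulrDl.
have -> : r * sin b * cos b = (r * cos b) * sin b by ring.
by rewrite -cos_al ?rcos_le1//; ring.
Qed.

Lemma tl_pihalf r : tl r (pi / 2) = r.
Proof. by rewrite tlE al_pihalf sin_pihalf cos_pihalf mulr1 mulr0 addr0. Qed.

Lemma tl_gt0 r b : 0 < r -> bmin r < b <= pi / 2 -> 0 < tl r b.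
Proof.
move=> r0 /andP[b1]; rewrite le_eqVlt => /predU1P[->|b2]; first by rewrite tl_pihalf.
have bb : bmin r < b <= pi / 2 by rewrite b1 ltW.
have bb' : bmin r <= b < pi / 2 by rewrite b2 ltW.
have bb2 : bmin r <= b <= pi / 2 by rewrite !ltW.
have cb := cos_gt0_bmin r0 bb'.
rewrite -(pmulr_lgt0 _ cb) tl_cos// mulr_gt0//.
  apply: cos_gt0_pihalf; have := al_lt_pihalf r0 bb'; have := al_gt0 r0 bb.
  by have := pi_gt0 R; lin.
apply: sin_gt0_pi; have := alDb_gt0 r0 bb; have /andP[] := al_itv r b; lin.
Qed.

Lemma tl_bmin_le1 r : 0 < r <= 1 -> tl r (bmin r) = 0.
Proof.
move=> r1; rewrite tlE al_bmin_le1// bmin_le1// sinN cos_acl; last by lin.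
by rewrite mulrN mulrC addNr.
Qed.

Lemma tl_ge0 r b : 0 < r -> bmin r <= b <= pi / 2 -> 0 <= tl r b.
Proof.
move=> r0 /andP[]; rewrite le_eqVlt => /predU1P[<-|b1] b2; last first.
  by apply/ltW/tl_gt0; rewrite ?b1.
have [r1|r1] := leP r 1; first by rewrite tl_bmin_le1 ?r0.
rewrite tlE addr_ge0// ?mulr_ge0 ?sin_al_ge0 ?cos_al_ge0//; first exact: ltW.
apply: sin_ge0_pi; have /andP[_ /ltW h] := bmin_itv r0.
rewrite (bmin_ge1 (ltW r1)) in h *.
by have /andP[] := acl_itv r^-1; have := pi_ge0 R; lin.
Qed.

Lemma Th_pihalf r : Th r (pi / 2) = r.
Proof. by rewrite /Th al_pihalf tl_pihalf; lin. Qed.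

Lemma Th_bmin_le1 r : 0 < r <= 1 -> Th r (bmin r) = pi.
Proof. by move=> r1; rewrite /Th tl_bmin_le1// al_bmin_le1// bmin_le1//; lin. Qed.

Lemma vv_pihalf r : vv r (pi / 2) = pi / 2 + r.
Proof. by rewrite /vv al_pihalf tl_pihalf. Qed.

Lemma vvE r b : vv r b = Th r b + b + 2 * al r b - pi.
Proof. by rewrite /vv /Th; lin. Qed.

Lemma sin_ltx x : 0 <= x -> sin x <= x.
Proof.
rewrite le_eqVlt => /predU1P[<-|x0]; first by rewrite sin0.
have H y : y \in `]0, x[ -> is_derive y 1 (@sin R) (cos y) by move=> _; exact: is_derive_sin.
have [c _] := MVT x0 H (continuous_subspaceT (@continuous_sin R)).
rewrite sin0 !subr0 => ->; rewrite ler_piMl ?cos_le1//; exact: ltW.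
Qed.

(** The bound is the value at b = pi / 2. It holds because al + sin (2 al) / 2 <= pi / 2, which is
    sin x <= x at x = pi - 2 al. *)
Lemma vv_le r b : 0 <= r -> vv r b <= pi / 2 + r.
Proof.
move=> r0; rewrite /vv /tl /al.
have /andP[h1 h2] := acl_itv (2 * (r * cos b) - 1); rewrite -/(za r b) in h1 h2.
have : sin (pi - za r b) <= pi - za r b by apply: sin_ltx; lin.
rewrite sinB sinpi cospi mul0r sub0r mulN1r opprK.
have : r * sin b <= r by rewrite ler_piMr ?sin_le1.
lin.
Qed.

End tangent_lines.

(** * Strict monotonicity of [Th] *)

Section Th_monotone.
Context {R : realType}.
Implicit Types (a b c d e r s t th x y : R).
Local Notation pi := (@trigo.pi R).

(** From cos^2 al = r cos b one gets al' = r sin b / (2 sin al cos al). The terms of the derivative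
    then combine to - sin^2 al (1 + r sin b / (sin al cos al)) = - tan al times [tl]. *)
Lemma is_derive_Th r b : 0 < r -> bmin r < b < pi / 2 ->
  is_derive b 1 (Th r) (- (sin (al r b) / cos (al r b) * tl r b)).
Proof.
move=> r0 /andP[b1 b2].
have bb : bmin r < b <= pi / 2 by rewrite b1 ltW.
have bb' : bmin r <= b < pi / 2 by rewrite b2 ltW.
have bb2 : bmin r <= b <= pi / 2 by rewrite !ltW.
pose g : R -> R := cst 2 * (cst r * cos) - cst 1.
have gb : -1 < g b < 1.
  have h1 : 0 < r * cos b by rewrite mulr_gt0// (cos_gt0_bmin r0 bb').
  have h2 := rcos_lt1 r0 bb.
  by rewrite /g !fctE; lin.
have Dg : is_derive b 1 g (2 * (r * - sin b)).
  by rewrite /g; apply: is_derive_eq; rewrite ?scaler0 ?addr0 ?subr0/=.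
have Da := is_derive1_comp (is_derive_acl gb) Dg.
have Ds := is_derive1_comp (is_derive_sin _) Da.
have -> : Th r = cst pi - id - cst 2^-1 * (acl \o g) +
    (cst r * sin + cst 2^-1 * (sin \o (acl \o g))).
  by apply/funext => x; rewrite /Th /al /tl /za /g !fctE /= !(mulrC 2^-1).
have cstd (x : R) : is_derive b 1 (cst x : R -> R) 0 by exact: is_derive_cst.
have D1 := is_deriveB (is_deriveB (cstd pi) (is_derive_id b (1 : R))) (is_deriveM (cstd 2^-1) Da).
have D2 := is_deriveD (is_deriveM (cstd r) (is_derive_sin b)) (is_deriveM (cstd 2^-1) Ds).
have D := is_deriveD D1 D2.
apply: (is_derive_eq D).
have zE : (acl \o g) b = za r b by rewrite /za /g !fctE.
have gE : acl (g b) = za r b by rewrite /za /g !fctE.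
rewrite gE zE.
have S0 : 0 < sin (al r b).
  apply: sin_gt0_pi; have := al_gt0 r0 bb; have := al_lt_pihalf r0 bb'.
  by have := pi_gt0 R; lin.
have C0 : 0 < cos (al r b).
  apply: cos_gt0_pihalf; have := al_gt0 r0 bb; have := al_lt_pihalf r0 bb'.
  by have := pi_gt0 R; lin.
rewrite /GRing.scale/= !mulr0 !addr0 (sin2half (za r b)) (cos2half (za r b)).
rewrite -/(al r b) tlE -(cos_al (rcos_le1 r0 bb2)).
have SC := sin2cos2 (al r b).
set S := sin (al r b) in S0 SC *; set C := cos (al r b) in C0 SC *.
have -> : S / C * (r * sin b + S * C) = S ^+ 2 * (1 + r * sin b / (S * C)).
  by field; rewrite !gt_eqF.
by rewrite SC; field; rewrite !gt_eqF.
Qed.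

Lemma za_cvg T (F : set_system T) {FF : Filter F} (f g : T -> R) r b :
  f @ F --> r -> g @ F --> b -> (fun i => za (f i) (g i)) @ F --> za r b.
Proof.
move=> fr gb; apply: acl_cvg; apply: cvgB; last exact: cvg_cst.
by apply: cvgM; [exact: cvg_cst|apply: cvgM => //; exact: cos_cvg].
Qed.

Lemma al_cvg T (F : set_system T) {FF : Filter F} (f g : T -> R) r b :
  f @ F --> r -> g @ F --> b -> (fun i => al (f i) (g i)) @ F --> al r b.
Proof.
by move=> fr gb; apply: cvgM; [exact: za_cvg|exact: cvg_cst].
Qed.

Lemma tl_cvg T (F : set_system T) {FF : Filter F} (f g : T -> R) r b :
  f @ F --> r -> g @ F --> b -> (fun i => tl (f i) (g i)) @ F --> tl r b.
Proof.
move=> fr gb; apply: cvgD; first by apply: cvgM => //; exact: sin_cvg.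
by apply: cvgM; [apply: sin_cvg; exact: za_cvg|exact: cvg_cst].
Qed.

Lemma Th_cvg T (F : set_system T) {FF : Filter F} (f g : T -> R) r b :
  f @ F --> r -> g @ F --> b -> (fun i => Th (f i) (g i)) @ F --> Th r b.
Proof.
move=> fr gb; apply: cvgD; last exact: tl_cvg.
apply: cvgB; last exact: al_cvg.
by apply: cvgB => //; exact: cvg_cst.
Qed.

Lemma vv_cvg T (F : set_system T) {FF : Filter F} (f g : T -> R) r b :
  f @ F --> r -> g @ F --> b -> (fun i => vv (f i) (g i)) @ F --> vv r b.
Proof. by move=> fr gb; apply: cvgD; [exact: al_cvg|exact: tl_cvg]. Qed.

Lemma bmin_cvg T (F : set_system T) {FF : Filter F} (f : T -> R) r :
  0 < r -> f @ F --> r -> (fun i => bmin (f i)) @ F --> bmin r.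
Proof.
move=> r0 fr; apply: cvgB; last exact: acl_cvg.
by apply: acl_cvg; apply: cvgV; rewrite // gt_eqF.
Qed.

Lemma continuous_Th r : continuous (Th r).
Proof. by move=> b; apply: (@Th_cvg _ _ _ (fun=> r) id) => //; exact: cvg_cst. Qed.

Lemma Th_lt r b c : 0 < r -> bmin r <= b -> b < c -> c <= pi / 2 ->
  Th r c < Th r b.
Proof.
move=> r0 b1 bc c1.
apply: (@derive_lt0_lt _ (Th r) (fun x => - (sin (al r x) / cos (al r x) * tl r x)) _ _ bc).
- by move=> x /andP[x1 x2]; apply: is_derive_Th; rewrite // (le_lt_trans b1)//= (lt_le_trans x2).
- move=> x /andP[x1 x2].
  have bb : bmin r < x <= pi / 2 by rewrite (le_lt_trans b1)//= ltW// (lt_le_trans x2).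
  have bb' : bmin r <= x < pi / 2 by rewrite ltW ?(le_lt_trans b1)//= (lt_le_trans x2).
  have := al_gt0 r0 bb; have := al_lt_pihalf r0 bb'; have := pi_gt0 R => p0 a1 a2.
  rewrite oppr_lt0 mulr_gt0 ?tl_gt0// divr_gt0//.
    by apply: sin_gt0_pi; lin.
  by apply: cos_gt0_pihalf; lin.
- exact: continuous_Th.
Qed.

Lemma Th_le r b c : 0 < r -> bmin r <= b -> b <= c -> c <= pi / 2 ->
  Th r c <= Th r b.
Proof.
move=> r0 b1; rewrite le_eqVlt => /predU1P[->//|bc c1].
exact/ltW/Th_lt.
Qed.

(** Ensures that every angle between r and pi is attained. For r > 1 the line at [bmin] has alpha =
    0 and length tan [bmin]. *)
Lemma Th_bmin_ge r : 0 < r -> pi <= Th r (bmin r).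
Proof.
move=> r0; have [r1|r1] := leP r 1; first by rewrite Th_bmin_le1 ?r0.
have E := bmin_ge1 (ltW r1).
have ri : -1 <= r^-1 <= 1.
  by rewrite invf_le1 ?(ltW r1)// andbT (@le_trans _ _ 0)// ?invr_ge0 ?(ltW r0)//; lin.
have rc : r * cos (bmin r) = 1 by rewrite E cos_acl// mulfV// gt_eqF.
have a0 : al r (bmin r) = 0.
  by apply: alP; rewrite ?cos0 ?expr1n ?rc//; have := pi_ge0 R; lin.
have /andP[b1 b2] := bmin_itv r0.
have b0 : 0 <= bmin r by rewrite E; have /andP[] := acl_itv r^-1.
(* tan x >= x *)
have : bmin r <= tl r (bmin r); last by rewrite /Th a0; lin.
rewrite tlE a0 sin0 mul0r addr0.
have -> : r * sin (bmin r) = tan (bmin r).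
  have cb : cos (bmin r) != 0 by apply/eqP => c0; move: rc; rewrite c0; lin.
  by rewrite /tan -[RHS]mul1r -rc; field.
move: b0; rewrite le_eqVlt => /predU1P[<-|b0]; first by rewrite tan0.
have cx x : 0 <= x <= bmin r -> cos x != 0.
  by move=> x1; rewrite gt_eqF//; apply: cos_gt0_pihalf; lin.
have H x : x \in `]0, bmin r[ -> is_derive x 1 tan ((cos x) ^- 2).
  rewrite in_itv/= => /andP[x1 x2]; apply: is_derive_tan; apply: cx; lin.
have ct : {within `[0, bmin r], continuous (@tan R)}.
  apply: continuous_in_subspaceT => x; rewrite inE/= in_itv/= => x1.
  exact: continuous_tan (cx _ x1).
have [x xi] := MVT b0 H ct.
rewrite tan0 !subr0 => ->.
move: xi; rewrite in_itv/= => /andP[x1 x2].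
have c0 : 0 < cos x by apply: cos_gt0_pihalf; lin.
apply: ler_peMl; first exact: ltW.
by rewrite invf_ge1 ?exprn_gt0// exprn_ile1 ?cos_le1 ?ltW.
Qed.

End Th_monotone.

(** * The tangent angle as a continuous function of the state *)

Section tangent_angle.
Context {R : realType}.
Implicit Types (a b c d e r s t th x y : R).
Local Notation pi := (@trigo.pi R).

(** The inverse of [Th r], continued by pi / 2 into the zone. The explicit bound - (pi / 2) <= b
    makes [bet_bnd] hold for every r, also where [bmin_itv] says nothing. *)
Definition bet r th : R :=
  if th <= r then pi / 2
  else xget (pi / 2)
    [set b | [/\ bmin r <= b <= pi / 2, - (pi / 2) <= b & Th r b = th]].

Lemma bet_le r th : th <= r -> bet r th = pi / 2.
Proof. by move=> rt; rewrite /bet rt. Qed.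

Lemma bet_bnd r th : - (pi / 2) <= bet r th <= pi / 2.
Proof.
have pi0 := pi_ge0 R; rewrite /bet; case: ifP => _; first by lin.
by case: xgetP => [b _ /= [/andP[_ ->] -> _]|_]//; lin.
Qed.

Lemma betP r th : 0 < r -> r <= th <= pi ->
  bmin r <= bet r th <= pi / 2 /\ Th r (bet r th) = th.
Proof.
move=> r0 /andP[rth thpi]; have /andP[m1 m2] := bmin_itv r0.
rewrite /bet; case: ifP => [thr|/negbT].
  by rewrite lexx (ltW m2) Th_pihalf; split => //; apply/eqP; rewrite eq_le rth.
rewrite -ltNge => {}rth.
case: xgetP => [b _ /= [//]|H]; exfalso.
have ct : {within `[bmin r, pi / 2], continuous (Th r)}.
  by apply: continuous_subspaceT; exact: continuous_Th.
have [|b] := @IVT R (Th r) (bmin r) (pi / 2) th (ltW m2) ct.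
  rewrite Th_pihalf ge_min le_max (le_trans thpi (Th_bmin_ge r0)) (ltW rth).
  by rewrite !orbT.
rewrite in_itv/= => /andP[b1 b2] E; apply: (H b) => /=; split => //.
- by rewrite b1.
- by rewrite (le_trans _ b1)// ltW.
Qed.

Lemma bet_itv r th : 0 < r -> th <= pi -> bmin r <= bet r th <= pi / 2.
Proof.
move=> r0 thpi; have [thr|/ltW rth] := leP th r.
  by rewrite bet_le// lexx andbT; have /andP[_ /ltW] := bmin_itv r0.
by have [|//] := betP r0 (th := th); rewrite rth.
Qed.

Lemma Th_bet r th : 0 < r -> th <= pi -> Th r (bet r th) = Num.max th r.
Proof.
move=> r0 thpi; have [thr|rth] := leP th r; first by rewrite bet_le// Th_pihalf.
by have [|//] := betP r0 (th := th); rewrite (ltW rth).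
Qed.

Lemma bet_gt r th b : 0 < r -> th <= pi -> bmin r <= b <= pi / 2 ->
  Th r b < th -> bet r th < b.
Proof.
move=> r0 thpi /andP[b1 b2] H; rewrite ltNge; apply/negP => bb.
have /andP[_ c2] := bet_itv r0 thpi.
have := Th_le r0 b1 bb c2; rewrite Th_bet// ge_max => /andP[h _].
by move: H; rewrite ltNge h.
Qed.

Lemma bet_lt r th b : 0 < r -> th <= pi -> b <= pi / 2 ->
  th < Th r b -> r < Th r b -> b < bet r th.
Proof.
move=> r0 thpi b2 H1 H2; rewrite ltNge; apply/negP => bb.
have /andP[c1 c2] := bet_itv r0 thpi.
have := Th_le r0 c1 bb b2; rewrite Th_bet// le_max.
by rewrite leNgt H1 leNgt H2.
Qed.

Lemma bet_uniq r th b : 0 < r -> bmin r <= b <= pi / 2 -> Th r b = th ->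
  th <= pi -> bet r th = b.
Proof.
move=> r0 /andP[b1 b2] E thpi; have /andP[c1 c2] := bet_itv r0 thpi.
have rth : r <= th by rewrite -E -{1}(Th_pihalf r) Th_le.
have F : Th r (bet r th) = th by rewrite Th_bet//; apply/max_idPl.
case: (ltgtP (bet r th) b) => // bb.
  by have := Th_lt r0 c1 bb b2; rewrite E F ltxx.
by have := Th_lt r0 b1 bb c2; rewrite E F ltxx.
Qed.

(** For c a little above or below the limit, [Th (f i) c] eventually lies on a definite side of
    [g i]; monotonicity of [Th] carries this over to [bet]. *)
Lemma bet_cvg T (F : set_system T) {FF : Filter F} (f g : T -> R) r th :
  0 < r -> th <= pi -> f @ F --> r -> g @ F --> th ->
  (\forall i \near F, g i <= pi) ->
  (fun i => bet (f i) (g i)) @ F --> bet r th.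
Proof.
move=> r0 thpi fr gth gpi.
have f0 : \forall i \near F, 0 < f i by apply: (cvgr_gt r).
have /andP[b1 b2] := bet_itv r0 thpi.
have ThE : Th r (bet r th) = Num.max th r by exact: Th_bet.
apply/cvgrPdist_lt => e e0.
have up : \forall i \near F, bet (f i) (g i) < bet r th + e.
  have [e1|e1] := ltP (pi / 2) (bet r th + e).
    by near=> i; have /andP[_ h] := bet_bnd (f i) (g i); exact: le_lt_trans e1.
  pose c := bet r th + e / 2.
  have c1 : bet r th < c by rewrite ltrDl divr_gt0.
  have c2 : c < bet r th + e by rewrite ltrD2l; lin.
  have c3 : c < pi / 2 by exact: lt_le_trans e1.
  have rth : r < th.
    rewrite ltNge; apply/negP => h; move: c3; rewrite ltNge => /negP; apply.
    by rewrite ltW//; move: c1; rewrite bet_le.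
  have H : Th r c < th.
    by rewrite -[X in _ < X](max_idPl (ltW rth)) -ThE Th_lt// ltW.
  have Hc : (fun i => g i - Th (f i) c) @ F --> th - Th r c.
    by apply: cvgB => //; apply: Th_cvg => //; exact: cvg_cst.
  have N1 : \forall i \near F, 0 < g i - Th (f i) c.
    by apply: (cvgr_gt (th - Th r c)) => //; rewrite subr_gt0.
  have N2 : \forall i \near F, 0 < c - bmin (f i).
    apply: (cvgr_gt (c - bmin r)); last by rewrite subr_gt0 (le_lt_trans b1).
    by apply: cvgB; [exact: cvg_cst|exact: bmin_cvg].
  near=> i; apply: lt_trans c2; apply: bet_gt.
  - by near: i.
  - by near: i.
  - rewrite (ltW c3) andbT ltW// -subr_gt0; by near: i.
  - by rewrite -subr_gt0; near: i.
have lo : \forall i \near F, bet r th - e < bet (f i) (g i).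
  (* At the lower end of the range there is no admissible c below, but [bmin] itself is
     continuous. *)
  move: b1; rewrite le_eqVlt => /predU1P[E|b1].
    have N1 : \forall i \near F, 0 < bmin (f i) - (bmin r - e).
      apply: (cvgr_gt (bmin r - (bmin r - e))); last by lin.
      by apply: cvgB; [exact: bmin_cvg|exact: cvg_cst].
    near=> i; have fi0 : 0 < f i by near: i.
    have gi : g i <= pi by near: i.
    have /andP[h _] := bet_itv fi0 gi; apply: lt_le_trans h.
    by rewrite -E -subr_gt0; near: i.
  pose c := Num.max ((bmin r + bet r th) / 2) (bet r th - e / 2).
  have c1 : bmin r < c by rewrite lt_max; apply/orP; left; lin.
  have c2 : c < bet r th by rewrite gt_max; apply/andP; split; lin.
  have c3 : bet r th - e < c by rewrite lt_max; apply/orP; right; lin.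
  have H : Num.max th r < Th r c by rewrite -ThE Th_lt// ltW.
  move: H; rewrite gt_max => /andP[H1 H2].
  have Hc : (fun i => Th (f i) c) @ F --> Th r c.
    by apply: Th_cvg => //; exact: cvg_cst.
  have N1 : \forall i \near F, 0 < Th (f i) c - g i.
    by apply: (cvgr_gt (Th r c - th)); [exact: cvgB|rewrite subr_gt0].
  have N2 : \forall i \near F, 0 < Th (f i) c - f i.
    by apply: (cvgr_gt (Th r c - r)); [exact: cvgB|rewrite subr_gt0].
  near=> i; apply: lt_trans c3 _; apply: bet_lt.
  - by near: i.
  - by near: i.
  - exact: le_trans (ltW c2) b2.
  - by rewrite -subr_gt0; near: i.
  - by rewrite -subr_gt0; near: i.
near=> i.
have H1 : bet (f i) (g i) < bet r th + e by near: i.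
have H2 : bet r th - e < bet (f i) (g i) by near: i.
by rewrite ltr_norml; lin.
Unshelve. all: by end_near.
Qed.

End tangent_angle.

(** * Agreement with the formulas of the statement *)

Section feedback_formulas.
Context {R : realType}.
Implicit Types (a b c d e mu r s t th x y : R).
Local Notation pi := (@trigo.pi R).

Lemma sqrt_id x y : 0 <= y -> x = y ^+ 2 -> Num.sqrt x = y.
Proof. by move=> y0 ->; rewrite sqrtr_sqr ger0_norm. Qed.

Lemma norm_sin x : - (pi / 2) <= x <= pi / 2 -> acl (cos x) = `|x|.
Proof.
have p2 := pi_ge2 R.
move=> /andP[x1 x2]; have [x0|x0] := leP 0 x.
  by rewrite acl_cos ?ger0_norm//; lin.
by rewrite -cosN acl_cos ?ltr0_norm//; lin.
Qed.

(** beta recovered from x = s / mu through x^2 = rho cos beta; the sign of beta separates the two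
    cases. *)
Definition heading (inw : bool) r x : R :=
  if inw then acl (x ^+ 2 / r) else - acl (x ^+ 2 / r).

Section one_state.
Variables (mu r : R).
Hypotheses (mu0 : 0 < mu) (r0 : 0 < r).
Let p := r / mu.

Let p0 : 0 < p. Proof. by rewrite divr_gt0. Qed.

Let rE : r = mu * p. Proof. by rewrite mulrC divfK// gt_eqF. Qed.

Let quot_itv x : 0 < x <= 1 -> x ^+ 2 <= p -> 0 < x ^+ 2 / p <= 1.
Proof.
move=> /andP[x0 x1] xp; rewrite divr_gt0 ?exprn_gt0//=.
by rewrite ler_pdivrMr// mul1r.
Qed.

Let acl_quot x : 0 < x <= 1 -> x ^+ 2 <= p ->
  0 <= acl (x ^+ 2 / p) < pi / 2.
Proof.
move=> x01 xp; have /andP[q0 q1] := quot_itv x01 xp.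
have /andP[a0 a1] := acl_itv (x ^+ 2 / p); rewrite a0 /= ltNge; apply/negP => h.
have : cos (acl (x ^+ 2 / p)) <= cos (pi / 2).
  by rewrite le_cos ?a0//; have p2 := pi_ge2 R; lin.
by rewrite cos_pihalf cos_acl; lin.
Qed.

Lemma cos_heading inw x : 0 < x <= 1 -> x ^+ 2 <= p ->
  cos (heading inw p x) = x ^+ 2 / p.
Proof.
move=> x01 xp; have q := quot_itv x01 xp.
by rewrite /heading; case: inw; rewrite ?cosN cos_acl//; lin.
Qed.

Lemma al_heading inw x : 0 < x <= 1 -> x ^+ 2 <= p ->
  al p (heading inw p x) = acl x.
Proof.
move=> x01 xp; have /andP[a0 a1] := acl_itv x; apply: alP.
  rewrite a0 /= leNgt; apply/negP => h.
  have : cos (acl x) < cos (pi / 2) by rewrite lt_cos ?a0//; have p2 := pi_ge2 R; lin.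
  by rewrite cos_pihalf cos_acl; lin.
by rewrite cos_heading// mulrC divfK ?gt_eqF// cos_acl//; lin.
Qed.

Lemma t_L_heading inw x : 0 < x <= 1 -> x ^+ 2 <= p ->
  t_L mu r inw (mu * x) = tl p (heading inw p x).
Proof.
move=> x01 xp; have /andP[x0 x1] := x01.
have E1 : Num.sqrt (r ^+ 2 - (mu * x) ^+ 4 / mu ^+ 2) =
    mu * (p * sin (acl (x ^+ 2 / p))).
  apply: sqrt_id.
    by do 2!(apply: mulr_ge0; first exact: ltW); apply: sin_ge0_pi; exact: acl_itv.
  rewrite !exprMn sin2cos2 cos_acl; last by have := quot_itv x01 xp; lin.
  by rewrite rE; field; rewrite !gt_eqF.
have E2 : Num.sqrt ((mu * x) ^+ 2 - (mu * x) ^+ 4 / mu ^+ 2) =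
    mu * (sin (acl x) * cos (acl x)).
  apply: sqrt_id.
    apply: mulr_ge0; first exact: ltW.
    by apply: mulr_ge0; [apply: sin_ge0_pi; exact: acl_itv|rewrite cos_acl; lin].
  rewrite !exprMn sin2cos2 cos_acl; last by lin.
  by field; rewrite gt_eqF.
rewrite tlE al_heading// /t_L E1 E2 /heading.
by case: inw; rewrite ?sinN; field; rewrite gt_eqF.
Qed.

Lemma t_M_heading th inw x : 0 < x <= 1 -> x ^+ 2 <= p ->
  t_M mu r th inw (mu * x) = th + heading inw p x + al p (heading inw p x) - pi.
Proof.
move=> x01 xp; have q := quot_itv x01 xp.
rewrite al_heading// /t_M /heading.
have -> : (mu * x) ^+ 2 / (mu * r) = x ^+ 2 / p.
  by rewrite rE; field; rewrite !gt_eqF.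
have -> : mu * x / mu = x by field; rewrite gt_eqF.
by case: inw; rewrite !aclE//; lin.
Qed.

(** Here the condition that the swimming time be nonnegative enters: in Case 2 it amounts to r <= s,
    which places the root in the range where [Th] is injective. *)
Lemma heading_ge_bmin inw x : 0 < x <= 1 -> x ^+ 2 <= p ->
  0 <= tl p (heading inw p x) -> bmin p <= heading inw p x.
Proof.
move=> x01 xp; have /andP[x0 x1] := x01; have q := quot_itv x01 xp.
have x21 : x ^+ 2 <= 1 by rewrite expr_le1// ltW.
case: inw => [_|].
  have [p1|/ltW p1] := leP p 1.
    rewrite bmin_le1 ?p0//; have := acl_itv p; have := acl_itv (x ^+ 2 / p).
    by rewrite /heading; lin.
  rewrite bmin_ge1//= le_acl//.
  by rewrite ler_pdivrMr// mulVf ?gt_eqF.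
rewrite -t_L_heading// /t_L pmulr_rge0 ?divr_gt0// subr_ge0 => h.
have h2 : p <= x.
  rewrite -(ler_pXn2r (n := 2)) ?nnegrE ?(ltW p0) ?(ltW x0)//.
  have e1 : r ^+ 2 - (mu * x) ^+ 4 / mu ^+ 2 = mu ^+ 2 * (p ^+ 2 - x ^+ 4).
    by rewrite {1}rE; field; rewrite gt_eqF.
  have e2 : (mu * x) ^+ 2 - (mu * x) ^+ 4 / mu ^+ 2 = mu ^+ 2 * (x ^+ 2 - x ^+ 4).
    by field; rewrite gt_eqF.
  have x4 : x ^+ 4 <= x ^+ 2.
    by rewrite -[4%N]/(2 + 2)%N exprD ler_piMr// exprn_ge0// ltW.
  move: h; rewrite e1 e2 ler_sqrt.
    rewrite ler_pM2l ?exprn_gt0//; lin.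
  by rewrite mulr_ge0 ?exprn_ge0 ?(ltW mu0)// subr_ge0.
have p1 : 0 < p <= 1 by rewrite p0 (le_trans h2).
rewrite bmin_le1// /heading lerN2 le_acl//.
by rewrite ler_pdivlMr// -expr2 lerXn2r ?nnegrE ?(ltW p0) ?(ltW x0).
Qed.

Variable th : R.
Hypothesis th_itv : p < th <= pi.

Let b := bet p th.
Let b_itv : bmin p <= b <= pi / 2.
Proof. by case/andP: th_itv => _ h; exact: bet_itv. Qed.

Let ThE : Th p b = th.
Proof. by case/andP: th_itv => h1 h2; rewrite Th_bet//; apply/max_idPl; exact: ltW. Qed.

Lemma bet_lt_pihalf : b < pi / 2.
Proof.
case/andP: b_itv => _; rewrite le_eqVlt => /predU1P[E|//].
by move: ThE; rewrite E Th_pihalf => E'; move: th_itv; rewrite E' ltxx.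
Qed.

(** A root of [delta] solves Th rho beta = theta, whose solution is unique. So a root is determined
    together with its case, and being the least one is automatic. *)
Lemma switch_radius_root inw s : switch_radius mu r th inw s ->
  s = mu * cos (al p b) /\ b = heading inw p (s / mu).
Proof.
move=> [/andP[s0 smu] smr tL0 D0]; set x := s / mu.
have sE : s = mu * x by rewrite /x mulrC divfK// gt_eqF.
have x01 : 0 < x <= 1 by rewrite divr_gt0//= ler_pdivrMr// mul1r.
have xp : x ^+ 2 <= p.
  move: smr; rewrite sE {1}rE exprMn mulrA -expr2 ler_pM2l ?exprn_gt0//.
have tl0 := tL0; rewrite sE t_L_heading// in tl0.
have bh := heading_ge_bmin x01 xp tl0.
move: D0; rewrite /delta sE t_L_heading// t_M_heading// => D0.
have /andP[h1 h2] := acl_quot x01 xp.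
have hh : heading inw p x <= pi / 2.
  by rewrite /heading; case: inw {sE x01 xp tl0 bh D0 tL0}; lin.
have <- : heading inw p x = b.
  apply/esym/bet_uniq => //; rewrite ?bh//; last by case/andP: th_itv.
  by rewrite /Th; lin.
by rewrite al_heading// cos_acl//; case/andP: x01; lin.
Qed.

Lemma heading_bet : let x := cos (al p b) in
  [/\ 0 < x <= 1, x ^+ 2 <= p & heading (0 <= b) p x = b].
Proof.
move=> x; have /andP[b1 b2] := b_itv; have lt := bet_lt_pihalf.
have cb : 0 < cos b by apply: (cos_gt0_bmin p0); rewrite b1.
have E : x ^+ 2 = p * cos b by apply: cos_al; exact: rcos_le1.
have x0 : 0 < x.
  rewrite lt_neqAle cos_al_ge0 andbT eq_sym -sqrf_eq0 E gt_eqF//.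
  exact: mulr_gt0.
split; first by rewrite x0 cos_le1.
  by rewrite E ler_piMr ?cos_le1// ltW.
have E2 : x ^+ 2 / p = cos b by rewrite E mulrC mulKf// gt_eqF.
have bi := bmin_itv p0.
rewrite /heading E2 norm_sin; last by lin.
by case: ifPn => h; [rewrite ger0_norm|rewrite ltr0_norm ?opprK// ltNge].
Qed.

Lemma switch_radius_bet : switch_radius mu r th (0 <= b) (mu * cos (al p b)).
Proof.
have [x01 xp hE] := heading_bet; have /andP[x0 x1] := x01.
split.
- by rewrite mulr_gt0//= ler_piMr// ltW.
- by rewrite rE exprMn mulrA -expr2 ler_pM2l ?exprn_gt0.
- by rewrite t_L_heading// hE tl_ge0.
- by rewrite /delta t_L_heading// t_M_heading// hE; move: ThE; rewrite /Th; lin.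
Qed.

Lemma inwardE : inward mu r th = (0 <= b).
Proof.
apply/asboolP/idP => [[s sr]|b0]; last first.
  by exists (mu * cos (al p b)); have := switch_radius_bet; rewrite b0.
by have [_ ->] := switch_radius_root sr; case/andP: (acl_itv ((s / mu) ^+ 2 / p)).
Qed.

Lemma least_switch_radius_bet :
  least_switch_radius mu r th (inward mu r th) (mu * cos (al p b)).
Proof.
split; first by rewrite inwardE; exact: switch_radius_bet.
by move=> s /switch_radius_root[->].
Qed.

Lemma s_starP : least_switch_radius mu r th (inward mu r th) (s_star mu r th).
Proof. by apply: (@xgetPex _ 0); exists (mu * cos (al p b)); exact: least_switch_radius_bet. Qed.

Lemma s_starE : s_star mu r th = mu * cos (al p b).
Proof. by case: s_starP => /switch_radius_root[]. Qed.

End one_state.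

(** beta is measured from the tangential direction and psi from the radial one: psi = beta + pi /
    2. *)
Lemma psi_starE mu r th : 0 < mu -> 0 < r -> 0 <= th < pi ->
  psi_star mu r th = (- sin (bet (r / mu) th), cos (bet (r / mu) th)).
Proof.
move=> mu0 r0 /andP[th0 thpi]; rewrite /psi_star lt_eqF//.
have p0 : 0 < r / mu by rewrite divr_gt0.
case: leP => [h|h]; first by rewrite bet_le// sin_pihalf cos_pihalf.
have thi : r / mu < th <= pi by rewrite h ltW.
have [x01 xp hE] := heading_bet mu0 r0 thi.
have /andP[x0 x1] := x01.
rewrite inwardE// s_starE//; set b := bet _ _ in hE x01 xp *.
set x := cos (al _ _) in hE x01 xp x0 x1 *.
have cE : cos b = x ^+ 2 / (r / mu) by rewrite -(cos_heading mu0 r0 (0 <= b) x01 xp) hE.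
have -> : (mu * x) ^+ 2 / (mu * r) = cos b.
  by rewrite cE; field; rewrite !gt_eqF.
have -> : Num.sqrt (1 - (mu * x) ^+ 4 / (mu ^+ 2 * r ^+ 2)) = `|sin b|.
  rewrite -sqrtr_sqr sin2cos2 cE; congr Num.sqrt.
  by field; rewrite !gt_eqF.
have := bet_bnd (r / mu) th; rewrite -/b => bb; have p2 := pi_ge2 R.
case: ifPn => b0; first by rewrite ger0_norm// sin_ge0_pi//; lin.
have h0 : 0 <= sin (- b) by apply: sin_ge0_pi; lin.
by rewrite -normrN -sinN ger0_norm.
Qed.

Lemma acosE_asin x : -1 <= x <= 1 -> pi / 2 - asin x = acos x.
Proof.
move=> x1; have p2 := pi_ge2 R.
have : cos (pi / 2 - asin x) = x.
  by rewrite cosB cos_pihalf sin_pihalf mul0r add0r mul1r asinK// in_itv.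
move=> {2}<-; rewrite cosK// in_itv/=.
by have := asin_geNpi2 x1; have := asin_lepi2 x1; lin.
Qed.

Lemma tf_starE mu r th : 0 < mu -> 0 < r -> 0 <= th <= pi ->
  (th = pi -> r <= mu) ->
  tf_star mu r th = vv (r / mu) (bet (r / mu) th).
Proof.
move=> mu0 r0 /andP[th0 thpi] rmu; have p2 := pi_ge2 R.
have p0 : 0 < r / mu by rewrite divr_gt0.
rewrite /tf_star; case: eqVneq => [E|ne].
  have p01 : 0 < r / mu <= 1 by rewrite p0 ler_pdivrMr// mul1r rmu.
  have /andP[_ p1] := p01.
  (* Opposite M within radius mu, the line has length 0. *)
  have -> : bet (r / mu) th = bmin (r / mu).
    apply: bet_uniq => //; last by rewrite Th_bmin_le1.
    by have := bmin_itv p0; lin.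
  by rewrite /vv tl_bmin_le1// al_bmin_le1// addr0 acosE_asin ?aclE//; lin.
have {ne}thpi : th < pi by rewrite lt_neqAle ne.
case: leP => [h|h]; first by rewrite bet_le// vv_pihalf.
have thi : r / mu < th <= pi by rewrite h ltW.
have [x01 xp hE] := heading_bet mu0 r0 thi.
have /andP[x0 x1] := x01.
rewrite inwardE// s_starE// t_L_heading// hE.
have -> : mu * cos (al (r / mu) (bet (r / mu) th)) / mu = cos (al (r / mu) (bet (r / mu) th)).
  by field; rewrite gt_eqF.
rewrite /vv acosE_asin; last by lin.
by rewrite cosK// in_itv/=; have := al_itv (r / mu) (bet (r / mu) th); lin.
Qed.

Lemma tf_star_center mu : tf_star mu 0 pi = pi / 2.
Proof. by rewrite /tf_star eqxx mul0r acosE_asin ?acos0//; lin. Qed.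

End feedback_formulas.

(** * The lower bound for M *)

Section motions.
Context {R : realType}.
Implicit Types (a b c d e s t x y z A B K T mu : R) (l : @lady R) (m : @man R).
Local Notation pi := (@trigo.pi R).

Definition rho mu l t : R := rad l t / mu.
Definition phi l m t : R := azi l t - pos m t.
Definition th l m t : R := acl (cos (phi l m t)).

Lemma measurable_cos (D : set R) (f : R -> R) : measurable_fun D f ->
  measurable_fun D (fun t => cos (f t)).
Proof.
move=> mf; apply: measurableT_comp mf.
exact: continuous_measurable_fun (@continuous_cos R).
Qed.

Lemma measurable_sin (D : set R) (f : R -> R) : measurable_fun D f ->
  measurable_fun D (fun t => sin (f t)).
Proof.
move=> mf; apply: measurableT_comp mf.
exact: continuous_measurable_fun (@continuous_sin R).
Qed.

Lemma acos_cosE x : acos (cos x) = acl (cos x).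
Proof. by rewrite aclE// cos_geN1 cos_le1. Qed.

Lemma cos_th l m t : cos (th l m t) = cos (phi l m t).
Proof. by rewrite cos_acl// cos_geN1 cos_le1. Qed.

Lemma th_itv l m t : 0 <= th l m t <= pi.
Proof. exact: acl_itv. Qed.

Lemma sin_th l m t : sin (th l m t) = `|sin (phi l m t)|.
Proof.
have s0 : 0 <= sin (th l m t) by apply: sin_ge0_pi; exact: th_itv.
apply/eqP; rewrite -(eqrXn2 (n := 2)) ?normr_ge0// real_normK ?num_real//.
by rewrite !sin2cos2 cos_th.
Qed.

Lemma rel_angleE l m t : rad l t != 0 -> rel_angle l m t = th l m t.
Proof. by move=> r0; rewrite /rel_angle /angle (negbTE r0) acos_cosE. Qed.

Lemma rel_angle0 l m t : rad l t = 0 -> rel_angle l m t = pi.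
Proof. by move=> r0; rewrite /rel_angle /angle r0 eqxx. Qed.

Lemma orientE l m t : rad l t != 0 -> orient l m t = sg1 (sin (phi l m t)).
Proof. by move=> r0; rewrite /orient (negbTE r0). Qed.

Lemma orient0 l m t : rad l t = 0 -> orient l m t = 1.
Proof. by move=> r0; rewrite /orient r0 eqxx. Qed.

Lemma sg1_sqr x : sg1 x * sg1 x = 1.
Proof. by rewrite /sg1; case: ifP => _; rewrite ?mulrNN mulr1. Qed.

Lemma sg1_norm x : sg1 x * `|x| = x.
Proof.
rewrite /sg1; case: ifP => [x0|/negbT]; first by rewrite ger0_norm// mul1r.
by rewrite -ltNge => x0; rewrite ltr0_norm// mulrNN mul1r.
Qed.

Section lady.
Variables (mu r0 th0 T : R) (l : @lady R).
Hypotheses (mu0 : 0 < mu) (T0 : 0 <= T) (lm : lady_motion mu r0 th0 T l).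

Lemma rad_ge0 t : 0 <= t <= T -> 0 <= rad l t.
Proof. by case: lm => _ _ H _ _ /H/andP[]. Qed.

Lemma rho_ge0 t : 0 <= t <= T -> 0 <= rho mu l t.
Proof. by move=> /rad_ge0 h; rewrite divr_ge0// ltW. Qed.

Lemma rho_gt0 t : 0 < rad l t -> 0 < rho mu l t.
Proof. by move=> h; rewrite divr_gt0. Qed.

Lemma bm_cospsi : bm (fun t => cos (psi l t)) 0 T.
Proof.
case: lm => _ [mp _] _ _ _; split; first exact: measurable_cos.
by exists 1 => t _; rewrite cos_max.
Qed.

Lemma bm_sinpsi : bm (fun t => sin (psi l t)) 0 T.
Proof.
case: lm => _ [mp _] _ _ _; split; first exact: measurable_sin.
by exists 1 => t _; rewrite sin_max.
Qed.

Lemma der_rho : der (rho mu l) (fun t => cos (psi l t)) 0 T.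
Proof.
split; first exact: bm_cospsi.
move=> a b a0 ab bT; rewrite /rho -mulrBl; case: lm => _ _ _ -> // _.
have -> : \int[lebesgue_measure]_(t in `[a, b]) (mu * cos (psi l t)) =
    ig (fun t => mu * cos (psi l t)) a b by [].
by rewrite (igZ _ (bmW bm_cospsi a0 bT)) mulrAC mulfV ?mul1r// gt_eqF.
Qed.

Lemma rho_lip a b : 0 <= a -> a <= b -> b <= T ->
  `|rho mu l b - rho mu l a| <= b - a.
Proof.
move=> a0 ab bT; have [_ ->//] := der_rho; rewrite -[X in _ <= X]mul1r.
by apply: ig_norm_le => //; [exact: bmW bm_cospsi a0 bT|move=> t _; exact: cos_max].
Qed.

Lemma der_azi a b : 0 <= a -> b <= T ->
  (forall t, a <= t <= b -> 0 < rad l t) ->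
  der (azi l) (fun t => sin (psi l t) / rho mu l t) a b.
Proof.
move=> a0 bT rp.
have mv : bm (fun t => (rho mu l t)^-1) a b.
  have /der_continuous cr := derW der_rho a0 bT.
  apply: continuous_bm; apply/subspace_continuousP => t tab.
  apply: cvgV; first by rewrite gt_eqF// rho_gt0// rp//; move: tab; rewrite /= in_itv.
  by move/subspace_continuousP : cr; exact.
have mw : bm (fun t => sin (psi l t) / rho mu l t) a b.
  by apply: bmM mv; exact: bmW bm_sinpsi a0 bT.
split => // s t as_ st tb; case: lm => _ _ _ _ -> //; last 3 first.
- exact: le_trans as_.
- exact: le_trans bT.
- by move=> u /andP[u1 u2]; apply: rp; rewrite (le_trans as_)//= (le_trans u2).
apply: eq_ig => u /andP[u1 u2]; rewrite /rho invfM invrK.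
by rewrite mulrC (mulrC mu).
Qed.

End lady.

Lemma der_pos T m : man_motion T m -> der (pos m) (omega m) 0 T.
Proof.
move=> [_ mw w1 E].
have mb : bm (omega m) 0 T by split => //; exists 1 => t /w1; rewrite ler_norml.
split => // a b a0 ab bT.
have E' t : 0 <= t <= T -> pos m t = ig (omega m) 0 t by exact: E.
rewrite !E'; last 2 first.
- by rewrite a0 (le_trans ab).
- by rewrite (le_trans a0).
by rewrite (@ig_cat _ _ 0 a b)//; [ring|exact: bmW mb (lexx _) bT].
Qed.

Lemma pos_lip T m a b : man_motion T m -> 0 <= a -> a <= b -> b <= T ->
  `|pos m b - pos m a| <= b - a.
Proof.
move=> mm a0 ab bT; have [mw ->//] := der_pos mm; rewrite -[X in _ <= X]mul1r.
apply: ig_norm_le => //; first exact: bmW mw a0 bT.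
case: mm => _ _ w1 _ t /andP[t1 t2]; rewrite ler_norml w1//.
by rewrite (le_trans a0) ?(ltW t1)//= (le_trans (ltW t2)).
Qed.

Lemma der_phi mu r0 th0 T l m a b : 0 < mu -> lady_motion mu r0 th0 T l ->
  man_motion T m -> 0 <= a -> b <= T ->
  (forall t, a <= t <= b -> 0 < rad l t) ->
  der (phi l m) (fun t => sin (psi l t) / rho mu l t - omega m t) a b.
Proof.
move=> mu0 lm mm a0 bT rp; apply: derB; first exact: (der_azi mu0 lm a0 bT rp).
exact: derW (der_pos mm) a0 bT.
Qed.

Lemma th_cvgr mu r0 th0 T l m a b t : 0 < mu -> lady_motion mu r0 th0 T l ->
  man_motion T m -> 0 <= a -> b <= T ->
  (forall t, a <= t <= b -> 0 < rad l t) -> a <= t -> t < b ->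
  th l m s @[s --> t^'+] --> th l m t.
Proof.
move=> mu0 lm mm a0 bT rp at_ tb; apply: acl_cvg; apply: cos_cvg.
exact: der_cvgr (der_phi mu0 lm mm a0 bT rp) at_ tb.
Qed.

Lemma th_cvgl mu r0 th0 T l m a b t : 0 < mu -> lady_motion mu r0 th0 T l ->
  man_motion T m -> 0 <= a -> b <= T ->
  (forall t, a <= t <= b -> 0 < rad l t) -> a < t -> t <= b ->
  th l m s @[s --> t^'-] --> th l m t.
Proof.
move=> mu0 lm mm a0 bT rp at_ tb; apply: acl_cvg; apply: cos_cvg.
exact: der_cvgl (der_phi mu0 lm mm a0 bT rp) at_ tb.
Qed.

Lemma rad_near_pos mu r0 th0 T l t : 0 < mu -> lady_motion mu r0 th0 T l ->
  0 <= t <= T -> 0 < rad l t ->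
  exists2 d : R, 0 < d & forall s, 0 <= s <= T -> `|s - t| < d -> 0 < rad l s.
Proof.
move=> mu0 lm tT rt; have rt' : 0 < rho mu l t by rewrite divr_gt0.
exists (rho mu l t) => // s sT st.
have : `|rho mu l s - rho mu l t| <= `|s - t|.
  have [ts|/ltW ts] := leP t s.
    by rewrite (ger0_norm (x := s - t)) ?subr_ge0//; apply: (rho_lip mu0 lm); lin.
  by rewrite distrC (distrC s) (ger0_norm (x := t - s)) ?subr_ge0//; apply: (rho_lip mu0 lm); lin.
have sE : rad l s = rho mu l s * mu by rewrite /rho divfK// gt_eqF.
move=> h; rewrite sE mulr_gt0//.
by have := le_lt_trans h st; rewrite ltr_norml => /andP[]; lin.
Qed.

End motions.

(** * The two phases of a pursuit at full speed *)

Section pursuit.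
Context {R : realType}.
Implicit Types (a b c d e s t x y z A B K T mu : R) (l : @lady R) (m : @man R).
Local Notation pi := (@trigo.pi R).

Lemma der_oo (f f' g' : R -> R) A B : der f f' A B ->
  (forall t, A < t < B -> f' t = g' t) -> der f g' A B.
Proof.
move=> [mf E] fg; have mg := bm_oo mf fg; split => // a b Aa ab bB.
rewrite E//; apply: eq_ig_oo => //; first exact: bmW mf Aa bB.
  exact: bmW mg Aa bB.
by move=> t /andP[t1 t2]; apply: fg; rewrite (le_lt_trans Aa)//= (lt_le_trans t2).
Qed.

Lemma dot_le1 x y a b : x ^+ 2 + y ^+ 2 = 1 -> a ^+ 2 + b ^+ 2 = 1 ->
  x * a + y * b <= 1.
Proof.
move=> h1 h2; have := addr_ge0 (sqr_ge0 (x - a)) (sqr_ge0 (y - b)).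
have -> : (x - a) ^+ 2 + (y - b) ^+ 2 =
    (x ^+ 2 + y ^+ 2) + (a ^+ 2 + b ^+ 2) - 2 * (x * a + y * b) by ring.
by rewrite h1 h2; lin.
Qed.

Lemma sin_lt x : 0 < x -> sin x < x.
Proof.
move=> x0; have [x1|x1] := ltP 1 x; first exact: le_lt_trans (sin_le1 x) x1.
have p2 := pi_ge2 R.
have s0 : 0 < sin (x / 2) by apply: sin_gt0_pi; lin.
have c1 : cos (x / 2) < 1 by rewrite -[X in _ < X]cos0 lt_cos; lin.
have h1 : sin (x / 2) <= x / 2 by apply: sin_ltx; lin.
have h2 : sin (x / 2) * cos (x / 2) < sin (x / 2) by rewrite gtr_pMr.
by rewrite sin2half; lin.
Qed.

Lemma sin_lip1 x y : x <= y -> sin y - sin x <= y - x.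
Proof.
rewrite le_eqVlt => /predU1P[->|xy]; first by rewrite !subrr.
have H z : z \in `]x, y[ -> is_derive z 1 (@sin R) (cos z) by move=> _; exact: is_derive_sin.
have [z _ ->] := MVT xy H (continuous_subspaceT (@continuous_sin R)).
by rewrite ler_piMl ?cos_le1// subr_ge0 ltW.
Qed.

(** sin (x - theta) and, below, cos (x - theta), expanded so that [der_abs] applies to |sin phi| and
    [acl] need not be differentiated. *)
Definition sd x l m t : R := sin x * cos (phi l m t) - cos x * `|sin (phi l m t)|.
Definition cd x l m t : R := cos x * cos (phi l m t) + sin x * `|sin (phi l m t)|.

Lemma sdE x l m t : sd x l m t = sin (x - th l m t).
Proof. by rewrite /sd sinB cos_th sin_th. Qed.

Lemma cdE x l m t : cd x l m t = cos (x - th l m t).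
Proof. by rewrite /cd cosB cos_th sin_th. Qed.

Section play.
Variables (mu r0 th0 T : R) (l : @lady R) (m : @man R).
Hypotheses (mu0 : 0 < mu) (T0 : 0 <= T) (lm : lady_motion mu r0 th0 T l)
  (mm : man_motion T m).

(** For k = -1 the direction is fixed in space and the last term drops out; k = 1 serves alpha = V -
    t. *)
Lemma der_radial x0 k a b : 0 <= a -> b <= T ->
  (forall t, a <= t <= b -> 0 < rad l t) ->
  (forall t, a < t < b -> omega m t = sg1 (sin (phi l m t))) ->
  let X t := x0 + k * t in
  der (fun t => rho mu l t * sd (X t) l m t)
      (fun t => cos (psi l t) * sd (X t) l m t
        - sg1 (sin (phi l m t)) * sin (psi l t) * cd (X t) l m t
        + (k + 1) * (rho mu l t * cd (X t) l m t)) a b.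
Proof.
move=> a0 bT rp w X.
have Dr := derW (der_rho mu0 lm) a0 bT.
have Dp := der_phi mu0 lm mm a0 bT rp.
have ncos : continuous (fun x : R => - sin x).
  by move=> x; apply: cvgN; exact: continuous_sin.
have DX : der X (fun=> k) a b.
  have := derD (der_cst x0 a b) (derZ k (der_id a b)).
  by apply: eq_der => t _; rewrite ?add0r ?mulr1.
have DC := der_comp (@is_derive_cos R) ncos Dp.
have DS := der_abs (der_comp (@is_derive_sin R) (@continuous_cos R) Dp).
have DsX := der_comp (@is_derive_sin R) (@continuous_cos R) DX.
have DcX := der_comp (@is_derive_cos R) ncos DX.
have D := derM Dr (derB (derM DsX DC) (derM DcX DS)).
apply: (der_oo (f' := _)); first exact: D.
move=> t tab /=; have rt : rho mu l t != 0.
  by rewrite gt_eqF// divr_gt0// rp//; move: tab => /andP[h1 h2]; rewrite !ltW.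
rewrite (w t tab) /sd /cd.
have g2 := sg1_sqr (sin (phi l m t)).
have := sg1_norm (sin (phi l m t)).
set g := sg1 _ in g2 *; set S := `|_| => <-.
set C := cos (phi l m t); set sp := sin (psi l t); set cp := cos (psi l t).
set sX := sin (X t); set cX := cos (X t).
apply/eqP; rewrite -subr_eq0; apply/eqP.
transitivity ((g * g - 1) * (rho mu l t * (sX * S + cX * C)) ).
  field. exact: rt.
by rewrite g2 subrr mul0r.
Qed.

Lemma sd_cd x t : sd x l m t ^+ 2 + cd x l m t ^+ 2 = 1.
Proof. by rewrite sdE cdE addrC cos2Dsin2. Qed.

(** The scalar product of two unit vectors. *)
Lemma speed_le1 x t :
  cos (psi l t) * sd x l m t - sg1 (sin (phi l m t)) * sin (psi l t) * cd x l m t <= 1.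
Proof.
rewrite -mulNr; apply: dot_le1; last exact: sd_cd.
by rewrite sqrrN exprMn (expr2 (sg1 _)) sg1_sqr mul1r cos2Dsin2.
Qed.

(* Along a straight line of fixed direction L gains at most [mu] per unit of
   time, so [y + rho sin (y - theta - 2 alpha)] cannot increase. *)
Lemma first_phase V al a b : 0 <= a -> a <= b -> b <= T ->
  (forall t, a <= t <= b -> 0 < rad l t) ->
  (forall t, a < t < b -> omega m t = sg1 (sin (phi l m t))) ->
  V - b + rho mu l b * sd (V - b - 2 * al) l m b <=
  V - a + rho mu l a * sd (V - a - 2 * al) l m a.
Proof.
move=> a0 ab bT rp w.
have D := der_radial (V - 2 * al) (-1) a0 bT rp w.
have D1 := derD (derB (der_cst V a b) (der_id a b)) D.
have XE t : V - 2 * al + -1 * t = V - t - 2 * al by ring.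
have := der_le ab D1; rewrite /= !XE; apply=> t /andP[t1 t2].
have := speed_le1 (V - 2 * al + -1 * t) t; lin.
Qed.

(** H is the excess in the first-phase inequality when alpha = y = V - t. Its slope is at most 1 +
    cos^2 y - sin^2 y + 2 Y, where Y = rho cos (y + theta), and H >= 0 forces Y <= - cos^2 y. *)
Lemma second_phase V a b : 0 <= a -> a <= b -> b <= T ->
  (forall t, a <= t <= b -> 0 < rad l t) ->
  (forall t, a < t < b -> omega m t = sg1 (sin (phi l m t))) ->
  V - a <= pi / 2 -> 0 <= V - b ->
  let H t := - (sin (V - t) * cos (V - t)) + rho mu l t * sd (- (V - t)) l m t in
  (forall t, a < t < b -> 0 <= H t) -> H b <= H a.
Proof.
move=> a0 ab bT rp w Va Vb H H0.
have D := der_radial (- V) 1 a0 bT rp w.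
have DV : der (fun t => V - t) (fun=> -1) a b.
  by apply: eq_der (derB (der_cst V a b) (der_id a b)) => t _; rewrite ?sub0r.
have ncos : continuous (fun x : R => - sin x).
  by move=> x; apply: cvgN; exact: continuous_sin.
have Ds := der_comp (@is_derive_sin R) (@continuous_cos R) DV.
have Dc := der_comp (@is_derive_cos R) ncos DV.
have D1 := derD (derN (derM Ds Dc)) D.
have XE t : - V + 1 * t = - (V - t) by ring.
have := der_le ab D1; rewrite /= !XE; apply=> t tab; have /andP[t1 t2] := tab.
have tab' : a <= t <= b by rewrite !ltW.
rewrite XE; set y := V - t.
have y0 : 0 < y by rewrite /y; lin.
have y1 : y < pi / 2 by rewrite /y; lin.
have p0 := pi_gt0 R.
have sy : 0 < sin y by apply: sin_gt0_pi; lin.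
have cy : 0 <= cos y by apply: cos_ge0_pihalf; lin.
have Ht := H0 t tab; rewrite /H -/y in Ht.
have sp := speed_le1 (- y) t.
have r0' : 0 <= rho mu l t by rewrite ltW// divr_gt0// rp.
have sinS : 0 <= sin (th l m t) by rewrite sin_th.
have sE := sdE (- y) l m t; have cE := cdE (- y) l m t.
set X := rho mu l t * sd (- y) l m t in Ht *.
set Y := rho mu l t * cd (- y) l m t.
have E : rho mu l t * sin (th l m t) = - (X * cos y + Y * sin y).
  have -> : sin (th l m t) = - (sd (- y) l m t * cos y + cd (- y) l m t * sin y).
    rewrite sE cE -sinD (_ : - y - th l m t + y = - th l m t) ?sinN ?opprK//; ring.
  by rewrite /X /Y; ring.
have Y1 : Y <= - cos y ^+ 2.
  rewrite -(ler_pM2r sy).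
  have h1 : 0 <= rho mu l t * sin (th l m t) by exact: mulr_ge0.
  have h2 : sin y * cos y * cos y <= X * cos y by apply: ler_wpM2r => //; lin.
  by rewrite expr2; lin.
have s2 := sin2cos2 y.
move: sp; rewrite -/Y expr2 in s2 Y1 *; rewrite expr2 in s2; lin.
Qed.

End play.
End pursuit.

Section pursuit_bound.
Context {R : realType}.
Implicit Types (a b c d e s t x y z A B K T mu : R) (l : @lady R) (m : @man R).
Local Notation pi := (@trigo.pi R).

(** For phases that begin at the center, where theta need not be continuous: they begin e later, and
    e tends to 0. *)
Lemma le_small a b h : 0 < h -> (forall e, 0 < e < h -> a <= b + e) -> a <= b.
Proof.
move=> h0 H; apply/ler_addgt0Pr => e e0.
pose d := Num.min (e / 2) (h / 2).
have d0 : 0 < d by rewrite lt_min !divr_gt0.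
have de : d <= e / 2 by rewrite ge_min lexx.
have dh : d <= h / 2 by rewrite ge_min lexx orbT.
by have := H d; lra.
Qed.

Section play.
Variables (mu r0 th0 T : R) (l : @lady R) (m : @man R).
Hypotheses (mu0 : 0 < mu) (T0 : 0 <= T) (lm : lady_motion mu r0 th0 T l)
  (mm : man_motion T m).

(** The inequality on V and al holds with equality for the true value and its alpha. If E were
    reached before V had elapsed, it would be carried along both phases and fail at E. *)
Lemma pursuit_time (tau V al : R) : 0 <= tau -> tau <= T ->
  (forall t, tau < t <= T -> 0 < rad l t) ->
  (forall t, tau < t < T -> omega m t = sg1 (sin (phi l m t))) ->
  0 <= al -> al <= V -> al <= pi / 2 ->
  V + rho mu l tau * sd (V - 2 * al) l m tau <= al + sin al * cos al ->
  rho mu l T = 1 -> cos (phi l m T) = -1 -> V <= T - tau.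
Proof.
move=> tau0 tauT rp w al0 alV al1 F0 rT cT.
rewrite leNgt; apply/negP => lt; pose W := V + tau.
have p0 := pi_gt0 R.
have sT : `|sin (phi l m T)| = 0.
  by apply/eqP; rewrite normr_eq0 -sqrf_eq0 sin2cos2 cT sqrrN expr1n subrr.
have sdT x : sd x l m T = - sin x by rewrite /sd cT sT mulr0 subr0 mulrN1.
have rho_le s : tau <= s <= T -> rho mu l tau = 0 -> 0 <= rho mu l s <= s - tau.
  move=> /andP[s1 s2] E; have := rho_lip mu0 lm tau0 s1 s2; rewrite E subr0.
  have h := rho_ge0 mu0 lm (t := s); rewrite ger0_norm ?h//; lin.
have sd1 x t : -1 <= sd x l m t <= 1 by rewrite sdE sin_geN1 sin_le1.
have rtau : 0 < rad l tau \/ rho mu l tau = 0.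
  have := rad_ge0 lm (t := tau); rewrite tau0 tauT le_eqVlt => /(_ isT)/orP[/eqP h|]; [right|by left].
  by rewrite /rho -h mul0r.
pose N t := W - t + rho mu l t * sd (W - t - 2 * al) l m t.
have rpos a b : tau < a -> b <= T -> forall t, a <= t <= b -> 0 < rad l t.
  by move=> ta bT t /andP[t1 t2]; apply: rp; rewrite (lt_le_trans ta)//= (le_trans t2).
have NA b : tau <= b <= T -> N b <= N tau.
  move=> /andP[]; rewrite le_eqVlt => /predU1P[<-//|tb] bT.
  have [rt|rt] := rtau.
    apply: (first_phase mu0 lm mm) => //; first exact: ltW.
      move=> t /andP[]; rewrite le_eqVlt => /predU1P[<-//|t1 t2].
      by apply: rp; rewrite t1 (le_trans t2).
    by move=> t /andP[t1 t2]; apply: w; rewrite t1 (lt_le_trans t2).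
  rewrite {2}/N rt mul0r addr0.
  apply: (@le_small _ _ (b - tau)); first by rewrite subr_gt0.
  move=> e /andP[e0 eb]; pose s := tau + e.
  have sT' : tau <= s <= T by rewrite /s; lin.
  have : N b <= N s.
    apply: (first_phase mu0 lm mm) => //; rewrite /s; [lin|lin| |].
      by apply: rpos => //; lin.
    by move=> t t12; apply: w; lin.
  have /andP[h1 h2] := rho_le s sT' rt; have := sd1 (W - s - 2 * al) s.
  have : rho mu l s * sd (W - s - 2 * al) l m s <= rho mu l s.
    by rewrite ler_piMr//; case/andP: (sd1 (W - s - 2 * al) s).
  by rewrite {2}/N /s in h2 *; lin.
have Ntau : N tau <= al + sin al * cos al by rewrite /N /W addrK.
have yT : 0 < W - T by rewrite /W; lin.
(* If E is reached while the remaining time is still at least al, the first phase alone is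
   contradictory: it forces al = 0, and then sin y < y excludes it. *)
have [alT|alT] := leP al (W - T).
  have := NA T; rewrite tauT lexx /N rT mul1r sdT => /(_ isT) h.
  have := @sin_lip1 _ (- al) (W - T - 2 * al); rewrite sinN => h1.
  have h2 : sin (W - T - 2 * al) - - sin al <= W - T - 2 * al - - al by apply: h1; lin.
  have h3 : sin al <= sin al * cos al by rewrite /N in Ntau; lin.
  have s0 : 0 <= sin al by apply: sin_ge0_pi; lin.
  have [a0|a0] := ltP 0 al.
    have c1 : cos al < 1.
      by rewrite -[X in _ < X]cos0 lt_cos//; move: p0 a0 al1; lin_goal.
    have s1 : 0 < sin al by apply: sin_gt0_pi; lin.
    by move: h3; rewrite leNgt gtr_pMr// c1.
  have E : al = 0 by lin.
  rewrite /N E mulr0 !subr0 sin0 mul0r addr0 in Ntau h.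
  have := sin_lt yT; lin.
(* At t1 the remaining time equals al, and the first-phase inequality reads H t1 <= 0, whereas H is
   positive at E. *)
pose t1 := W - al.
have t1T : tau <= t1 < T by move: alT; rewrite /t1 /W; lin.
have /andP[t1a t1b] := t1T.
pose H t := - (sin (W - t) * cos (W - t)) + rho mu l t * sd (- (W - t)) l m t.
have Ht1 : H t1 <= 0.
  have := NA t1; rewrite t1a (ltW t1b) => /(_ isT).
  move: Ntau; rewrite /H /N /t1 subKr; have -> : al - 2 * al = - al by ring.
  lin.
have HT : 0 < H T.
  rewrite /H rT mul1r sdT sinN opprK.
  have s1 : 0 < sin (W - T) by apply: sin_gt0_pi; lin.
  have c1 : cos (W - T) < 1.
    by rewrite -[X in _ < X]cos0 lt_cos//; move: p0 yT alT al1; lin_goal.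
  by rewrite addrC subr_gt0 gtr_pMr.
(* After t0 H is positive, so [second_phase] forbids it to have increased. *)
have [//||t0 [/andP[t01 t02] Ht0 tH]] := @last_time _ (fun t => H t <= 0) t1 T (ltW t1b).
  move=> t /andP[tt1 tT] /negP; rewrite -ltNge => Hpos.
  have ta : tau < (tau + t) / 2 by lin.
  have cH : H s @[s --> t^'-] --> H t.
    have -> : H = fun s => - (sin (W - s) * cos (W - s)) + rho mu l s * sin (- (W - s) - th l m s).
      by apply/funext => s; rewrite /H sdE.
    have cW : W - s @[s --> t^'-] --> W - t.
      by apply: cvgB; [exact: cvg_cst|apply: cvg_at_left_filter; exact: cvg_id].
    apply: cvgD; first by apply: cvgN; apply: cvgM; [exact: sin_cvg|exact: cos_cvg].
    apply: cvgM; first by apply: der_cvgl (der_rho mu0 lm) _ _ => //; lin.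
    apply: sin_cvg; apply: cvgB; first exact: cvgN.
    by apply: (th_cvgl mu0 lm mm _ _ (rpos _ _ ta tT)) => //; lin.
  move/cvgrPdist_lt : cH => /(_ _ Hpos); apply: filterS => s.
  by rewrite ltr_norml => h; apply/negP; rewrite -ltNge; move: h; lin_goal.
have t0T : t0 < T.
  by rewrite lt_neqAle t02 andbT; apply/eqP => E; move: Ht0; rewrite E leNgt HT.
have step a : t0 <= a -> a < T -> (forall t, a <= t <= T -> 0 < rad l t) -> H T <= H a.
  move=> t0a aT rpa; have ta := le_trans t1a (le_trans t01 t0a).
  apply: (second_phase mu0 lm mm) => //.
  - exact: le_trans tau0 ta.
  - exact: ltW.
  - by move=> t /andP[at_ tT]; apply: w; rewrite (le_lt_trans ta).
  - by move: t01 t0a al1; rewrite /t1; lin_goal.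
  - exact: ltW.
  - move=> t t12; apply: ltW; rewrite ltNge; apply/negP; apply: tH.
    by case/andP: t12 => at_ tT; rewrite (le_lt_trans t0a)//= ltW.
have [rt0|rt0] : 0 < rad l t0 \/ t0 = tau /\ rho mu l tau = 0.
  have := le_trans t1a t01; rewrite le_eqVlt => /predU1P[E|lt0]; last first.
    by left; apply: rp; rewrite lt0.
  by case: rtau => h; [left; rewrite -E|right].
- have := step t0 (lexx _) t0T.
  suff rp0 : forall t, t0 <= t <= T -> 0 < rad l t by move=> /(_ rp0); rewrite leNgt (le_lt_trans Ht0).
  move=> t /andP[]; rewrite le_eqVlt => /predU1P[<-//|h1 h2].
  by apply: rp; rewrite (le_lt_trans (le_trans t1a t01)).
- case: rt0 => E rt0; suff : H T <= 0 by rewrite leNgt HT.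
  apply: (@le_small _ _ (T - t0)); first by rewrite subr_gt0.
  move=> e /andP[e0 eb]; pose s := t0 + e.
  have hs : H T <= H s.
    have es : t0 < s by rewrite ltrDl.
    apply: step; [exact: ltW|by rewrite -ltrBrDl|apply: rpos => //].
    by rewrite (le_lt_trans (le_trans t1a t01)).
  have sT' : tau <= s <= T by move: e0 eb; rewrite /s E; lin_goal.
  have /andP[h1 h2] := rho_le s sT' rt0.
  have : rho mu l s * sd (- (W - s)) l m s <= rho mu l s.
    by rewrite ler_piMr//; case/andP: (sd1 (- (W - s)) s).
  have : 0 <= sin (W - s) * cos (W - s).
    have /andP[y1 y2] : 0 <= W - s <= pi / 2.
      by move: t01 e0 eb yT al1; rewrite /s /t1; lin_goal.
    rewrite mulr_ge0//; [apply: sin_ge0_pi|apply: cos_ge0_pihalf].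
      by move: p0 y1 y2; lin_goal.
    by move: p0 y1 y2; lin_goal.
  by rewrite {2}/H /s in hs h2 *; lin.
Qed.

End play.
End pursuit_bound.

Section man_lower_bound.
Context {R : realType}.
Implicit Types (a b c d e s t x y z A B K T mu : R) (l : @lady R) (m : @man R).
Local Notation pi := (@trigo.pi R).

Section play.
Variables (mu r0 th0 T : R) (l : @lady R) (m : @man R).
Hypotheses (mu0 : 0 < mu) (T0 : 0 <= T) (lm : lady_motion mu r0 th0 T l)
  (mm : man_motion T m).

Lemma th_start : 0 <= th0 <= pi -> th l m 0 = th0.
Proof.
move=> th0_itv; case: lm => [[_ az0] _ _ _ _]; case: mm => [p0 _ _ _].
by rewrite /th /phi az0 p0 subr0 acl_cos.
Qed.

Lemma near_outer t : 0 < t -> t <= T -> 0 < rad l t -> rho mu l t < th l m t ->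
  \forall s \near t^'-, 0 < rad l s /\ rho mu l s < th l m s.
Proof.
move=> t0 tT rt lt.
have tT' : 0 <= t <= T by rewrite ltW.
have [d d0 H] := rad_near_pos mu0 lm tT' rt.
pose a := Num.max 0 (t - d / 2).
have a0 : 0 <= a by rewrite le_max lexx.
have at_ : a < t by rewrite gt_max t0 /=; lin.
have ad : t - d < a by rewrite lt_max; apply/orP; right; lin.
have rp s : a <= s <= t -> 0 < rad l s.
  move=> /andP[s1 s2]; apply: H; first by rewrite (le_trans a0)//= (le_trans s2).
  by rewrite distrC ger0_norm; lin.
have c1 := th_cvgl mu0 lm mm a0 tT rp at_ (lexx _).
have c2 := der_cvgl (der_rho mu0 lm) t0 tT.
have c : (th l m s - rho mu l s) @[s --> t^'-] --> (th l m t - rho mu l t).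
  exact: cvgB c1 c2.
move/cvgrPdist_lt : c => /(_ (th l m t - rho mu l t)).
rewrite subr_gt0 => /(_ lt) [e /= e0 He].
apply/near_leftP; exists (Num.min e (t - a)).
  by rewrite lt_min e0 subr_gt0.
move=> s /andP[s1 s2]; split.
  by apply: rp; rewrite (ltW s2) andbT; move: s1; rewrite ltrBlDr -ltrBlDl lt_min => /andP[]; lin.
have : ball t e s.
  by rewrite /ball/= ger0_norm; move: s1; rewrite ltrBlDr -ltrBlDl lt_min => /andP[]; lin.
move=> /He /(_ s2); set u := th l m s - _.
by rewrite ltr_norml => /andP[_]; rewrite /u; lin.
Qed.

Lemma man_follows_outer t : man_follows (omega_star mu) T l m ->
  0 <= t < T -> 0 < rad l t -> rho mu l t < th l m t ->
  omega m t = sg1 (sin (phi l m t)).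
Proof.
move=> fm tT rt lt; have := fm t tT.
have rt' : rad l t != 0 by rewrite gt_eqF.
rewrite rel_angleE// orientE// /omega_star lt /= => h.
by rewrite -[LHS]mul1r -(sg1_sqr (sin (phi l m t))) -mulrA h mulr1.
Qed.

Lemma man_lower_bound : 0 <= th0 <= pi -> man_follows (omega_star mu) T l m ->
  final_time mu l m T -> vv (r0 / mu) (bet (r0 / mu) th0) <= T.
Proof.
move=> th0_itv fm [_ [radT angT] _].
have p2 := pi_ge2 R.
have rad0 : rad l 0 = r0 by case: lm => [[]].
have rho0 : rho mu l 0 = r0 / mu by rewrite /rho rad0.
have rhoT : rho mu l T = 1 by rewrite /rho radT divff// gt_eqF.
have thT : th l m T = pi by rewrite -angT rel_angleE// radT gt_eqF.
have cosT : cos (phi l m T) = -1 by rewrite -cos_th thT cospi.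
(* The center is added to the zone because the azimuth is unconstrained there. *)
pose P t := rad l t = 0 \/ th l m t <= rho mu l t.
have nPE t : 0 <= t <= T -> ~ P t -> 0 < rad l t /\ rho mu l t < th l m t.
  move=> tT nP; split; last by rewrite ltNge; apply/negP => h; apply: nP; right.
  rewrite lt_neqAle (rad_ge0 lm tT) andbT; apply/eqP => h; apply: nP; left.
  by rewrite -h.
have nPT : ~ P T.
  by case; [rewrite radT => h; move: mu0; rewrite h ltxx|rewrite thT rhoT; lin].
have r00 : 0 <= r0 / mu by rewrite -rho0 (rho_ge0 mu0 lm)// lexx.
have [[a [/andP[a0 aT] Pa]]|nP] := pselect (exists a, 0 <= a <= T /\ P a).
  have [|tau [/andP[at_ tT] Ptau nPt]] := @last_time _ P a T aT Pa.
    move=> t /andP[at_ tT] nPt.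
    have t0 : 0 < t by exact: le_lt_trans at_.
    have tT' : 0 <= t <= T by rewrite ltW.
    have [h1 h2] := nPE t tT' nPt.
    apply: filterS (near_outer t0 tT h1 h2) => s [h3 h4] [h|].
      by rewrite h ltxx in h3.
    by rewrite leNgt h4.
  have tau0 : 0 <= tau by exact: le_trans at_.
  have tauT : tau < T.
    by rewrite lt_neqAle tT andbT; apply/eqP => h; apply: nPT; rewrite -h.
  have out t : tau < t <= T -> 0 < rad l t /\ rho mu l t < th l m t.
    move=> /andP[t1 t2]; apply: nPE; last by apply: nPt; rewrite t1.
    by rewrite (le_trans tau0 (ltW t1)).
  (* From the last zone time on, the bound is that of the line through the center, alpha = pi / 2.
     Before tau the radius rho changes by at most tau, which carries the bound back to time 0. *)
  have h : pi / 2 + rho mu l tau <= T - tau.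
    have rt0 : 0 <= rho mu l tau by apply: (rho_ge0 mu0 lm); rewrite tau0.
    apply: (pursuit_time mu0 lm mm (al := pi / 2) tau0 tT) => //; [| |lin|lin|].
    - by move=> t /out[].
    - move=> t /andP[t1 t2]; have [|h1 h2] := out t; first by rewrite t1 ltW.
      apply: man_follows_outer => //; first by rewrite (le_trans tau0 (ltW t1)).
    rewrite cos_pihalf mulr0 addr0 sdE.
    have [rt|rt] := eqVneq (rad l tau) 0.
      by rewrite /rho rt mul0r mul0r !addr0.
    (* The zone condition gives one inequality at tau, the limit from the right the other. *)
    have thr : th l m tau = rho mu l tau.
      case: Ptau => [h|h]; first by rewrite h eqxx in rt.
      apply/eqP; rewrite eq_le h /=.
      have rp : forall t, tau <= t <= T -> 0 < rad l t.
        move=> t /andP[]; rewrite le_eqVlt => /predU1P[<- _|t1 t2].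
          by rewrite lt_neqAle eq_sym rt (rad_ge0 lm)// tau0.
        by case: (out t) => //; rewrite t1.
      have c1 := th_cvgr mu0 lm mm tau0 (lexx _) rp (lexx _) tauT.
      have c2 := der_cvgr (der_rho mu0 lm) tau0 tauT.
      apply: ler_cvg_to c2 c1 _; apply/near_rightP.
      exists (T - tau); first by rewrite subr_gt0.
      by move=> s /andP[s1 s2]; apply: ltW; case: (out s) => //; lin.
    rewrite thr.
    have -> : pi / 2 + rho mu l tau - 2 * (pi / 2) - rho mu l tau = - (pi / 2) by lin.
    by rewrite sinN sin_pihalf; lin.
  have := vv_le (bet (r0 / mu) th0) r00.
  have := rho_lip mu0 lm (lexx 0) tau0 tT.
  by rewrite rho0 ler_norml => /andP[]; lin.
have out t : 0 <= t <= T -> 0 < rad l t /\ rho mu l t < th l m t.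
  by move=> tT; apply: nPE => // Pt; apply: nP; exists t.
have [] := out 0; first by rewrite lexx.
rewrite rho0 th_start// rad0 => r0p lt0; rewrite -[X in _ <= X]subr0.
have rp : 0 < r0 / mu by rewrite divr_gt0.
have /andP[th0_ge0 th0_pi] := th0_itv.
have bi := bet_itv rp th0_pi.
have ThE : Th (r0 / mu) (bet (r0 / mu) th0) = th0.
  by rewrite Th_bet//; apply/max_idPl; exact: ltW.
set b := bet _ _ in ThE bi *; set r := r0 / mu in ThE bi rp *.
have /andP[a1 a2] := al_itv r b.
apply: (pursuit_time mu0 lm mm (al := al r b) (lexx 0) T0) => //.
- by move=> t /andP[t1 t2]; case: (out t) => //; rewrite ltW.
- move=> t /andP[t1 t2]; have [|h1 h2] := out t; first by rewrite !ltW.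
  by apply: man_follows_outer => //; rewrite ltW.
- by rewrite /vv lerDl tl_ge0.
rewrite sdE th_start// rho0 -/r -ThE.
have -> : vv r b - 2 * al r b - Th r b = b - pi by rewrite vvE; ring.
have -> : sin (b - pi) = - sin b by rewrite sinB cospi sinpi mulr0 subr0 mulrN1.
by rewrite /vv tlE; lin.
Qed.

End play.
End man_lower_bound.

(** * Motions of M that follow [omega_star] *)

Section man_existence.
Context {R : realType}.
Implicit Types (a b c d e f s t x y z p A B K T S mu : R) (l : @lady R) (m : @man R).
Local Notation pi := (@trigo.pi R).

Lemma der_cat (f f' : R -> R) a c b : der f f' a c -> der f f' c b ->
  der f f' a b.
Proof.
move=> [m1 E1] [m2 E2]; have mm := bm_cat m1 m2; split => // x y ax xy yb.
have [yc|cy] := leP y c; first exact: E1.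
have [cx|xc] := leP c x; first by apply: E2 => //; exact: ltW.
rewrite (@ig_cat _ _ x c y) ?(ltW cy) ?(ltW xc)//; last exact: bmW mm ax yb.
by rewrite -E1 ?(ltW xc)// -E2 ?(ltW cy)//; ring.
Qed.

Lemma eq_der_oo (f f' g g' : R -> R) a b :
  (forall t, a <= t <= b -> f t = g t) -> (forall t, a < t < b -> f' t = g' t) ->
  der f f' a b -> der g g' a b.
Proof. by move=> fg fg' D; apply: der_oo fg'; exact: eq_der D. Qed.

Lemma man_motionP T m : pos m 0 = 0 -> der (pos m) (omega m) 0 T ->
  (forall t, 0 <= t <= T -> -1 <= omega m t <= 1) -> man_motion T m.
Proof.
move=> p0 [[mo _] E] o1; split => // t /andP[t0 tT].
by have := E 0 t (lexx _) t0 tT; rewrite p0 subr0.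
Qed.

(* On theta <= rho any control is optimal; theta / rho makes the law continuous
   at theta = rho and at theta = 0, which leaves only the jump at theta = pi. *)
Definition man_law r f : R := sg1 (sin f) * Num.min 1 (acl (cos f) / r).

Lemma sg1P x : (0 <= x /\ sg1 x = 1) \/ (x < 0 /\ sg1 x = -1).
Proof. by rewrite /sg1; case: leP => h; [left|right]. Qed.

Lemma measurable_sg1 (D : set R) (f : R -> R) : measurable_fun D f ->
  measurable_fun D (fun t => sg1 (f t)).
Proof.
move=> mf; apply: (measurableT_comp _ mf); apply: nondecreasing_measurable => //.
by move=> x y xy; case: (sg1P x) => -[x0 ->]; case: (sg1P y) => -[y0 ->]; lin.
Qed.

Section law.
Variables (r : R).
Hypothesis r0 : 0 < r.
Let c f := Num.min 1 (acl (cos f) / r).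

Let c0 f : 0 <= c f.
Proof.
by rewrite le_min ler01 divr_ge0 ?(ltW r0)//; case/andP: (acl_itv (cos f)).
Qed.

Let c1 f : c f <= 1. Proof. by rewrite ge_min lexx. Qed.

Lemma man_law_norm f : `|man_law r f| <= 1.
Proof.
rewrite normrM; have -> : `|sg1 (sin f)| = 1.
  by case: (sg1P (sin f)) => -[_ ->]; rewrite ?normrN normr1.
by rewrite mul1r ger0_norm; [exact: c1|exact: c0].
Qed.

Let c_near f e : 0 < e -> exists2 d : R, 0 < d &
  forall y, `|y - f| < d -> `|c f - c y| <= e.
Proof.
move=> e0; have /cvgrPdist_le /(_ _ e0) [d /= d0 H] : c y @[y --> f] --> c f.
  apply: (@continuous_min _ _ (fun=> 1) (fun y => acl (cos y) / r)); first exact: cvg_cst.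
  apply: cvgM; last exact: cvg_cst.
  by apply: acl_cvg; exact: continuous_cos.
by exists d => // y yf; apply: H; rewrite /ball/= distrC.
Qed.

Let sin_near f e : 0 < e -> exists2 d : R, 0 < d &
  forall y, `|y - f| < d -> `|sin f - sin y| < e.
Proof.
move=> e0; have /cvgrPdist_lt /(_ _ e0) [d /= d0 H] := @continuous_sin R f.
by exists d => // y yf; apply: H; rewrite /ball/= distrC.
Qed.

(** At odd multiples of pi the sign takes its upper value, which is also the limit from the left; at
    multiples of 2 pi the law vanishes. Left in f means right in the position of M, as [usc_ode]
    demands. *)
Lemma man_law_usc f e : 0 < e -> exists2 d : R, 0 < d &
  forall y, `|y - f| < d -> man_law r y <= man_law r f + e.
Proof.
move=> e0; have [d d0 H] := c_near f e0.
have [[s0 E]|[s0 E]] := sg1P (sin f).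
  exists d => // y /H; rewrite ler_norml /man_law -!/(c _) E => /andP[h1 h2].
  by have := c0 y; case: (sg1P (sin y)) => -[_ ->]; lin.
have [|d' d'0 H'] := @sin_near f (- sin f); first by rewrite oppr_gt0.
exists (Num.min d d'); first by rewrite lt_min d0.
move=> y; rewrite lt_min => /andP[/H + /H']; rewrite ltr_norml ler_norml.
move=> /andP[h1 h2] /andP[h3 h4]; rewrite /man_law -!/(c _) E.
by case: (sg1P (sin y)) => -[? ->]; lin.
Qed.

Lemma man_law_left f e : 0 < e -> exists2 d : R, 0 < d &
  forall y, f - d < y <= f -> man_law r f <= man_law r y + e.
Proof.
move=> e0; have [d d0 H] := c_near f e0.
have Hl y : f - d < y <= f -> `|c f - c y| <= e.
  by move=> /andP[y1 y2]; apply: H; rewrite ler0_norm; lin.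
have [[s0 E]|[s0 E]] := sg1P (sin f); last first.
  exists d => // y /Hl; rewrite ler_norml /man_law -!/(c _) E => /andP[h1 h2].
  by have := c0 y; have := c0 f; case: (sg1P (sin y)) => -[_ ->]; lin.
have [s00|s00] := eqVneq (sin f) 0; last first.
  have [|d' d'0 H'] := @sin_near f (sin f); first by rewrite lt_neqAle eq_sym s00.
  exists (Num.min d d'); first by rewrite lt_min d0.
  move=> y; rewrite ltrBlDr -ltrBlDl lt_min -andbA => /and3P[y1 y2 y3].
  have := Hl y; rewrite ltrBlDr -ltrBlDl y1 => /(_ y3).
  have := H' y; rewrite distrC (ger0_norm (x := f - y)) ?subr_ge0// => /(_ y2).
  rewrite ltr_norml ler_norml /man_law -!/(c _) E => /andP[h1 h2] /andP[h3 h4].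
  by case: (sg1P (sin y)) => -[? ->]; lin.
have p2 := pi_ge2 R.
have [cf|cf] := leP 0 (cos f).
  have cf0 : c f = 0.
    rewrite /c acl_ge1 ?mul0r; first by apply/min_idPr.
    by have := cos2Dsin2 f; rewrite s00 expr0n/= addr0 => /eqP; rewrite sqrf_eq1 => /orP[/eqP->|/eqP h] //; lin.
  exists d => // y /Hl; rewrite ler_norml /man_law -!/(c _) cf0 => /andP[h1 h2].
  by case: (sg1P (sin y)) => -[_ ->]; lin.
exists (Num.min d pi); first by rewrite lt_min d0; lin.
move=> y; rewrite ltrBlDr -ltrBlDl lt_min -andbA => /and3P[y1 y2 y3].
have := Hl y; rewrite ltrBlDr -ltrBlDl y1 => /(_ y3).
have sy : 0 <= sin y.
  have -> : y = f - (f - y) by ring.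
  rewrite sinB s00 mul0r sub0r -mulNr mulr_ge0//; first by lin.
  by apply: sin_ge0_pi; lin.
rewrite ler_norml /man_law -!/(c _) E => /andP[h1 h2].
by case: (sg1P (sin y)) => -[? ->]; lin.
Qed.

End law.

Section play.
Variables (mu r0 th0 T : R) (l : @lady R).
Hypotheses (mu0 : 0 < mu) (T0 : 0 <= T) (lm : lady_motion mu r0 th0 T l).

(** At the center the angle counts as pi, where [omega_star] prescribes 1. *)
Definition man_rate t p : R :=
  if rho mu l t <= 0 then 1 else man_law (rho mu l t) (azi l t - p).

(** The azimuth is arbitrary at the center. On the open set of the other times it is continuous. *)
Lemma measurable_azi_oo a b : 0 <= a -> b <= T ->
  measurable_fun (`]a, b[ `&` (fun t => rho mu l t <= 0) @^-1` [set false]) (azi l).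
Proof.
move=> a0 bT.
have nb t : a < t < b -> 0 < rad l t -> exists2 d : R, 0 < d &
    forall s, `|s - t| <= d -> a < s < b /\ 0 < rad l s.
  move=> /andP[t1 t2] rt.
  have tT : 0 <= t <= T by rewrite (le_trans a0 (ltW t1)) (le_trans (ltW t2) bT).
  have [d d0 H] := rad_near_pos mu0 lm tT rt.
  pose e := Num.min (d / 2) (Num.min ((t - a) / 2) ((b - t) / 2)).
  have e0 : 0 < e by rewrite !lt_min !divr_gt0// subr_gt0.
  exists e => // s; rewrite ler_norml => /andP[s1 s2].
  have h1 : e <= d / 2 by rewrite ge_min lexx.
  have h2 : e <= (t - a) / 2 by rewrite /e !ge_min lexx orbT.
  have h3 : e <= (b - t) / 2 by rewrite /e !ge_min lexx !orbT.
  split; first by lin.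
  by apply: H; [lin|rewrite ltr_norml; lin].
have DE t : (`]a, b[ `&` (fun t => rho mu l t <= 0) @^-1` [set false]) t ->
    a < t < b /\ 0 < rad l t.
  rewrite /= in_itv/= => -[tab] /negbT; rewrite -ltNge.
  by rewrite /rho pmulr_lgt0 ?invr_gt0.
apply: open_continuous_measurable_fun.
  move=> t /DE[tab rt]; have [d d0 H] := nb t tab rt.
  exists d => //= s; rewrite /ball/= distrC => /ltW/H[h1 h2].
  by rewrite in_itv/=; split => //; apply/negbTE; rewrite -ltNge divr_gt0.
move=> t; rewrite inE => /DE[tab rt]; have [d d0 H] := nb t tab rt.
have [|a1 _] := H (t - d); first by rewrite addrAC subrr sub0r normrN gtr0_norm.
have [|b1 _] := H (t + d); first by rewrite addrAC subrr add0r gtr0_norm.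
have [|||K K0 L] := der_lip (@der_azi _ mu r0 th0 T l mu0 lm (t - d) (t + d) _ _ _).
- by lin.
- by lin.
- by move=> s sd; case: (H s) => //; rewrite ler_norml; lin.
apply/left_right_continuousP; split.
  apply: (@lip_cvgl _ _ K t (t - d)); first by lin.
  by move=> s /andP[s1 s2]; apply: L; lin.
apply: (@lip_cvgr _ _ K t (t + d)); first by lin.
by move=> s /andP[s1 s2]; apply: L; lin.
Qed.

Lemma bm_man_rate a b p : 0 <= a -> b <= T -> bm (fun t => man_rate t p) a b.
Proof.
move=> a0 bT.
have R1 t : `|man_rate t p| <= 1.
  rewrite /man_rate; case: (leP (rho mu l _) 0) => h; first by rewrite normr1.
  exact: man_law_norm.
split; last by exists 1.
apply: (@measurable_fun_itv_cc _ _ _ false true).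
have mr : measurable_fun `]a, b[ (rho mu l).
  have [m1 _] := bmW (der_bm0 (der_rho mu0 lm)) a0 bT.
  by apply: measurable_funS m1 => //; exact: subset_itv_oo_cc.
apply: measurable_fun_if => //.
- by apply: measurable_fun_ler => //; exact: measurable_cst.
- have ma := measurable_azi_oo a0 bT.
  set D := _ `&` _ in ma *.
  have mf : measurable_fun D (fun t => azi l t - p) by apply: measurable_funB.
  apply: measurable_funM; first by apply: measurable_sg1; exact: measurable_sin.
  apply: measurable_minr => //; apply: measurable_funM.
    apply: (measurableT_comp (f := acl)).
      exact: continuous_measurable_fun (@continuous_acl R).
    exact: measurable_cos.
  have mD : measurable_fun D (rho mu l) by apply: measurable_funS mr => //; exact: subIsetl.
  apply: (eq_measurable_fun (fun t => rho mu l t `^ (-1))).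
    move=> t; rewrite inE => -[_ /negbT]; rewrite -ltNge => h.
    by rewrite powR_inv1// ltW.
  by apply: (measurableT_comp (f := fun z : R => z `^ (-1))) => //; exact: measurable_powR.
Qed.

Lemma man_extends S m : 0 <= S <= T -> man_motion S m ->
  man_follows (omega_star mu) S l m -> exists m',
  [/\ man_motion T m', man_follows (omega_star mu) T l m' & man_agree S m m'].
Proof.
move=> /andP[S0 ST] mm fm.
have [||||p [mp pE]] := @usc_ode R man_rate 1 S T (pos m S) ST.
- move=> t x; rewrite /man_rate; case: (leP (rho mu l _) 0) => h; first by rewrite normr1.
  exact: man_law_norm.
- by move=> x; exact: bm_man_rate.
- move=> t x e _ e0; rewrite /man_rate; case: (leP (rho mu l _) 0) => h.
    by exists 1 => // y _; rewrite lerDl ltW.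
  have [d d0 H] := man_law_usc h (azi l t - x) e0.
  exists d => // y yx; apply: H; have -> : azi l t - y - (azi l t - x) = x - y by ring.
  by rewrite distrC.
- move=> t x e _ e0; rewrite /man_rate; case: (leP (rho mu l _) 0) => h.
    by exists 1 => // y _; rewrite lerDl ltW.
  have [d d0 H] := man_law_left h (azi l t - x) e0.
  by exists d => // y yx; apply: H; lin.
have dp : der p (fun t => man_rate t (p t)) S T.
  split => // a b Sa ab bT; rewrite !pE ?Sa ?(le_trans Sa ab) ?(le_trans ab bT)//.
  by rewrite (@ig_cat _ _ S a b)//; [ring|exact: bmW mp (lexx _) bT].
have pS : p S = pos m S by rewrite pE ?lexx// ig0 addr0.
pose m' := Man (fun t => if t <= S then pos m t else p t)
  (fun t => if t < S then omega m t else man_rate t (p t)).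
have dm : der (pos m') (omega m') 0 T.
  apply: (@der_cat _ _ 0 S T).
    apply: eq_der_oo (der_pos mm) => t /andP[t1 t2] /=; first by rewrite t2.
    by rewrite t2.
  apply: eq_der_oo dp => t /andP[t1 t2] /=.
    by case: leP => // h; have -> : t = S by apply/le_anti; rewrite h.
  by rewrite ltNge (ltW t1).
have rate1 t : -1 <= man_rate t (p t) <= 1.
  rewrite -ler_norml /man_rate; case: (leP (rho mu l t) 0) => h; first by rewrite normr1.
  exact: man_law_norm.
exists m'; split; last by split => t /andP[t1 t2] /=; rewrite t2.
  apply: man_motionP => //; first by rewrite /= S0; case: mm.
  move=> t /andP[t1 t2] /=; case: ltP => // tS.
  by case: mm => _ _ + _; apply; rewrite t1 ltW.
move=> t /andP[t0 tT].
have [tS|St] := ltP t S.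
  have := fm t; rewrite t0 tS => /(_ isT).
  by rewrite /rel_angle /orient /= (ltW tS) tS.
have E : pos m' t = p t.
  by rewrite /=; case: leP => // h; have -> : t = S by apply/le_anti; rewrite h.
have Eo : omega m' t = man_rate t (p t) by rewrite /= ltNge St.
have tT' : 0 <= t <= T by rewrite t0 ltW.
have [r00|rp] := eqVneq (rad l t) 0.
  rewrite rel_angle0// orient0// r00 Eo /man_rate /rho r00 mul0r lexx mul1r.
  by rewrite /omega_star mul0r pi_gt0.
have rp' : 0 < rho mu l t by rewrite divr_gt0// lt_neqAle eq_sym rp (rad_ge0 lm).
rewrite rel_angleE// orientE// Eo /man_rate leNgt rp' /= /man_law.
have -> : azi l t - p t = phi l m' t by rewrite /phi E.
rewrite mulrA sg1_sqr mul1r -/(th l m' t) /omega_star -/(rho mu l t).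
have /andP[th0' th1'] := th_itv l m' t.
case: ltP => h.
  by apply/min_idPl; rewrite ler_pdivlMr// mul1r ltW.
case: eqVneq => [->|h2].
  by rewrite mul0r; apply/min_idPr.
rewrite /= le_min ge_min lexx /= andbT; apply/andP; split; first by lin.
by apply: (@le_trans _ _ 0); [lin|rewrite divr_ge0// ltW].
Qed.

End play.

Lemma man_secures_omega_star mu r0 th0 : 0 < mu -> 0 <= th0 <= pi ->
  man_secures mu r0 th0 (omega_star mu) (vv (r0 / mu) (bet (r0 / mu) th0)).
Proof.
move=> mu0 th0_itv T l T0 lm; split.
  by move=> S m ST mm fm; exact: (man_extends mu0 lm ST mm fm).
by move=> m mm fm ft; exact: (man_lower_bound mu0 T0 lm mm th0_itv fm ft).
Qed.

End man_existence.

(** * The value along the feedback of L *)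

Section strategy.
Context {R : realType}.
Implicit Types (a b c d e mu r s t th w x y : R).
Local Notation pi := (@trigo.pi R).

(* For r > 1, [Th r (bmin r)] is pi + sqrt (r^2 - 1) - acos (1 / r), so that
   [Gam] is the barrier; it is pi for r <= 1. *)
Definition Gam r : R := 2 * pi - Th r (bmin r).

Lemma Gam_le1 r : 0 < r <= 1 -> Gam r = pi.
Proof. by move=> r01; rewrite /Gam Th_bmin_le1//; ring. Qed.

Lemma Gam_le_pi r : 0 < r -> Gam r <= pi.
Proof. by move=> r0; rewrite /Gam; have := Th_bmin_ge r0; lin. Qed.

Lemma acl_inv r : 1 <= r -> 0 <= acl r^-1 < pi / 2 /\ r * cos (acl r^-1) = 1.
Proof.
move=> r1; have r0 : 0 < r by lin.
have i0 : 0 < r^-1 by rewrite invr_gt0.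
have i1 : r^-1 <= 1 by rewrite invf_le1.
have c : cos (acl r^-1) = r^-1 by rewrite cos_acl//; lin.
split; last by rewrite c mulfV// gt_eqF.
have /andP[a0 a1] := acl_itv r^-1; rewrite a0 /= ltNge; apply/negP => h.
have p2 := pi_ge2 R.
have : cos (acl r^-1) <= cos (pi / 2) by rewrite le_cos ?a0//; lin.
by rewrite cos_pihalf c; lin.
Qed.

Lemma Gam_ge1 r : 1 <= r -> Gam r = pi + acl r^-1 - r * sin (acl r^-1).
Proof.
move=> r1; have [/andP[c0 c1] E] := acl_inv r1.
have a0 : al r (acl r^-1) = 0.
  apply: alP; first by have := pi_ge2 R; lin.
  by rewrite cos0 expr1n E.
by rewrite /Gam bmin_ge1// /Th tlE a0 sin0 mul0r; ring.
Qed.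

Lemma Gam_barrier mu r : 0 < mu -> mu < r -> Gam (r / mu) = barrier mu r.
Proof.
move=> mu0 mur; have r1 : 1 <= r / mu by rewrite ler_pdivlMr// mul1r ltW.
have r0 : 0 < r by exact: lt_trans mur.
have i0 : 0 < (r / mu)^-1 by rewrite invr_gt0 divr_gt0.
have i1 : (r / mu)^-1 <= 1 by rewrite invf_le1 ?divr_gt0.
rewrite Gam_ge1// /barrier.
have -> : mu / r = (r / mu)^-1 by rewrite invfM invrK mulrC.
have E : Num.sqrt (r ^+ 2 / mu ^+ 2 - 1) = r / mu * sin (acl (r / mu)^-1).
  apply: sqrt_id.
    by rewrite mulr_ge0 ?divr_ge0 ?(ltW mu0) ?(ltW r0)// sin_ge0_pi// acl_itv.
  rewrite exprMn sin2cos2 cos_acl; last by lin.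
  by field; rewrite !gt_eqF.
by rewrite E aclE; [ring|lin].
Qed.

(** This is [Gam_le_pi] at r = 1 / cos x. *)
Lemma id_le_tan x : 0 <= x < pi / 2 -> x * cos x <= sin x.
Proof.
move=> /andP[x0 x1]; have p2 := pi_ge2 R.
have c0 : 0 < cos x by apply: cos_gt0_pihalf; lin.
have r1 : 1 <= (cos x)^-1 by rewrite invf_ge1 ?cos_le1.
have := Gam_le_pi (r := (cos x)^-1); rewrite invr_gt0 => /(_ c0).
rewrite Gam_ge1// invrK acl_cos; last by lin.
move=> h; have {h} : x <= (cos x)^-1 * sin x by lin.
by rewrite mulrC ler_pdivlMr.
Qed.

(** Strictness comes from halving the angle: x cos^2 (x / 2) <= sin x, and cos x < cos^2 (x / 2). *)
Lemma id_lt_tan x : 0 < x < pi / 2 -> x * cos x < sin x.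
Proof.
move=> /andP[x0 x1]; have p2 := pi_ge2 R.
have h := @id_le_tan (x / 2).
have {h} h : x / 2 * cos (x / 2) <= sin (x / 2) by apply: h; lin.
have c0 : 0 < cos (x / 2) by apply: cos_gt0_pihalf; lin.
have s0 : 0 < sin (x / 2) by apply: sin_gt0_pi; lin.
have h1 : x * cos (x / 2) ^+ 2 <= sin x.
  rewrite sin2half.
  have -> : x * cos (x / 2) ^+ 2 = 2 * (x / 2 * cos (x / 2) * cos (x / 2)) by field.
  by rewrite ler_pM2l// ler_wpM2r// ltW.
apply: lt_le_trans h1; rewrite ltr_pM2l// cos2half -subr_gt0.
have -> : cos (x / 2) ^+ 2 - (2 * cos (x / 2) ^+ 2 - 1) = 1 - cos (x / 2) ^+ 2 by ring.
by rewrite -sin2cos2 exprn_gt0.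
Qed.

Lemma Gam_lt_pi r : 1 < r -> Gam r < pi.
Proof.
move=> r1; have [/andP[c0 c1] E] := acl_inv (ltW r1).
rewrite Gam_ge1 ?(ltW r1)//.
have c00 : 0 < acl r^-1.
  rewrite lt_neqAle c0 andbT; apply/eqP => h.
  by move: E; rewrite -h cos0 mulr1 => h1; move: r1; rewrite h1 ltxx.
have := @id_lt_tan (acl r^-1); rewrite c00 c1 => /(_ isT).
rewrite -(@ltr_pM2l _ r); last by lin.
have -> : r * (acl r^-1 * cos (acl r^-1)) = acl r^-1 * (r * cos (acl r^-1)) by ring.
by rewrite E; lin.
Qed.

(** With r = 1 / cos c, s = 1 / cos d one has Gam r = pi + c - tan c, and tan d - tan c = sin (d -
    c) / (cos c cos d) >= d - c. *)
Lemma Gam_le r s : 1 <= r -> r <= s -> Gam s <= Gam r.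
Proof.
move=> r1 rs; have s1 : 1 <= s by lin.
have [/andP[c0 c1] E] := acl_inv r1; have [/andP[d0 d1] E'] := acl_inv s1.
rewrite !Gam_ge1//; set c := acl r^-1 in c0 c1 E *; set d := acl s^-1 in d0 d1 E' *.
have p2 := pi_ge2 R.
have cd : c <= d by apply: le_acl; rewrite lef_pV2 ?posrE//; lin.
have h := @id_le_tan (d - c).
have {h} h : (d - c) * cos (d - c) <= sin (d - c) by apply: h; lin.
have cc : cos c * cos d <= cos (d - c).
  rewrite cosB (mulrC (cos d)) lerDl mulr_ge0// sin_ge0_pi//; lin.
have e1 : s * sin d - r * sin c = r * s * sin (d - c).
  transitivity (s * sin d * (r * cos c) - r * sin c * (s * cos d)).
    by rewrite E E'; ring.
  by rewrite sinB; ring.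
have e2 : r * s * (cos c * cos d) = 1.
  by transitivity ((r * cos c) * (s * cos d)); [ring|rewrite E E' mulr1].
have rs0 : 0 <= r * s by rewrite mulr_ge0//; lin.
have h2 : (d - c) * (r * s * (cos c * cos d)) <= r * s * sin (d - c).
  apply: (@le_trans _ _ (r * s * ((d - c) * cos (d - c)))); last exact: ler_wpM2l.
  have -> : (d - c) * (r * s * (cos c * cos d)) = r * s * ((d - c) * (cos c * cos d)) by ring.
  by apply: ler_wpM2l => //; apply: ler_wpM2l => //; lin.
by move: h2; rewrite e2 mulr1 -e1; lin.
Qed.

Lemma Gam_cvg T (F : set_system T) {FF : Filter F} (f : T -> R) r :
  0 < r -> f @ F --> r -> (fun i => Gam (f i)) @ F --> Gam r.
Proof.
move=> r0 fr; apply: cvgB; first exact: cvg_cst.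
by apply: Th_cvg => //; exact: bmin_cvg.
Qed.

Lemma max_cvg T (F : set_system T) {FF : Filter F} (f g : T -> R) x y :
  f @ F --> x -> g @ F --> y ->
  (fun i => Num.max (f i) (g i)) @ F --> Num.max x y.
Proof.
move=> fx gy; rewrite maxr_absE; under eq_fun do rewrite maxr_absE.
apply: cvgM; last exact: cvg_cst.
by apply: cvgD; [exact: cvgD|apply: cvg_norm; exact: cvgB].
Qed.

Lemma min_cvg T (F : set_system T) {FF : Filter F} (f g : T -> R) x y :
  f @ F --> x -> g @ F --> y ->
  (fun i => Num.min (f i) (g i)) @ F --> Num.min x y.
Proof.
move=> fx gy; rewrite minr_absE; under eq_fun do rewrite minr_absE.
apply: cvgM; last exact: cvg_cst.
by apply: cvgB; [exact: cvgD|apply: cvg_norm; exact: cvgB].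
Qed.

(* States above the barrier are projected onto it. *)
Definition hat r th : R := Num.min th (Gam r).
Definition bh r th : R := bet r (hat r th).
Definition vh r th : R := vv r (bh r th).

Lemma hat_le_pi r th : 0 < r -> hat r th <= pi.
Proof. by move=> r0; rewrite ge_min Gam_le_pi// orbT. Qed.

Lemma hat_cvg T (F : set_system T) {FF : Filter F} (f g : T -> R) r th :
  0 < r -> f @ F --> r -> g @ F --> th ->
  (fun i => hat (f i) (g i)) @ F --> hat r th.
Proof.
by move=> r0 fr gt_; apply: min_cvg => //; exact: Gam_cvg.
Qed.

Lemma bh_cvg T (F : set_system T) {FF : Filter F} (f g : T -> R) r th :
  0 < r -> f @ F --> r -> g @ F --> th ->
  (fun i => bh (f i) (g i)) @ F --> bh r th.
Proof.
move=> r0 fr gt_; apply: bet_cvg => //; first exact: hat_le_pi.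
  exact: hat_cvg.
have /cvgrPdist_lt /(_ _ r0) := fr; apply: filterS => i.
by rewrite ltr_norml => h; apply: hat_le_pi; lin.
Qed.

Lemma vh_cvg T (F : set_system T) {FF : Filter F} (f g : T -> R) r th :
  0 < r -> f @ F --> r -> g @ F --> th ->
  (fun i => vh (f i) (g i)) @ F --> vh r th.
Proof. by move=> r0 fr gt_; apply: vv_cvg => //; exact: bh_cvg. Qed.

Lemma bh_itv r th : 0 < r -> bmin r <= bh r th <= pi / 2.
Proof. by move=> r0; apply: bet_itv => //; exact: hat_le_pi. Qed.

(* Above the barrier the heading is turned towards the center, which is reached
   at th = pi: by reflection the angular part changes sign there and has to
   vanish for the heading to be continuous. *)
Definition kap r th : R :=
  if pi <= Gam r then 1 else Num.max 0 (Num.min 1 ((pi - th) / (pi - Gam r))).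

Lemma kap_itv r th : 0 <= kap r th <= 1.
Proof.
rewrite /kap; case: ifP => _; first by rewrite ler01 lexx.
by rewrite le_max lexx ge_max ler01 ge_min lexx.
Qed.

Lemma kap1 r th : th <= Gam r -> kap r th = 1.
Proof.
rewrite /kap => h; case: leP => // h1.
have -> : Num.min 1 ((pi - th) / (pi - Gam r)) = 1.
  apply/min_idPl; rewrite ler_pdivlMr ?subr_gt0// mul1r; lin.
by apply/max_idPr; exact: ler01.
Qed.

(** [kap] jumps at theta = pi, rho = 1. The excluded states, theta = pi with rho <= 1, are those in
    which [kL] copies M. *)
Lemma kap_cvg T (F : set_system T) {FF : Filter F} (f g : T -> R) r th :
  0 < r -> th <= pi -> (th < pi \/ 1 < r) -> f @ F --> r -> g @ F --> th ->
  (fun i => kap (f i) (g i)) @ F --> kap r th.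
Proof.
move=> r0 thpi out fr gt_.
have cG : (fun i => Gam (f i)) @ F --> Gam r by exact: Gam_cvg.
have [G|G] := ltP (Gam r) pi.
  have E : kap r th = Num.max 0 (Num.min 1 ((pi - th) / (pi - Gam r))).
    by rewrite /kap leNgt G.
  have c : (fun i => Num.max 0 (Num.min 1 ((pi - g i) / (pi - Gam (f i))))) @ F
      --> kap r th.
    rewrite E; apply: max_cvg; first exact: cvg_cst.
    apply: min_cvg; first exact: cvg_cst.
    apply: cvgM; first by apply: cvgB => //; exact: cvg_cst.
    apply: cvgV; first by rewrite subr_eq0 gt_eqF.
    by apply: cvgB => //; exact: cvg_cst.
  apply: cvg_trans c; apply: near_eq_cvg.
  have /cvgrPdist_lt /(_ (pi - Gam r)) := cG; rewrite subr_gt0 => /(_ G).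
  apply: filterS => i; rewrite ltr_norml => /andP[h1 h2].
  by rewrite /kap leNgt ifF//; apply/negbTE; rewrite negbK; lin.
have {}out : th < pi.
  by case: out => // r1; move: (Gam_lt_pi r1); rewrite ltNge G.
rewrite kap1; last by lin.
have c1 : (fun=> 1 : R) @ F --> (1 : R) by exact: cvg_cst.
apply: cvg_trans c1; apply: near_eq_cvg.
have c : (Gam (f i) - g i) @[i --> F] --> (Gam r - th) by exact: cvgB.
move/cvgrPdist_lt : c => /(_ (Gam r - th)); rewrite subr_gt0 => H.
have h0 : th < Gam r by lin.
have := H h0; apply: filterS => i; rewrite ltr_norml => /andP[h1 h2].
by rewrite kap1//; lin.
Qed.

(** Interpolates between the tangent line, heading beta + pi / 2 at [kap] = 1, and the center,
    heading pi at [kap] = 0. *)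
Definition head r th : R := pi - kap r th * (pi / 2 - bh r th).

Lemma head_itv r th : 0 <= head r th <= pi.
Proof.
have /andP[k0 k1] := kap_itv r th; have /andP[b0 b1] := bet_bnd r (hat r th).
have p2 := pi_ge2 R; rewrite /head /bh; set x := pi / 2 - _.
have x0 : 0 <= x <= pi by rewrite /x; lin.
have h1 : 0 <= kap r th * x by rewrite mulr_ge0//; lin.
have h2 : kap r th * x <= x by rewrite ler_piMl//; lin.
by lin.
Qed.

Lemma head_cvg T (F : set_system T) {FF : Filter F} (f g : T -> R) r th :
  0 < r -> th <= pi -> (th < pi \/ 1 < r) -> f @ F --> r -> g @ F --> th ->
  (fun i => head (f i) (g i)) @ F --> head r th.
Proof.
move=> r0 thpi out fr gt_; apply: cvgB; first exact: cvg_cst.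
apply: cvgM; first exact: kap_cvg.
by apply: cvgB; [exact: cvg_cst|exact: bh_cvg].
Qed.

(** In the first branch sin psi / rho = w, so L turns exactly as fast as M. The clamp makes the
    formula total. *)
Definition kL mu r th w : R :=
  if (th == pi) && (r <= mu) then asin (clamp (r / mu * w)) else head (r / mu) th.

Lemma kL_feedback mu : lady_feedback (kL mu).
Proof.
split=> [r th w|r th w w' /negbTE h]; last by rewrite /kL h.
have p2 := pi_ge2 R; rewrite /kL; case: ifP => _; last first.
  by have := head_itv (r / mu) th; lin.
have c := clamp_itv (r / mu * w).
by have := asin_geNpi2 c; have := asin_lepi2 c; lin.
Qed.

Lemma cos_asin_clamp x : -1 <= x <= 1 ->
  sin (asin (clamp x)) = x /\ cos (asin (clamp x)) = Num.sqrt (1 - x ^+ 2).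
Proof.
move=> x1; rewrite clampE// asinK// ?in_itv//; split => //.
by rewrite cos_asin// in_itv.
Qed.

Lemma head_bh r th : th <= Gam r ->
  cos (head r th) = - sin (bh r th) /\ sin (head r th) = cos (bh r th).
Proof.
move=> h; rewrite /head kap1// mul1r.
have -> : pi - (pi / 2 - bh r th) = bh r th + pi / 2 by lin.
by rewrite cosDpihalf sinDpihalf.
Qed.

Lemma below_barrier_state mu r th : 0 < mu -> 0 < r -> below_barrier mu r th ->
  [/\ th <= Gam (r / mu) & th = pi -> r <= mu].
Proof.
move=> mu0 r0 [_ /andP[th0 thpi] bar].
have rp : 0 < r / mu by rewrite divr_gt0.
have [rmu|mur] := leP r mu.
  by split => //; rewrite Gam_le1// rp ler_pdivrMr// mul1r.
have h := bar mur; rewrite -Gam_barrier// in h; split; first exact: ltW.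
by move=> E; have := Gam_le_pi rp; rewrite leNgt -E h.
Qed.

Lemma kL_psi_star mu r th w : 0 < mu -> below_barrier mu r th ->
  angle r th = th -> omega_star mu r th w ->
  (cos (kL mu r th w), sin (kL mu r th w)) = psi_star mu r th.
Proof.
move=> mu0 bb an om; have p2 := pi_ge2 R.
have [/andP[r0 r1] /andP[th0 thpi] _] := bb.
have st : 0 < r -> [/\ th <= Gam (r / mu) & th = pi -> r <= mu].
  by move=> h; exact: below_barrier_state.
have rmu : th = pi -> r <= mu.
  move=> h; have [r00|] := ltP 0 r; first by have [_ ->] := st r00.
  by move=> h1; apply: le_trans h1 _; exact: ltW.
have rp0 : 0 <= r / mu by rewrite divr_ge0// ltW.
rewrite /kL; case: eqVneq => [E|ne] /=.
  have rm := rmu E; have rp1 : r / mu <= 1 by rewrite ler_pdivrMr// mul1r.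
  rewrite rm; move: om; rewrite /omega_star E.
  have -> : r / mu < pi by lin.
  move=> /= ->; rewrite mulr1.
  have [|-> ->] := @cos_asin_clamp (r / mu); first by lin.
  by rewrite /psi_star eqxx expr_div_n.
have r00 : 0 < r.
  rewrite lt_neqAle r0 andbT eq_sym; apply/eqP => h.
  by move: an; rewrite /angle h eqxx => h1; rewrite h1 eqxx in ne.
have [hG _] := st r00.
have [-> ->] := head_bh hG.
rewrite psi_starE//; last by rewrite th0 lt_neqAle ne.
by rewrite /bh /hat (min_idPl hG).
Qed.

End strategy.

(** * Envelope estimate for the decrease of the value *)

Section envelope.
Context {R : realType}.
Implicit Types (a b c d e eta eps h mu r s t th w x y V : R).
Local Notation pi := (@trigo.pi R).

(** Without the errors eta, dr sb <= - h sb^2 and dth >= h (cb / r - 1) give dV (1 - r cb) <= - h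
    (sb^2 + cb^2 - r cb) = - h (1 - r cb). The errors add up to at most h eta (3 r + 3). *)
Lemma env_algebra r h cb sb c S dr dth dV eta eps :
  0 < r -> 0 < h -> sb ^+ 2 + cb ^+ 2 = 1 -> 0 < 1 - r * cb ->
  0 < eta -> eta <= cb -> cb <= 1 -> eps <= 1 -> eta * (3 * r + 4) <= eps * (1 - r * cb) ->
  `|c - cb| <= eta -> `|S - sb| <= eta -> c <= 1 -> `|dr| <= h ->
  dr * sb <= h * (- sb ^+ 2 + eta) -> h * (cb / r - 1 - eta) <= dth ->
  dV * (1 - r * c) <= dr * S - r * c * dth -> dV <= - h + eps * h.
Proof.
move=> r0 h0 sc; set D := 1 - r * cb => D0 e0 ecb cb1 eps1 eD.
move=> cc SS c1 drh drs dthh H.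
move: (cc); rewrite ler_norml => /andP[cc1 cc2].
have c0 : 0 <= c by lin.
have re : r * eta <= eps * D - 4 * eta by have := mulr_ge0 (ltW r0) (ltW e0); lin.
have epsD : eps * D <= D by rewrite ger_pMl.
have rc : 1 - r * c <= D + r * eta.
  by have := ler_wpM2l (ltW r0) cc1; rewrite /D; lin.
have rc0 : 0 < 1 - r * c.
  by have := ler_wpM2l (ltW r0) cc2; rewrite /D in re epsD D0 *; lin.
have k1 : dr * S <= h * (- sb ^+ 2 + eta) + h * eta.
  have -> : dr * S = dr * sb + dr * (S - sb) by ring.
  apply: lerD => //; apply: le_trans (ler_norm _) _; rewrite normrM.
  exact: ler_pM.
have k2 : c * h * (cb - r - r * eta) <= r * c * dth.
  have -> : c * h * (cb - r - r * eta) = r * c * (h * (cb / r - 1 - eta)).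
    by field; rewrite gt_eqF.
  by apply: ler_wpM2l => //; rewrite mulr_ge0// ltW.
have k3 : h * (cb * (cb - r) - eta * (r + 1)) <= h * (c * (cb - r)).
  apply: ler_wpM2l; first exact: ltW.
  have : `|(c - cb) * (cb - r)| <= eta * (r + 1).
    rewrite normrM; apply: ler_pM => //.
    rewrite (le_trans (ler_normB _ _))// ger0_norm ?(gtr0_norm r0) 1?addrC ?lerD2l//; lin.
  by rewrite ler_norml => /andP[]; lin.
have k4 : h * (c * (r * eta)) <= h * (r * eta).
  rewrite ler_pM2l// ler_piMl// mulr_ge0// ltW//.
have k5 : dV * (1 - r * c) <= h * (- D + eta * (2 * r + 3)).
  have e1 : h * (- sb ^+ 2 + eta) + h * eta - h * (cb * (cb - r) - eta * (r + 1)) +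
      h * (r * eta) = h * (- (sb ^+ 2 + cb ^+ 2) + r * cb + eta * (2 * r + 3)) by ring.
  rewrite sc in e1.
  have e2 : c * h * (cb - r - r * eta) = h * (c * (cb - r)) - h * (c * (r * eta)) by ring.
  have e3 : h * (- D + eta * (2 * r + 3)) = h * (- 1 + r * cb + eta * (2 * r + 3)).
    by rewrite /D; ring.
  by move: e1 e2 k1 k2 k3 k4; rewrite e3; lin.
rewrite leNgt; apply/negP => lt.
have k6 : (- h + eps * h) * (1 - r * c) < dV * (1 - r * c) by rewrite ltr_pM2r.
have k7 : h * ((1 - eps) * (1 - r * c)) <= h * ((1 - eps) * (D + r * eta)).
  by rewrite ler_pM2l// ler_wpM2l//; lin.
have k8 : h * (D - eta * (2 * r + 3)) < h * ((1 - eps) * (D + r * eta)).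
  have e4 : (- h + eps * h) * (1 - r * c) = - (h * ((1 - eps) * (1 - r * c))) by ring.
  have e5 : h * (- D + eta * (2 * r + 3)) = - (h * (D - eta * (2 * r + 3))) by ring.
  by lin.
move: k8; rewrite ltr_pM2l// => k8.
have k9 : (1 - eps) * (r * eta) <= r * eta \/ eps < 0.
  case: (ltP eps 0); [by right|left].
  by rewrite ler_piMl ?mulr_ge0 ?(ltW r0) ?(ltW e0)// lerBlDr lerDl.
case: k9 => [k9|n]; last first.
  have : eps * D < 0 by rewrite nmulr_rlt0.
  have : 0 < eta * (3 * r + 4) by rewrite mulr_gt0//; move: r0; lin_goal.
  by lin.
by lin.
Qed.

Lemma cos_lip x y : `|cos x - cos y| <= `|x - y|.
Proof.
wlog xy : x y / y <= x.
  by move=> H; have [/H//|/ltW/H] := leP y x; rewrite distrC (distrC y).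
move: xy; rewrite le_eqVlt => /predU1P[->|xy]; first by rewrite !subrr.
have H z : z \in `]y, x[ -> is_derive z 1 (@cos R) (- sin z) by move=> _; exact: is_derive_cos.
have [z _ ->] := MVT xy H (continuous_subspaceT (@continuous_cos R)).
by rewrite normrM normrN ler_piMl// sin_max.
Qed.

Lemma sin_diff x y : exists2 z, `|z - x| <= `|y - x| & sin y - sin x = cos z * (y - x).
Proof.
have H (u v z : R) : z \in `]u, v[ -> is_derive z 1 (@sin R) (cos z) by move=> _; exact: is_derive_sin.
have [xy|xy|->] := ltgtP x y.
- have [z] := MVT xy (H _ _) (continuous_subspaceT (@continuous_sin R)).
  rewrite in_itv/= => /andP[z1 z2] E; exists z => //.
  by rewrite !gtr0_norm; lin.
- have [z] := MVT xy (H _ _) (continuous_subspaceT (@continuous_sin R)).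
  rewrite in_itv/= => /andP[z1 z2] E; exists z; last by lin.
  by rewrite !ltr0_norm; lin.
- by exists y; rewrite ?subrr ?normr0 ?mulr0.
Qed.

(** Both states are compared at the parameter a2 of the second one, where the envelope inequality of
    the first state still bounds V1 from below. In the difference only the changes of r and theta
    remain; z is a mean value point of the sine. *)
Lemma envelope_step r1 b1 a1 r2 b2 a2 V1 V2 th1 th2 :
  V1 = th1 + b1 + 2 * a1 - pi -> V2 = th2 + b2 + 2 * a2 - pi ->
  V2 = a2 + (r2 * sin b2 + sin a2 * cos a2) ->
  r1 * sin (b1 - 2 * (a2 - a1)) + sin a2 * cos a2 + a2 <= V1 ->
  exists2 z, `|z - b1| <= `|b2 - b1| + 4 * `|a2 - a1| &
    (V2 - V1) * (1 - r1 * cos z) <= (r2 - r1) * sin b2 - r1 * cos z * (th2 - th1).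
Proof.
move=> E1 E2 E3 H; have [z z1 Ez] := sin_diff (b1 - 2 * (a2 - a1)) b2.
exists z.
  have n2 : `|2 * (a2 - a1)| = 2 * `|a2 - a1| by rewrite normrM gtr0_norm.
  have -> : z - b1 = (z - (b1 - 2 * (a2 - a1))) - 2 * (a2 - a1) by ring.
  apply: le_trans (ler_normB _ _) _.
  have : `|b2 - (b1 - 2 * (a2 - a1))| <= `|b2 - b1| + 2 * `|a2 - a1|.
    have -> : b2 - (b1 - 2 * (a2 - a1)) = (b2 - b1) + 2 * (a2 - a1) by ring.
    by rewrite -n2; exact: ler_normD.
  by lin.
have e : b2 - (b1 - 2 * (a2 - a1)) = (V2 - V1) - (th2 - th1) by rewrite E1 E2; ring.
rewrite e in Ez.
have e2 : r1 * (sin b2 - sin (b1 - 2 * (a2 - a1))) =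
    r1 * (cos z * ((V2 - V1) - (th2 - th1))) by rewrite Ez.
have e3 : (V2 - V1) * (1 - r1 * cos z) = (V2 - V1) - r1 * (cos z * (V2 - V1)) by ring.
have e4 : r1 * (cos z * (V2 - V1 - (th2 - th1))) =
  r1 * (cos z * (V2 - V1)) - r1 * cos z * (th2 - th1) by ring.
have e5 : (r2 - r1) * sin b2 = r2 * sin b2 - r1 * sin b2 by ring.
have e6 : r1 * (sin b2 - sin (b1 - 2 * (a2 - a1))) =
  r1 * sin b2 - r1 * sin (b1 - 2 * (a2 - a1)) by ring.
by lin.
Qed.

Lemma x_sub_sin x : 0 <= x < pi / 2 -> x - sin x <= x * (1 - cos x).
Proof. by move=> /id_le_tan; rewrite mulrBr mulr1; lin. Qed.

(* The derivative in the tangency parameter vanishes to second order at [al]. *)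
Lemma envelope_ge0 r b : 0 < r -> bmin r < b <= pi / 2 ->
  exists2 d : R, 0 < d & forall a, `|a - al r b| < d ->
    r * sin (b - 2 * (a - al r b)) + sin a * cos a + a <= vv r b.
Proof.
move=> r0 /andP[b1 b2]; have p2 := pi_ge2 R.
have bi : bmin r <= b <= pi / 2 by rewrite (ltW b1).
have t0 : 0 < tl r b by apply: tl_gt0; rewrite ?b1.
(* The bound 1/4 keeps 2 e below pi / 2 for [x_sub_sin], and e <= [tl] lets the quadratic term, with
   coefficient [tl], dominate (2 e - sin (2 e)) / 2 <= e (1 - cos (2 e)). *)
exists (Num.min (1 / 4) (tl r b)); first by rewrite lt_min t0 andbT; lin.
move=> a; set e := a - al r b; rewrite lt_min => /andP[h1 h2].
have aE : a = al r b + e by rewrite /e; ring.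
have key : vv r b - (r * sin (b - 2 * e) + sin a * cos a + a) =
    tl r b * (1 - cos (2 * e)) - (2 * e - sin (2 * e)) / 2.
  have ca := cos_al (rcos_le1 r0 bi).
  have s2 : sin (al r b) ^+ 2 = 1 - r * cos b by rewrite sin2cos2 ca.
  have e2 : 2 * e / 2 = e by lin.
  have s2e : sin (2 * e) = 2 * (sin e * cos e) by rewrite sin2half e2.
  have c2e : cos (2 * e) = 2 * cos e ^+ 2 - 1 by rewrite cos2half e2.
  have se2 := sin2cos2 e.
  rewrite /vv tlE aE sinB sinD cosD s2e c2e.
  set A := sin (al r b) in s2 *; set C := cos (al r b) in ca *.
  set S := sin e in se2 *; set c := cos e in se2 *.
  apply/eqP; rewrite -subr_eq0; apply/eqP.
  transitivity (2 * S * c * (r * cos b - C ^+ 2) + S * c * (C ^+ 2 + A ^+ 2 - 1)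
     + A * C * (S ^+ 2 + c ^+ 2 - 1) ).
    by field.
  by rewrite ca s2 se2; ring.
rewrite -subr_ge0 key subr_ge0.
have c1 : 0 <= 1 - cos (2 * e) by rewrite subr_ge0 cos_le1.
have [e0|e0] := leP 0 e.
  rewrite ger0_norm// in h1 h2.
  have := @x_sub_sin (2 * e).
  have h3 : 0 <= 2 * e < pi / 2 by lin.
  move=> /(_ h3) h4.
  have : e * (1 - cos (2 * e)) <= tl r b * (1 - cos (2 * e)) by apply: ler_wpM2r => //; exact: ltW.
  by lin.
have : sin (- (2 * e)) <= - (2 * e) by apply: sin_ltx; lin.
rewrite sinN => h3.
have : 0 <= tl r b * (1 - cos (2 * e)) by rewrite mulr_ge0// ltW.
by lin.
Qed.

(** One-sided estimates suffice: the angle need have no right derivative, and a larger angle only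
    lowers the value. *)
Lemma vv_decrease (rr hh : R -> R) t r hr : 0 < r -> r < hr -> hr <= pi ->
  bmin r < bet r hr ->
  rr s @[s --> t^'+] --> r -> hh s @[s --> t^'+] --> hr ->
  (\forall s \near t^'+, hh s <= pi) ->
  (\forall s \near t^'+, `|rr s - r| <= s - t) ->
  (forall eta, 0 < eta -> \forall s \near t^'+,
     (rr s - r) * sin (bet r hr) <= (s - t) * (- sin (bet r hr) ^+ 2 + eta)) ->
  (forall eta, 0 < eta -> \forall s \near t^'+,
     (s - t) * (cos (bet r hr) / r - 1 - eta) <= hh s - hr) ->
  forall eps, 0 < eps -> \forall s \near t^'+,
     vv (rr s) (bet (rr s) (hh s)) <= vv r (bet r hr) + (- (s - t) + eps * (s - t)).
Proof.
move=> r0 rhr hrpi; set b := bet r hr => bb crr chh hpi lrr drr dhh.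
move=> eps eps0.
wlog eps1 : eps eps0 / eps <= 1.
  move=> H; have [//|/ltW e1] := leP eps 1; first exact: H.
  have := H 1 ltr01 (lexx _); have := nbhs_right_gt t; apply: filterS2 => s ts.
  rewrite mul1r => h; apply: le_trans h _; rewrite lerD2l lerD2l ler_peMl//; lin.
have bi : bmin r <= b <= pi / 2 by exact: bet_itv.
have ThE : Th r b = hr by rewrite Th_bet//; apply/max_idPl; exact: ltW.
have b2 : b < pi / 2.
  have /andP[_] := bi; rewrite le_eqVlt => /predU1P[E|//].
  by move: rhr; rewrite -ThE E Th_pihalf ltxx.
have bb2 : bmin r < b <= pi / 2 by rewrite bb (ltW b2).
have cb : 0 < cos b by apply: (cos_gt0_bmin r0); rewrite (ltW bb).
pose D := 1 - r * cos b.
have D0 : 0 < D by rewrite subr_gt0; exact: rcos_lt1.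
(* The first bound keeps the perturbed cosine nonnegative, the second is the error that
   [env_algebra] admits. *)
pose eta := Num.min (cos b) (eps * D / (3 * r + 4)).
have r34 : 0 < 3 * r + 4 by lin.
have eta0 : 0 < eta by rewrite lt_min cb divr_gt0// mulr_gt0.
have eta1 : eta <= cos b by rewrite ge_min lexx.
have eta2 : eta * (3 * r + 4) <= eps * D.
  by rewrite -ler_pdivlMr// ge_min lexx orbT.
pose A s := al (rr s) (bet (rr s) (hh s)).
have cbet : bet (rr s) (hh s) @[s --> t^'+] --> b by exact: bet_cvg.
have cA : A s @[s --> t^'+] --> al r b by exact: al_cvg.
have [d d0 Hd] := envelope_ge0 r0 bb2.
have e8 : 0 < eta / 8 by rewrite divr_gt0.
have e2 : 0 < eta / 2 by rewrite divr_gt0.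
have crh : (hh s - rr s) @[s --> t^'+] --> (hr - r) by exact: cvgB.
move/cvgrPdist_lt : (crr) => /(_ _ r0) N1.
move/cvgrPdist_lt : crh => /(_ (hr - r)); rewrite subr_gt0 => /(_ rhr) N2.
move/cvgrPdist_lt : (cbet) => /(_ _ e2) N3.
move/cvgrPdist_lt : (cA) => /(_ _ e8) N4.
move/cvgrPdist_lt : (cA) => /(_ _ d0) N5.
have N6 := drr _ eta0; have N7 := dhh _ eta0.
have N8 := nbhs_right_gt t.
near=> s.
have ts : 0 < s - t by rewrite subr_gt0; near: s.
have n1 : 0 < rr s.
  by have : `|r - rr s| < r; [near: s; exact: N1|rewrite ltr_norml; lin].
have n2 : rr s < hh s.
  have : `|hr - r - (hh s - rr s)| < hr - r by near: s; exact: N2.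
  by rewrite ltr_norml; lin.
have n3 : `|bet (rr s) (hh s) - b| <= eta / 2.
  by rewrite distrC ltW//; near: s; exact: N3.
have n4 : `|A s - al r b| <= eta / 8 by rewrite distrC ltW//; near: s; exact: N4.
have n5 : `|A s - al r b| < d by rewrite distrC; near: s; exact: N5.
have n6 : (rr s - r) * sin b <= (s - t) * (- sin b ^+ 2 + eta) by near: s; exact: N6.
have n7 : (s - t) * (cos b / r - 1 - eta) <= hh s - hr by near: s; exact: N7.
have n8 : hh s <= pi by near: s; exact: hpi.
have n9 : `|rr s - r| <= s - t by near: s; exact: lrr.
have ThE2 : Th (rr s) (bet (rr s) (hh s)) = hh s.
  by rewrite Th_bet//; apply/max_idPl; exact: ltW.
have [||||z z1 z2] := @envelope_step r b (al r b) (rr s) (bet (rr s) (hh s)) (A s)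
    (vv r b) (vv (rr s) (bet (rr s) (hh s))) hr (hh s).
- by rewrite vvE ThE.
- by rewrite vvE ThE2.
- by rewrite /vv tlE.
- by have := Hd _ n5; rewrite -addrA.
suff : vv (rr s) (bet (rr s) (hh s)) - vv r b <= - (s - t) + eps * (s - t) by lin.
apply: (@env_algebra r (s - t) (cos b) (sin b) (cos z) (sin (bet (rr s) (hh s)))
  (rr s - r) (hh s - hr) _ eta eps) => //.
- by rewrite addrC cos2Dsin2.
- by apply: le_trans (cos_lip _ _) _; move: z1 n3 n4; lin_goal.
- have [y _ ->] := sin_diff b (bet (rr s) (hh s)).
  rewrite normrM; apply: (@le_trans _ _ `|bet (rr s) (hh s) - b|); last by move: n3 eta0; lin_goal.
  by rewrite ler_piMl// cos_max.
Unshelve. all: by end_near.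
Qed.

End envelope.

(** * Dynamics of the reflected angle *)

Section angle_dynamics.
Context {R : realType}.
Implicit Types (a b c d e t s x y z u v A B T mu : R) (l : @lady R) (m : @man R).
Local Notation pi := (@trigo.pi R).

Lemma sg1_sin v : `|v| < pi -> sg1 (sin v) = sg1 v.
Proof.
rewrite ltr_norml => /andP[v1 v2]; have [v0|v0] := leP 0 v.
  by rewrite /sg1 v0 sin_ge0_pi//; lin.
have : 0 < sin (- v) by apply: sin_gt0_pi; lin.
by rewrite sinN oppr_gt0 /sg1 => h; rewrite !leNgt h v0.
Qed.

Lemma cos_norm x : cos `|x| = cos x.
Proof.
have [h|h] := leP 0 x; first by rewrite ger0_norm.
by rewrite ltr0_norm// cosN.
Qed.

Lemma acl_cos_norm v : `|v| <= pi -> acl (cos v) = `|v|.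
Proof.
by move=> v1; rewrite -cos_norm acl_cos// normr_ge0.
Qed.

Lemma sin_sg1 x y : sin (sg1 x * y) = sg1 x * sin y.
Proof. by case: (sg1P x) => -[_ ->]; rewrite ?mul1r// !mulN1r sinN. Qed.

Lemma cos_sg1 x y : cos (sg1 x * y) = cos y.
Proof. by case: (sg1P x) => -[_ ->]; rewrite ?mul1r// !mulN1r cosN. Qed.

Section play.
Variables (mu r0 th0 T : R) (l : @lady R) (m : @man R).
Hypotheses (mu0 : 0 < mu) (lm : lady_motion mu r0 th0 T l)
  (mm : man_motion T m).

Definition th' s : R :=
  sg1 (sin (phi l m s)) * (sin (psi l s) / rho mu l s - omega m s).

(** Near t the angle is |u| for a branch u of phi, or pi - |pi - u| if it equals pi at t; [der_abs]
    covers both. *)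
Lemma der_th t : 0 <= t <= T -> 0 < rad l t ->
  exists2 d : R, 0 < d & forall a b, 0 <= a -> b <= T -> t - d <= a -> b <= t + d ->
    (forall s, a <= s <= b -> 0 < rad l s) /\ der (th l m) th' a b.
Proof.
move=> tT rt; have /andP[t0 tT'] := tT.
have p0 := pi_gt0 R.
have [d1 d10 H1] := rad_near_pos mu0 lm tT rt.
pose a1 := Num.max 0 (t - d1 / 2); pose b1 := Num.min T (t + d1 / 2).
have a10 : 0 <= a1 by rewrite le_max lexx.
have b1T : b1 <= T by rewrite ge_min lexx.
have a1t : a1 <= t by rewrite ge_max t0 /=; lin.
have tb1 : t <= b1 by rewrite le_min tT' /=; lin.
have rp1 s : a1 <= s <= b1 -> 0 < rad l s.
  move=> /andP[s1 s2]; have h1 : t - d1 / 2 <= s.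
    by apply: le_trans s1; rewrite le_max lexx orbT.
  have h2 : s <= t + d1 / 2 by apply: le_trans s2 _; rewrite ge_min lexx orbT.
  apply: H1; first by rewrite (le_trans a10)//= (le_trans s2).
  by rewrite ltr_norml; lin.
have Dp := der_phi mu0 lm mm a10 b1T rp1.
have [K K0 L] := der_lip Dp.
have Lip s : a1 <= s <= b1 -> `|phi l m s - phi l m t| <= K * `|s - t|.
  move=> /andP[s1 s2]; have [st|/ltW ts] := leP s t.
    by rewrite distrC (distrC s) (ger0_norm (x := t - s)) ?subr_ge0//; exact: L.
  by rewrite (ger0_norm (x := s - t)) ?subr_ge0//; exact: L.
set sg := sg1 (sin (phi l m t)).
(* A multiple of 2 pi, known only through cos c0 = 1 and sin c0 = 0. *)
pose c0 := phi l m t - sg * th l m t.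
have cc0 : cos c0 = 1.
  rewrite cosB cos_sg1 sin_sg1 cos_th sin_th sg1_norm -!expr2.
  exact: cos2Dsin2.
have sc0 : sin c0 = 0.
  by rewrite sinB cos_sg1 sin_sg1 cos_th sin_th sg1_norm mulrC subrr.
pose u s := phi l m s - c0.
have cu s : cos (phi l m s) = cos (u s).
  by rewrite /u cosB cc0 sc0 mulr1 mulr0 addr0.
have su s : sin (phi l m s) = sin (u s).
  by rewrite /u sinB cc0 sc0 mulr1 mulr0 subr0.
have ut : u t = sg * th l m t by rewrite /u /c0; ring.
have /andP[th0' thpi] := th_itv l m t.
have Nut : `|u t| = th l m t.
  rewrite ut normrM (ger0_norm th0'); case: (sg1P (sin (phi l m t))) => -[_ h];
  by rewrite /sg h ?normrN normr1 mul1r.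
(* The distance by which u may move while |u| < pi or, starting from u = pi, while |pi - u| < pi. *)
pose gap := if th l m t < pi then pi - th l m t else pi.
have gap0 : 0 < gap by rewrite /gap; case: ifP => h; rewrite ?subr_gt0.
pose d := Num.min (d1 / 2) (gap / (K + 1)).
have K1 : 0 < K + 1 by lin.
have d0 : 0 < d by rewrite lt_min !divr_gt0.
exists d => // a b a0 bT ta bt.
have sub s : a <= s <= b -> a1 <= s <= b1.
  move=> /andP[s1 s2]; have dd : d <= d1 / 2 by rewrite ge_min lexx.
  by rewrite /a1 /b1 ge_max le_min; lin.
have uu s : a <= s <= b -> `|u s - u t| < gap.
  move=> sab; have /andP[s1 s2] := sab.
  have -> : u s - u t = phi l m s - phi l m t by rewrite /u; ring.
  have st : `|s - t| <= d by rewrite ler_norml; lin.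
  have dg : (K + 1) * d <= gap.
    by rewrite mulrC -ler_pdivlMr// ge_min lexx orbT.
  have h1 := Lip s (sub s sab).
  have h2 : K * `|s - t| <= K * d by exact: ler_wpM2l.
  by lin.
split; first by move=> s /sub/rp1.
have [ab|ba] := leP a b; last first.
  split; last by move=> x y ax xy yb; lin.
  split; last by exists 0 => s; lin.
  by rewrite set_itv_ge ?bnd_simp -?ltNge//; exact: measurable_fun_set0.
have Du : der u (fun s => sin (psi l s) / rho mu l s - omega m s) a b.
  have Dp' : der (phi l m) (fun s => sin (psi l s) / rho mu l s - omega m s) a b.
    have /andP[h1 _] := sub a (introT andP (conj (lexx a) ab)).
    have /andP[_ h2] := sub b (introT andP (conj ab (lexx b))).
    exact: derW Dp h1 h2.
  have := derB Dp' (der_cst c0 a b); apply: eq_der => // s _; by rewrite subr0.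
move: uu; rewrite /gap; case: ltP => [lt|ge] uu.
  have us s : a <= s <= b -> `|u s| < pi.
    move=> /uu h; have := ler_normD (u s - u t) (u t).
    by rewrite subrK Nut; lin.
  apply: eq_der (der_abs Du) => s sab.
    by rewrite /th cu acl_cos_norm// ltW// us.
  by rewrite /th' su sg1_sin// us.
have thE : th l m t = pi by apply/le_anti; rewrite thpi ge.
have utpi : u t = pi.
  have s0 : sin (phi l m t) = 0.
    by apply/eqP; rewrite -normr_eq0 -sin_th thE sinpi.
  by rewrite ut /sg s0 /sg1 lexx mul1r.
pose v s := pi - u s.
have vs s : a <= s <= b -> `|v s| < pi.
  by move=> /uu; rewrite utpi distrC.
have Dv : der v (fun s => - (sin (psi l s) / rho mu l s - omega m s)) a b.
  have := derB (der_cst pi a b) Du; apply: eq_der => // s _; by rewrite sub0r.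
have := derB (der_cst pi a b) (der_abs Dv); apply: eq_der => s sab.
  have h := vs s sab.
  rewrite /th cu -[LHS]acl_cos; last by have := normr_ge0 (v s); lin.
  have -> : u s = pi - v s by rewrite /v; ring.
  have cpi x : cos (pi - x) = - cos x.
    by rewrite cosB cospi sinpi mul0r addr0 mulN1r.
  rewrite (cpi `|v s|) (cpi (v s)); congr (acl (- _)).
  exact: cos_norm.
rewrite /th'; have -> : sin (phi l m s) = sin (v s).
  by rewrite su /v sinB sinpi cospi mul0r sub0r mulN1r opprK.
by rewrite sg1_sin ?vs// sub0r mulrN opprK.
Qed.

End play.
End angle_dynamics.

(** * Decrease of the value along the feedback of L *)

Section value_along_play.
Context {R : realType}.
Implicit Types (a b c d e eta eps t s x y z u A B T mu : R) (l : @lady R) (m : @man R).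
Local Notation pi := (@trigo.pi R).

Lemma der_le_cst (f f' : R -> R) a b c : a <= b -> der f f' a b ->
  (forall s, a < s < b -> f' s <= c) -> f b - f a <= c * (b - a).
Proof. by move=> ab [mf E] H; rewrite E//; exact: ig_le_cst. Qed.

Lemma der_ge_cst (f f' : R -> R) a b c : a <= b -> der f f' a b ->
  (forall s, a < s < b -> c <= f' s) -> c * (b - a) <= f b - f a.
Proof. by move=> ab [mf E] H; rewrite E//; exact: ig_ge_cst. Qed.

Lemma der_cvg_rate (f f' : R -> R) t b c : t < b -> der f f' t b ->
  f' s @[s --> t^'+] --> c -> forall eta, 0 < eta ->
  \forall s \near t^'+, `|f s - f t - (s - t) * c| <= eta * (s - t).
Proof.
move=> tb D /cvgrPdist_lt cf eta /cf /near_rightP[d d0 H].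
apply/near_rightP; exists (Num.min d (b - t)); first by rewrite lt_min d0 subr_gt0.
move=> s; rewrite -ltrBlDl lt_min => /andP[ts /andP[sd sb]].
have Ds : der f f' t s by apply: derW D _ _ => //; lin.
have B u : t < u < s -> c - eta <= f' u <= c + eta.
  move=> /andP[u1 u2]; have : `|c - f' u| < eta by apply: H; lin.
  by rewrite ltr_norml; lin.
have h1 := der_le_cst (ltW ts) Ds (fun u h => proj2 (andP (B u h))).
have h2 := der_ge_cst (ltW ts) Ds (fun u h => proj1 (andP (B u h))).
by rewrite ler_norml; lin.
Qed.

Lemma vh0 th : vh 0 th = pi / 2 :> R.
Proof.
have a1 : acl (-1) = pi :> R by rewrite aclE ?acosN1// lexx/=; lin.
by rewrite /vh /vv /al /tl /za !mul0r mulr0 sub0r a1 sinpi mul0r !addr0.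
Qed.

Lemma vh_le r th : 0 <= r -> vh r th <= pi / 2 + r :> R.
Proof. exact: vv_le. Qed.

(** Like the upper bound [vh_le], this tends to pi / 2 as r tends to 0. Together they give
    continuity of the value at the center, where the angle may be discontinuous. *)
Lemma vh_ge r th : 0 <= r -> acl (2 * r - 1) / 2 <= vh r th :> R.
Proof.
rewrite le_eqVlt => /predU1P[<-|r0].
  by rewrite vh0 mulr0 sub0r aclE ?acosN1// lexx/=; lin.
have bi := bh_itv th r0.
have h : acl (2 * r - 1) <= za r (bh r th).
  apply: le_acl; rewrite lerB// ler_pM2l// ler_piMr ?cos_le1//; exact: ltW.
by have := tl_ge0 r0 bi; rewrite /vh /vv /al; lin.
Qed.

Lemma bh_pi r : 0 < r <= 1 -> bh r pi = bmin r :> R.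
Proof.
move=> r01; have /andP[r0 r1] := r01.
rewrite /bh /hat Gam_le1// minxx; apply: bet_uniq => //.
  by have := bmin_itv r0; lin.
exact: Th_bmin_le1.
Qed.

Lemma vh_pi r : 0 < r <= 1 -> vh r pi = acl r :> R.
Proof.
by move=> r01; rewrite /vh bh_pi// /vv tl_bmin_le1// al_bmin_le1// addr0.
Qed.

(** cos (acos r - x) <= r + x sqrt (1 - r^2), because cos x <= 1 and sin x <= x. *)
Lemma acl_decrease r s x : 0 < r <= 1 -> 0 <= x <= acl r -> s <= 1 ->
  r + x * Num.sqrt (1 - r ^+ 2) <= s -> acl s <= acl r - x.
Proof.
move=> /andP[r0 r1] /andP[x0 xa] s1 h.
have p2 := pi_ge2 R.
have ci : cos (acl r) = r by rewrite cos_acl//; lin.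
have /andP[a0 a1] := acl_itv r; have /andP[b0 b1] := acl_itv s.
have si : sin (acl r) = Num.sqrt (1 - r ^+ 2).
  apply/esym/sqrt_id; first by apply: sin_ge0_pi; rewrite a0.
  by rewrite sin2cos2 ci.
have sq0 : 0 <= Num.sqrt (1 - r ^+ 2) by exact: sqrtr_ge0.
have s0 : 0 <= s by have := mulr_ge0 x0 sq0; lin.
have cs : cos (acl s) = s by rewrite cos_acl//; lin.
rewrite leNgt; apply/negP => lt.
have : cos (acl s) < cos (acl r - x) by rewrite lt_cos//; lin.
rewrite cs cosB ci si.
have h1 : r * cos x <= r by rewrite ler_piMr ?cos_le1// ltW.
have h2 : Num.sqrt (1 - r ^+ 2) * sin x <= Num.sqrt (1 - r ^+ 2) * x.
  by apply: ler_wpM2l => //; exact: sin_ltx.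
by lin.
Qed.

Section play.
Variables (mu r0 th0 T : R) (l : @lady R) (m : @man R).
Hypotheses (mu0 : 0 < mu) (lm : lady_motion mu r0 th0 T l)
  (mm : man_motion T m) (fl : lady_follows (kL mu) T l m).

Let V t := vh (rho mu l t) (th l m t).
Let ww t := orient l m t * omega m t.
Let kk t := kL mu (rad l t) (rel_angle l m t) (ww t).

Lemma ww1 t : 0 <= t <= T -> -1 <= ww t <= 1.
Proof.
case: mm => _ _ /(_ t) H _ /H w1; rewrite /ww /orient.
by case: ifP => _; rewrite ?mul1r ?mulN1r//; lin.
Qed.

Lemma psiE t : 0 <= t < T -> cos (psi l t) = cos (kk t) /\
  orient l m t * sin (psi l t) = sin (kk t).
Proof.
move=> /fl ->; rewrite /kk -/(ww t); set k := kL _ _ _ _.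
rewrite /orient; case: ifP => _; first by rewrite !mul1r.
by rewrite !mulN1r cosN sinN opprK.
Qed.

Lemma th'E t : 0 <= t < T -> 0 < rad l t ->
  th' mu l m t = sin (kk t) / rho mu l t - ww t.
Proof.
move=> tT rt; have [_ <-] := psiE tT.
by rewrite /th' /ww orientE ?gt_eqF// mulrBr mulrA.
Qed.

Lemma kkE t : 0 < rad l t -> kk t =
  if (th l m t == pi) && (rho mu l t <= 1) then asin (clamp (rho mu l t * ww t))
  else head (rho mu l t) (th l m t).
Proof.
move=> rt; rewrite /kk rel_angleE; last by rewrite gt_eqF.
rewrite /kL.
have -> : (rho mu l t <= 1) = (rad l t <= mu) by rewrite /rho ler_pdivrMr// mul1r.
by [].
Qed.

Lemma near_data t : 0 <= t < T -> 0 < rad l t -> exists2 d : R, 0 < d &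
  [/\ t + d <= T, forall s, t <= s <= t + d -> 0 < rad l s
    & der (th l m) (th' mu l m) t (t + d)].
Proof.
move=> /andP[t0 tT] rt; have [|d d0 H] := der_th mu0 lm mm _ rt.
  by rewrite t0 ltW.
exists (Num.min d (T - t)); first by rewrite lt_min d0 subr_gt0.
have e1 : t + Num.min d (T - t) <= T.
  by rewrite -lerBrDl ge_min lexx orbT.
have [||h1 h2] := H t (t + Num.min d (T - t)) t0 e1; first by lin.
  by rewrite lerD2l ge_min lexx.
by split.
Qed.

Lemma th_cvg_right t : 0 <= t < T -> 0 < rad l t ->
  th l m s @[s --> t^'+] --> th l m t.
Proof.
move=> tT rt; have [d d0 [_ _ D]] := near_data tT rt.
by apply: der_cvgr D _ _ => //; lin.
Qed.

Lemma rho_cvg_right t : 0 <= t < T -> rho mu l s @[s --> t^'+] --> rho mu l t.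
Proof. by move=> /andP[t0 tT]; exact: der_cvgr (der_rho mu0 lm) t0 tT. Qed.

Let outer t := th l m t < pi \/ 1 < rho mu l t.

Lemma kk_cvg t : 0 <= t < T -> 0 < rad l t -> outer t ->
  kk s @[s --> t^'+] --> head (rho mu l t) (th l m t).
Proof.
move=> tT rt out; have rp := rho_gt0 mu0 rt.
have cth := th_cvg_right tT rt; have crho := rho_cvg_right tT.
have /andP[_ thpi] := th_itv l m t.
have c : head (rho mu l s) (th l m s) @[s --> t^'+] -->
    head (rho mu l t) (th l m t) by exact: head_cvg.
apply: cvg_trans c; apply: near_eq_cvg.
have [d d0 [_ rpos _]] := near_data tT rt.
have N0 : \forall s \near t^'+, 0 < rad l s.
  by apply/near_rightP; exists d => // s /andP[s1 s2]; apply: rpos; lin.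
case: out => [lt|lt].
  move/cvgrPdist_lt : cth => /(_ (pi - th l m t)); rewrite subr_gt0 => /(_ lt).
  apply: filterS2 N0 => s rs; rewrite ltr_norml => /andP[h1 h2].
  by rewrite kkE// lt_eqF//; lin.
move/cvgrPdist_lt : crho => /(_ (rho mu l t - 1)); rewrite subr_gt0 => /(_ lt).
apply: filterS2 N0 => s rs; rewrite ltr_norml => /andP[h1 h2].
have h3 : 1 < rho mu l s by lin.
by rewrite kkE// leNgt h3 andbF.
Qed.

Lemma rho_rate t : 0 <= t < T -> 0 < rad l t -> outer t ->
  let h := head (rho mu l t) (th l m t) in forall eta, 0 < eta ->
  \forall s \near t^'+,
    `|rho mu l s - rho mu l t - (s - t) * cos h| <= eta * (s - t).
Proof.
move=> tT rt out h; have /andP[t0 tT'] := tT.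
have D : der (rho mu l) (fun s => cos (kk s)) t T.
  apply: (eq_der_oo _ _ (derW (der_rho mu0 lm) t0 (lexx _))) => // s /andP[s1 s2].
  by have [|-> _] := @psiE s; first by rewrite s2 andbT; lin.
by apply: der_cvg_rate D _ => //; apply: cos_cvg; exact: kk_cvg.
Qed.

(** Only a lower bound, from omega <= 1: omega itself need have no limit at t. *)
Lemma th_rate t : 0 <= t < T -> 0 < rad l t -> outer t ->
  let h := head (rho mu l t) (th l m t) in forall eta, 0 < eta ->
  \forall s \near t^'+,
    (s - t) * (sin h / rho mu l t - 1 - eta) <= th l m s - th l m t.
Proof.
move=> tT rt out h eta eta0; have /andP[t0 tT'] := tT.
have rp := rho_gt0 mu0 rt.
have [d d0 [dT rpos D]] := near_data tT rt.
have c : sin (kk s) / rho mu l s @[s --> t^'+] --> sin h / rho mu l t.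
  apply: cvgM; first by apply: sin_cvg; exact: kk_cvg.
  by apply: cvgV; [rewrite gt_eqF|exact: rho_cvg_right].
move/cvgrPdist_lt : c => /(_ _ eta0) /near_rightP[d' d'0 H].
apply/near_rightP; exists (Num.min d d'); first by rewrite lt_min d0.
move=> s; rewrite -ltrBlDl lt_min => /andP[ts /andP[sd sd']].
have Ds : der (th l m) (th' mu l m) t s by apply: derW D _ _ => //; lin.
rewrite mulrC; apply: (der_ge_cst (ltW ts) Ds) => u /andP[u1 u2].
rewrite th'E; last 2 first.
- by lin.
- by apply: rpos; lin.
have : `|sin h / rho mu l t - sin (kk u) / rho mu l u| < eta by apply: H; lin.
have uT : 0 <= u <= T by lin.
by rewrite ltr_norml; have := ww1 uT; lin.
Qed.

Lemma value_outer t : 0 <= t < T -> 0 < rad l t -> outer t ->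
  forall eps, 0 < eps -> \forall s \near t^'+,
  V s <= V t + (- (s - t) + eps * (s - t)).
Proof.
move=> tT rt out eps eps0; have /andP[t0 tT'] := tT.
have rp := rho_gt0 mu0 rt; set r := rho mu l t in rp.
have p2 := pi_ge2 R.
have [d d0 [dT rpos _]] := near_data tT rt.
have N0 : \forall s \near t^'+, t < s < t + d.
  by apply/near_rightP; exists d.
have cth := th_cvg_right tT rt; have crho := rho_cvg_right tT.
have rr := rho_rate tT rt out; have tr := th_rate tT rt out.
rewrite /= -/r in rr tr crho.
set th1 := th l m t in tr cth *; set h0 := head r th1 in rr tr *.
(* In the zone L heads for the center, and [vh_le] bounds the later value even if the state leaves
   the zone at once. *)
have [hr|hr] := leP (hat r th1) r.
  have bE : bh r th1 = pi / 2 by exact: bet_le.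
  have h0E : h0 = pi by rewrite /h0 /head bE subrr mulr0 subr0.
  have := rr _ eps0; apply: filterS2 N0 => s /andP[s1 s2].
  rewrite h0E cospi ler_norml => h.
  have -> : V t = pi / 2 + r by rewrite /V -/r /vh bE vv_pihalf.
  have rs : 0 <= rho mu l s by apply: (rho_ge0 mu0 lm); lin.
  by have := vh_le (th l m s) rs; rewrite -/(V s); lin.
have hrpi : hat r th1 <= pi by exact: hat_le_pi.
set b := bh r th1 in h0 rr tr *.
have bi : bmin r <= b <= pi / 2 by exact: bh_itv.
have /andP[bi1 bi2] := bi.
have ThE : Th r b = hat r th1 by rewrite Th_bet//; apply/max_idPl; exact: ltW.
(* Otherwise the projected angle would be pi, contrary to [outer] for r <= 1 and to [Gam_lt_pi] for
   r > 1. *)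
have bb : bmin r < b.
  rewrite lt_neqAle bi1 andbT; apply/eqP => E.
  move: ThE; rewrite -E => ThE; have := Th_bmin_ge rp; rewrite ThE => h.
  have hE : hat r th1 = pi by apply/le_anti; rewrite hrpi h.
  have [r1|r1] := leP r 1.
    case: out => [lt|]; last by rewrite -/r ltNge r1.
    by move: lt; rewrite -/th1 ltNge -hE ge_min lexx.
  by have := Gam_lt_pi r1; rewrite ltNge -hE ge_min lexx orbT.
have /andP[_ th1pi] := th_itv l m t; rewrite -/th1 in th1pi.
have big : Gam r <= th1 -> 1 < r.
  move=> G; rewrite ltNge; apply/negP => r1.
  case: out => [|]; last by rewrite -/r ltNge r1.
  by rewrite -/th1 ltNge; rewrite Gam_le1 ?rp//= in G; rewrite G.
have bpos : 1 < r -> 0 < b.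
  move=> r1; have [/andP[c0 _] _] := acl_inv (ltW r1).
  by move: bb; rewrite bmin_ge1 ?(ltW r1)//; lin.
(* Above the barrier r > 1 and b > 0, and turning further towards the center can only make rho fall
   faster. *)
have ch0 : cos h0 * sin b <= - sin b ^+ 2 /\ (1 < r -> cos h0 <= - sin b).
  have [G|G] := leP th1 (Gam r).
    have [-> _] := head_bh G; rewrite -/b; split => //.
    by rewrite mulNr expr2.
  have r1 := big (ltW G); have b0 := bpos r1.
  have /andP[k0 k1] := kap_itv r th1.
  have x0 : 0 <= pi / 2 - b by lin.
  have e1 : 0 <= kap r th1 * (pi / 2 - b) by exact: mulr_ge0.
  have e2 : kap r th1 * (pi / 2 - b) <= pi / 2 - b by exact: ler_piMl.
  have e3 : sin b <= cos (kap r th1 * (pi / 2 - b)).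
    have -> : sin b = cos (pi / 2 - b).
      by rewrite cosB cos_pihalf sin_pihalf mul0r add0r mul1r.
    by rewrite le_cos//; lin.
  have e4 : cos h0 = - cos (kap r th1 * (pi / 2 - b)).
    by rewrite /h0 /head cosB cospi sinpi mul0r addr0 mulN1r.
  have sb : 0 <= sin b by apply: sin_ge0_pi; lin.
  split; last by rewrite e4; lin.
  by rewrite e4 mulNr lerN2 expr2; apply: ler_wpM2r.
have [ch1 ch2] := ch0.
have sb1 := sin_max b.
have pos : \forall s \near t^'+, 0 < rho mu l s.
  by apply: filterS N0 => s hs; apply: rho_gt0 => //; apply: rpos; lin.
apply: (vv_decrease (hh := fun s => hat (rho mu l s) (th l m s)) rp hr hrpi bb crho) => //.
- exact: hat_cvg.
- by apply: filterS pos => s; exact: hat_le_pi.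
- apply: filterS N0 => s hs; have := rho_lip mu0 lm t0 (b := s) (ltac:(lin)) (ltac:(lin)).
  by [].
- move=> eta eta0; have := rr _ eta0; apply: filterS2 N0 => s hs.
  move=> hh; rewrite -/b.
  have e : (rho mu l s - r) * sin b = (rho mu l s - r - (s - t) * cos h0) * sin b
    + (s - t) * (cos h0 * sin b) by ring.
  have st : 0 < s - t by case/andP: hs => ts _; rewrite subr_gt0.
  have : (s - t) * (cos h0 * sin b) <= (s - t) * (- sin b ^+ 2) by rewrite ler_pM2l.
  have : `|(rho mu l s - r - (s - t) * cos h0) * sin b| <= eta * (s - t).
    by rewrite normrM; apply: le_trans hh; rewrite ler_piMr.
  by rewrite e !ler_norml; lin_goal.
move=> eta eta0; rewrite -[bet r (hat r th1)]/b.
(* On or above the barrier, rho decreases, so [Gam] does not; the rate demanded of the projected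
   angle is negative. *)
have [G|G] := ltP th1 (Gam r).
  have cG : (Gam (rho mu l s) - th l m s) @[s --> t^'+] --> (Gam r - th1).
    by apply: cvgB => //; exact: Gam_cvg.
  move/cvgrPdist_lt : cG => /(_ (Gam r - th1)); rewrite subr_gt0 => /(_ G) N1.
  have [_ sh0] := head_bh (ltW G); rewrite -/b -/h0 in sh0.
  have := tr _ eta0; rewrite sh0; apply: filterS2 N1 => s.
  rewrite ltr_norml => /andP[g1 g2].
  have h : th l m s <= Gam (rho mu l s) by move: g2; lin_goal.
  by rewrite /hat (min_idPl (ltW G)) (min_idPl h).
have r1 := big G; have b0 := bpos r1.
have sb0 : 0 < sin b by apply: sin_gt0_pi; lin.
have c1 := ch2 r1.
have cb : cos b / r <= 1 by rewrite ler_pdivrMr// mul1r; apply: le_trans (cos_le1 b) (ltW r1).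
have N1 := rr _ sb0.
have neg s : t < s < t + d -> (s - t) * (cos b / r - 1 - eta) <= 0.
  move=> /andP[ts _]; rewrite mulr_ge0_le0 ?subr_ge0 ?(ltW ts)//.
  by move: cb eta0; lin_goal.
have N2 : \forall s \near t^'+, 1 < rho mu l s.
  move/cvgrPdist_lt : crho => /(_ (r - 1)); rewrite subr_gt0 => /(_ r1).
  by apply: filterS => s; rewrite ltr_norml; lin_goal.
have hE : hat r th1 = Gam r by apply/min_idPr.
have N3 : \forall s \near t^'+, hat r th1 + (s - t) * (cos b / r - 1 - eta) <= th l m s.
  rewrite hE; move: G; rewrite le_eqVlt => /predU1P[G|G].
    have [_ sh0] := @head_bh _ r th1 (ltac:(by rewrite -G)).
    rewrite -/b -/h0 in sh0; have := tr _ eta0.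
    by apply: filterS => s; rewrite sh0 G; lin_goal.
  move/cvgrPdist_lt : cth => /(_ (th1 - Gam r)); rewrite subr_gt0 => /(_ G).
  apply: filterS2 N0 => s hs; rewrite ltr_norml => g.
  by have := neg s hs; move: g; lin_goal.
apply: filterS2 (filterI N1 (filterI N2 N3)) N0 => s [n1 [n2 n3]] hs.
have st : 0 < s - t by case/andP: hs => ts _; rewrite subr_gt0.
rewrite lerBrDl /hat le_min n3 /= -/(hat r th1) hE.
have le_r : rho mu l s <= r.
  have : (s - t) * cos h0 <= (s - t) * (- sin b) by rewrite ler_pM2l.
  by move: n1; rewrite ler_norml; lin_goal.
have := Gam_le (ltW n2) le_r.
by have := neg s hs; lin_goal.
Qed.

(** If beta is between - acos rho and 0, then cos beta >= rho, and L turns at least as fast as M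
    can. *)
Lemma th'_ge0 u : 0 <= u < T -> 0 < rad l u -> rho mu l u <= 1 ->
  bh (rho mu l u) (th l m u) <= 0 -> 0 <= th' mu l m u.
Proof.
move=> uT ru r1 b0; have rp := rho_gt0 mu0 ru.
have uT' : 0 <= u <= T by lin.
have := ww1 uT' => /andP[w1 w2].
have /andP[_ thpi] := th_itv l m u.
rewrite th'E// kkE//; case: eqVneq => [E|ne].
  rewrite r1 /=; have [|-> _] := @cos_asin_clamp R (rho mu l u * ww u).
    have h1 : rho mu l u * ww u <= rho mu l u * 1 by rewrite ler_pM2l.
    have h2 : rho mu l u * (- 1) <= rho mu l u * ww u by rewrite ler_pM2l.
    by lin.
  by rewrite mulrC mulKf ?gt_eqF// subrr.
have r01 : 0 < rho mu l u <= 1 by rewrite rp.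
have [|_ ->] := @head_bh R (rho mu l u) (th l m u); first by rewrite Gam_le1.
have /andP[b1 _] := bh_itv (th l m u) rp.
set b := bh _ _ in b0 b1 *; rewrite bmin_le1// in b1.
have p2 := pi_ge2 R; have /andP[a0 a1] := acl_itv (rho mu l u).
have : rho mu l u <= cos b.
  rewrite -{1}(cos_acl (x := rho mu l u)); last by lin.
  by rewrite -(cosN b) le_cos//; lin.
rewrite -[X in X <= _](mul1r (rho mu l u)) -ler_pdivlMr//; lin.
Qed.

(** beta is negative at theta = pi, rho < 1, hence by continuity a little later whatever theta is
    then; so theta cannot decrease from its maximum pi. *)
Lemma opposite_stays t : 0 <= t < T -> 0 < rad l t -> th l m t = pi ->
  rho mu l t < 1 -> exists2 d : R, 0 < d & t + d <= T /\
    forall s, t <= s <= t + d -> [/\ 0 < rad l s, th l m s = pi & rho mu l s < 1].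
Proof.
move=> tT rt thE r1; have /andP[t0 tT'] := tT.
have rp := rho_gt0 mu0 rt; have r01 : 0 < rho mu l t <= 1 by rewrite rp ltW.
have [d d0 [dT rpos D]] := near_data tT rt.
have cb : bh (rho mu l s) (th l m s) @[s --> t^'+] --> bh (rho mu l t) pi.
  by apply: bh_cvg => //; [exact: rho_cvg_right|rewrite -thE; exact: th_cvg_right].
have b0 : 0 < - bh (rho mu l t) pi.
  rewrite bh_pi// bmin_le1// opprK lt_neqAle; have /andP[-> _] := acl_itv (rho mu l t).
  rewrite andbT eq_sym; apply/eqP => h.
  have := @cos_acl R (rho mu l t); rewrite h cos0; lra.
move/cvgrPdist_lt : cb => /(_ _ b0) N1.
have := rho_cvg_right tT; move/cvgrPdist_lt => /(_ (1 - rho mu l t)).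
rewrite subr_gt0 => /(_ r1) N2.
have N12 : \forall s \near t^'+, `|bh (rho mu l t) pi - bh (rho mu l s) (th l m s)| < - bh (rho mu l t) pi /\ `|rho mu l t - rho mu l s| < 1 - rho mu l t.
  exact: filterI N1 N2.
move/near_rightP : N12 => [e e0 H].
exists (Num.min d (e / 2)); first by rewrite lt_min d0 divr_gt0.
split; first by apply: le_trans dT; rewrite lerD2l ge_min lexx.
have bnd u : t < u <= t + Num.min d (e / 2) ->
    [/\ 0 < rad l u, rho mu l u < 1, bh (rho mu l u) (th l m u) <= 0 & u <= t + d].
  rewrite -lerBlDl le_min => /andP[u1 /andP[u2 u3]].
  have [|h1 h2] := H u; first by lin.
  split; [by apply: rpos; lin| | |by lin].
    by move: h2; rewrite ltr_norml; lin.
  by move: h1; rewrite ltr_norml; lin.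
move=> s /andP[]; rewrite le_eqVlt => /predU1P[<- _|ts sd]; first by split.
have [h1 h2 h3 h4] := bnd s (introT andP (conj ts sd)).
split => //; apply/le_anti; have /andP[_ ->] := th_itv l m s; rewrite -thE /=.
have Ds : der (th l m) (th' mu l m) t s by apply: derW D _ _ => //; lin.
have := der_ge_cst (c := 0) (ltW ts) Ds; rewrite mul0r subr_ge0; apply.
move=> u /andP[u1 u2]; have [|g1 g2 g3 g4] := bnd u; first by lin.
by apply: th'_ge0 => //; [lin|exact: ltW].
Qed.

Lemma value_opposite t : 0 <= t < T -> 0 < rad l t -> th l m t = pi ->
  rho mu l t < 1 -> forall eps, 0 < eps -> \forall s \near t^'+,
  V s <= V t + (- (s - t) + eps * (s - t)).
Proof.
move=> tT rt thE r1 eps eps0; have /andP[t0 tT'] := tT.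
wlog eps1 : eps eps0 / eps <= 1.
  move=> H; have [//|/ltW e1] := leP eps 1; first exact: H.
  have := H 1 ltr01 (lexx _); have := nbhs_right_gt t; apply: filterS2 => s ts.
  rewrite mul1r => h; apply: le_trans h _; rewrite lerD2l lerD2l ler_peMl//; lin.
have rp := rho_gt0 mu0 rt; set r := rho mu l t in r1 rp.
have r01 : 0 < r <= 1 by rewrite rp ltW.
have [d d0 [dT st]] := opposite_stays tT rt thE r1.
have r21 : r ^+ 2 < 1 by rewrite expr_lt1// ltW.
pose q := Num.sqrt (1 - r ^+ 2).
have q0 : 0 < q by rewrite sqrtr_gt0 subr_gt0.
have cq : Num.sqrt (1 - rho mu l s ^+ 2) @[s --> t^'+] --> q.
  have c2 : 1 - rho mu l s ^+ 2 @[s --> t^'+] --> 1 - r ^+ 2.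
    apply: cvgB; first exact: cvg_cst.
    under eq_fun do rewrite expr2; rewrite expr2.
    by apply: cvgM; exact: rho_cvg_right.
  exact: (continuous_cvg _ (@sqrt_continuous R _) c2).
have eq0 : 0 < eps * q by exact: mulr_gt0.
move/cvgrPdist_lt : cq => /(_ _ eq0) /near_rightP[e e0 H].
have a0 : 0 < acl r.
  rewrite lt_neqAle; have /andP[-> _] := acl_itv r.
  rewrite andbT eq_sym; apply/eqP => h.
  by have := @cos_acl R r; rewrite h cos0; lra.
apply/near_rightP; exists (Num.min (acl r) (Num.min d e)); first by rewrite !lt_min a0 d0.
move=> s; rewrite -ltrBlDl !lt_min => /andP[ts /and3P[sa sd se]].
have [|g1 g2 g3] := st s; first by lin.
have rs : 0 < rho mu l s by exact: rho_gt0.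
have -> : V s = acl (rho mu l s) by rewrite /V g2 vh_pi// rs ltW.
have -> : V t = acl r by rewrite /V thE vh_pi.
have Dr : der (rho mu l) (fun u => cos (psi l u)) t s.
  by apply: derW (der_rho mu0 lm) _ _ => //; lin.
(* The radial speed sqrt (1 - (rho w)^2) is at least sqrt (1 - rho^2) because |w| <= 1. *)
have inc : (q - eps * q) * (s - t) <= rho mu l s - rho mu l t.
  apply: (der_ge_cst (ltW ts) Dr) => u /andP[u1 u2].
  have [|k1 k2 k3] := st u; first by lin.
  have ru : 0 < rho mu l u by exact: rho_gt0.
  have uT : 0 <= u <= T by lin.
  have := ww1 uT => /andP[w1 w2].
  have [|-> _] := @psiE u; first by lin.
  rewrite kkE// k2 eqxx (ltW k3) /=.
  have wr : -1 <= rho mu l u * ww u <= 1.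
    have h1 : rho mu l u * ww u <= rho mu l u * 1 by rewrite ler_pM2l.
    have h2 : rho mu l u * (- 1) <= rho mu l u * ww u by rewrite ler_pM2l.
    by lin.
  have [_ ->] := cos_asin_clamp wr.
  have : Num.sqrt (1 - rho mu l u ^+ 2) <= Num.sqrt (1 - (rho mu l u * ww u) ^+ 2).
    apply: ler_wsqrtr; rewrite lerD2l lerN2 exprMn ler_piMr ?sqr_ge0//.
    by rewrite -(real_normK (num_real (ww u))) expr_le1// ler_norml w1.
  have : `|q - Num.sqrt (1 - rho mu l u ^+ 2)| < eps * q by apply: H; lin.
  by rewrite ltr_norml; lin_goal.
have e1 : (1 - eps) * (s - t) <= s - t.
  by rewrite ler_piMl ?subr_ge0 ?(ltW ts)// lerBlDr lerDl ltW.
have e2 : 0 <= (1 - eps) * (s - t) by rewrite mulr_ge0//; lin.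
have := @acl_decrease r (rho mu l s) ((1 - eps) * (s - t)) r01.
rewrite -/q => h; suff : acl (rho mu l s) <= acl r - (1 - eps) * (s - t) by lin_goal.
apply: h; [by lin|exact: ltW|].
have -> : (1 - eps) * (s - t) * q = (q - eps * q) * (s - t) by ring.
by rewrite -lerBrDl.
Qed.

Lemma value_right t : 0 <= t < T -> 0 < rad l t -> ~ at_E mu l m t ->
  forall eps, 0 < eps -> \forall s \near t^'+,
  V s + s <= V t + t + eps * (s - t).
Proof.
move=> tT rt nE eps eps0.
have : \forall s \near t^'+, V s <= V t + (- (s - t) + eps * (s - t)).
  have /andP[_] := th_itv l m t; rewrite le_eqVlt => /predU1P[E|lt]; last first.
    by apply: value_outer => //; left.
  have [r1|r1|r1] := ltgtP (rho mu l t) 1.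
  - exact: value_opposite.
  - by apply: value_outer => //; right.
  exfalso; apply: nE; split; last by rewrite rel_angleE ?gt_eqF.
  by rewrite -[LHS](divfK (x := mu)) ?gt_eqF// -/(rho mu l t) r1 mul1r.
by apply: filterS => s; lin.
Qed.

Lemma V_squeeze (F : set_system R) {FF : Filter F} t :
  rad l t = 0 -> rho mu l s @[s --> F] --> rho mu l t ->
  (\forall s \near F, 0 <= rho mu l s) -> V s @[s --> F] --> V t.
Proof.
move=> rt c N.
have rz : rho mu l t = 0 by rewrite /rho rt mul0r.
rewrite rz in c; have -> : V t = pi / 2 by rewrite /V rz vh0.
apply: (@squeeze_cvgr _ _ _ _ (fun s => acl (2 * rho mu l s - 1) / 2)
   (fun s => pi / 2 + rho mu l s)).
- by apply: filterS N => s h; rewrite vh_ge//= vh_le.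
- have -> : pi / 2 = acl (2 * 0 - 1) / 2 :> R.
    by rewrite mulr0 sub0r aclE ?acosN1// lexx/=; lin.
  apply: cvgM; last exact: cvg_cst.
  by apply: acl_cvg; apply: cvgB; [apply: cvgM => //; exact: cvg_cst|exact: cvg_cst].
- by rewrite -[X in _ --> X]addr0; apply: cvgD => //; exact: cvg_cst.
Qed.

Lemma V_cvgr t : 0 <= t < T -> V s @[s --> t^'+] --> V t.
Proof.
move=> tT; have /andP[t0 tT'] := tT.
have tT2 : 0 <= t <= T by rewrite t0 ltW.
have := rad_ge0 lm tT2; rewrite le_eqVlt => /predU1P[rz|rt].
  apply: V_squeeze => //; first exact: rho_cvg_right.
  apply/near_rightP; exists (T - t); first by rewrite subr_gt0.
  by move=> s hs; apply: (rho_ge0 mu0 lm); lin.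
apply: vh_cvg; first exact: rho_gt0.
  exact: rho_cvg_right.
exact: th_cvg_right.
Qed.

Lemma V_cvgl t : 0 < t <= T -> V s @[s --> t^'-] --> V t.
Proof.
move=> /andP[t0 tT]; have tT2 : 0 <= t <= T by rewrite tT ltW.
have cr : rho mu l s @[s --> t^'-] --> rho mu l t by exact: der_cvgl (der_rho mu0 lm) t0 tT.
have := rad_ge0 lm tT2; rewrite le_eqVlt => /predU1P[rz|rt].
  apply: V_squeeze => //; apply/near_leftP; exists t => // s hs.
  by apply: (rho_ge0 mu0 lm); lin.
apply: vh_cvg => //; first exact: rho_gt0.
have [d d0 H] := der_th mu0 lm mm tT2 rt.
have [|||_ D] := H (Num.max 0 (t - d)) t _ tT.
- by rewrite le_max lexx.
- by rewrite le_max lexx orbT.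
- by lin.
by apply: der_cvgl D _ (lexx _); rewrite gt_max t0 /=; lin.
Qed.

Hypothesis nE : forall t, 0 <= t < T -> ~ at_E mu l m t.

(** Either end may lie at the center. The slope is used on [c, b[ with c > a, and continuity of the
    value lets c tend to a. *)
Lemma value_interval a b : 0 <= a -> a <= b -> b <= T ->
  (forall t, a < t < b -> 0 < rad l t) -> V b + b <= V a + a.
Proof.
move=> a0; rewrite le_eqVlt => /predU1P[->//|ab] bT rp.
have main c : a < c < b -> V b + b <= V c + c.
  move=> /andP[ac cb]; apply: (@dini_le _ (fun t => V t + t) c b (ltW cb)).
    move=> t e /andP[ct tb] e0; apply: value_right => //.
    - by lin.
    - by apply: rp; lin.
    - by apply: nE; lin.
  move=> t e /andP[ct tb] e0.
  have c1 : V s + s @[s --> t^'-] --> V t + t.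
    apply: cvgD; first by apply: V_cvgl; lin.
    by apply: cvg_at_left_filter; exact: cvg_id.
  move/cvgrPdist_lt : c1 => /(_ _ e0); apply: filterS => s.
  by rewrite ltr_norml; lin_goal.
have c2 : V s + s @[s --> a^'+] --> V a + a.
  apply: cvgD; first by apply: V_cvgr; lin.
  by apply: cvg_at_right_filter; exact: cvg_id.
apply: (ler_cvg_to (cvg_cst (V b + b)) c2).
by apply/near_rightP; exists (b - a); [rewrite subr_gt0|move=> s hs; apply: main; lin].
Qed.

Lemma zero_left a b : 0 <= a -> a <= b -> b <= T -> rad l a = 0 ->
  exists t, [/\ a <= t <= b, rad l t = 0 & forall s, t < s <= b -> rad l s <> 0].
Proof.
move=> a0 ab bT ra; apply: (last_time ab ra) => t /andP[at_ tb] rt.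
have tT : 0 <= t <= T by lin.
have rt' : 0 < rad l t by rewrite lt_neqAle (rad_ge0 lm tT) andbT eq_sym; exact/eqP.
have [d d0 H] := rad_near_pos mu0 lm tT rt'.
apply/near_leftP; exists (Num.min d t); first by rewrite lt_min d0; lin.
move=> s; rewrite ltrBlDr -ltrBlDl lt_min => /andP[/andP[s1 s2] s3] s0.
have : 0 < rad l s by apply: H; [lin|rewrite ltr_norml; lin].
by rewrite s0 ltxx.
Qed.

Lemma zero_right a b : 0 <= a -> a <= b -> b <= T -> rad l b = 0 ->
  exists t, [/\ a <= t <= b, rad l t = 0 & forall s, a <= s < t -> rad l s <> 0].
Proof.
move=> a0 ab bT rb; apply: (first_time ab rb) => t /andP[at_ tb] rt.
have tT : 0 <= t <= T by lin.
have rt' : 0 < rad l t by rewrite lt_neqAle (rad_ge0 lm tT) andbT eq_sym; exact/eqP.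
have [d d0 H] := rad_near_pos mu0 lm tT rt'.
apply/near_rightP; exists (Num.min d (T - t)); first by rewrite lt_min d0; lin.
move=> s; rewrite -ltrBlDl lt_min => /andP[s1 /andP[s2 s3]] s0.
have : 0 < rad l s by apply: H; [lin|rewrite ltr_norml; lin].
by rewrite s0 ltxx.
Qed.

(** The value is pi / 2 at each visit, yet would have to drop in between; and L cannot remain at the
    center, where the feedback is radial at full speed. So [value_interval] is applied at most twice
    along a play. *)
Lemma center_once a b : 0 <= a -> a <= b -> b <= T ->
  rad l a = 0 -> rad l b = 0 -> a = b.
Proof.
move=> a0 ab bT ra rb; apply/eqP; rewrite eq_le ab /= leNgt; apply/negP => lt.
have Vz t : rad l t = 0 -> V t = pi / 2 by move=> h; rewrite /V /rho h mul0r vh0.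
have [[c [/andP[ac cb] rc]]|nc] := pselect (exists c, a < c < b /\ rad l c <> 0).
  have [t [/andP[t1 t2] rt Ht]] := zero_left a0 (ltW ac) (le_trans (ltW cb) bT) ra.
  have [u [/andP[u1 u2] ru Hu]] := zero_right (le_trans a0 (ltW ac)) (ltW cb) bT rb.
  have tc : t < c by rewrite lt_neqAle t2 andbT; apply/eqP => h; apply: rc; rewrite -h.
  have cu : c < u by rewrite lt_neqAle u1 andbT; apply/eqP => h; apply: rc; rewrite h.
  have := @value_interval t u; rewrite !Vz// => h.
  suff : pi / 2 + u <= pi / 2 + t by lin.
  apply: h; [lin|lin|lin|move=> s /andP[s1 s2]].
  have sT : 0 <= s <= T by lin.
  rewrite lt_neqAle (rad_ge0 lm sT) andbT eq_sym; apply/eqP.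
  by have [sc|cs] := leP s c; [apply: Ht; lin|apply: Hu; lin].
have Z t : a < t < b -> rad l t = 0.
  by move=> tab; apply: contrapT => h; apply: nc; exists t.
have D := derW (der_rho mu0 lm) a0 bT.
have := der_ge_cst (c := 1) ab D; rewrite /rho ra rb subrr mul1r => h.
suff : b - a <= 0 by lin.
apply: h => s sab; have rs := Z s sab.
have [|-> _] := @psiE s; first by lin.
rewrite /kk rel_angle0// rs /kL eqxx (ltW mu0) /= mul0r mul0r.
have [|_ ->] := @cos_asin_clamp R 0; first by lin.
by rewrite expr0n subr0 sqrtr1.
Qed.

Lemma value_decreases : 0 <= T -> V T + T <= V 0.
Proof.
move=> T0; rewrite -[X in _ <= X]addr0.
have [[c [/andP[c0 cT] rc]]|nc] := pselect (exists c, 0 <= c <= T /\ rad l c = 0).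
  have pos t : 0 <= t <= T -> t <> c -> 0 < rad l t.
    move=> tT tc; rewrite lt_neqAle (rad_ge0 lm tT) andbT eq_sym; apply/eqP => rt.
    apply: tc; have /andP[t0 tT'] := tT.
    have [h|/ltW h] := leP t c; first exact: center_once.
    by apply/esym; exact: center_once.
  apply: (@le_trans _ _ (V c + c)).
    apply: value_interval => // t /andP[t1 t2]; apply: pos; first by lin.
    by move=> E; rewrite E ltxx in t1.
  apply: value_interval => // t /andP[t1 t2]; apply: pos; first by lin.
  by move=> E; rewrite E ltxx in t2.
apply: value_interval => // t /andP[t1 t2].
have tT : 0 <= t <= T by rewrite !ltW.
rewrite lt_neqAle (rad_ge0 lm tT) andbT eq_sym; apply/eqP => rt.
by apply: nc; exists t.
Qed.

End play.
End value_along_play.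

(** * Continuation of plays *)

Section plays.
Context {R : realType}.
Implicit Types (a b c d e h t s x y z u A B T mu : R) (l : @lady R) (m : @man R).
Local Notation pi := (@trigo.pi R).

Lemma lady_motionP mu r0 th0 T l : rad l 0 = r0 -> azi l 0 = th0 ->
  bm (psi l) 0 T -> (forall t, 0 <= t <= T -> - pi <= psi l t <= pi) ->
  (forall t, 0 <= t <= T -> 0 <= rad l t <= 1) ->
  der (rad l) (fun t => mu * cos (psi l t)) 0 T ->
  (forall a b, 0 <= a -> a <= b -> b <= T -> (forall t, a <= t <= b -> 0 < rad l t) ->
    der (azi l) (fun t => mu / rad l t * sin (psi l t)) a b) ->
  lady_motion mu r0 th0 T l.
Proof.
move=> r00 a00 [mp _] p1 r1 [_ Dr] Da; split.
- by [].
- by [].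
- by [].
- by move=> a b a0 ab bT; exact: Dr.
- by move=> a b a0 ab bT rp; have [_ E] := Da a b a0 ab bT rp; exact: E.
Qed.

Section lady.
Variables (mu r0 th0 T : R) (l : @lady R).
Hypotheses (mu0 : 0 < mu) (lm : lady_motion mu r0 th0 T l).

Lemma der_rad : der (rad l) (fun t => mu * cos (psi l t)) 0 T.
Proof.
apply: eq_der (derZ mu (der_rho mu0 lm)) => // t _.
by rewrite /rho mulrC divfK// gt_eqF.
Qed.

Lemma der_azi_rad a b : 0 <= a -> b <= T ->
  (forall t, a <= t <= b -> 0 < rad l t) ->
  der (azi l) (fun t => mu / rad l t * sin (psi l t)) a b.
Proof.
move=> a0 bT rp; apply: eq_der (der_azi mu0 lm a0 bT rp) => // t tab.
by rewrite /rho invfM invrK; ring.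
Qed.

Lemma bm_psi : bm (psi l) 0 T.
Proof.
case: lm => _ [mp p1] _ _ _; split => //; exists pi => t /p1.
by rewrite ler_norml.
Qed.

End lady.

Definition play mu r0 th0 m T l : Prop :=
  [/\ 0 <= T, lady_motion mu r0 th0 T l, lady_follows (kL mu) T l m
    & forall t, 0 <= t < T -> ~ at_E mu l m t].

Definition response mu l m t : R :=
  orient l m t * kL mu (rad l t) (rel_angle l m t) (orient l m t * omega m t).

Lemma response_itv mu l m t : - pi <= response mu l m t <= pi.
Proof.
have [H _] := @kL_feedback R mu.
have := H (rad l t) (rel_angle l m t) (orient l m t * omega m t).
rewrite /response /orient; case: ifP => _; rewrite ?mul1r ?mulN1r//.
by move=> /andP[h1 h2]; rewrite lerN2 h2 lerNl h1.
Qed.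

Lemma eq_rel_angle l l' m t : rad l t = rad l' t -> azi l t = azi l' t ->
  rel_angle l m t = rel_angle l' m t /\ orient l m t = orient l' m t.
Proof. by rewrite /rel_angle /orient => -> ->. Qed.

Lemma eq_rel_angle0 l l' m t : rad l t = 0 -> rad l' t = 0 ->
  rel_angle l m t = rel_angle l' m t /\ orient l m t = orient l' m t.
Proof. by move=> h h'; rewrite !rel_angle0// !orient0. Qed.

(** The azimuths must fit at T only if L is not at the center. At T itself the heading of [l2] is
    used, since the first play follows the feedback before T only. *)
Lemma glue_play mu r0 th0 m T h l l2 : 0 < mu -> play mu r0 th0 m T l -> 0 < h ->
  ~ at_E mu l m T ->
  rad l2 T = rad l T -> (0 < rad l T -> azi l2 T = azi l T) ->
  bm (psi l2) T (T + h) ->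
  (forall t, T <= t <= T + h -> 0 <= rad l2 t <= 1) ->
  der (rad l2) (fun t => mu * cos (psi l2 t)) T (T + h) ->
  (forall a b, T <= a -> a <= b -> b <= T + h -> (forall t, a <= t <= b -> 0 < rad l2 t) ->
    der (azi l2) (fun t => mu / rad l2 t * sin (psi l2 t)) a b) ->
  (forall t, T <= t <= T + h -> psi l2 t = response mu l2 m t) ->
  (forall t, T < t < T + h -> ~ at_E mu l2 m t) ->
  exists l', play mu r0 th0 m (T + h) l' /\ lady_agree T l l'.
Proof.
move=> mu0 [T0 lm fl nE] h0 nET r2 a2 mp r1 Dr Da fp nE2.
pose l' := Lady (fun t => if t <= T then rad l t else rad l2 t)
  (fun t => if t <= T then azi l t else azi l2 t)
  (fun t => if t < T then psi l t else psi l2 t).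
have l'l t : t <= T -> rad l' t = rad l t /\ azi l' t = azi l t.
  by move=> /= ->.
have l'l2 t : T <= t -> rad l' t = rad l2 t.
  by move=> /=; case: (leP t T) => // h1 h2; have -> : t = T by apply/le_anti; rewrite h1.
have a'l2 t : T <= t -> 0 < rad l' t -> azi l' t = azi l2 t.
  move=> /=; case: (leP t T) => // h1 h2 h3.
  have E : t = T by apply/le_anti; rewrite h1.
  by move: h3; rewrite E => h3; rewrite a2.
have same t : T <= t -> rel_angle l' m t = rel_angle l2 m t /\
    orient l' m t = orient l2 m t.
  move=> Tt; have E := l'l2 t Tt.
  have [rz|rz] := eqVneq (rad l2 t) 0; first by apply: eq_rel_angle0; rewrite ?E.
  have [ET|tT] := eqVneq t T; last first.
    have lt : T < t by rewrite lt_neqAle eq_sym tT.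
    by apply: eq_rel_angle => //=; rewrite leNgt lt.
  apply: eq_rel_angle => //; rewrite ET /= lexx -a2//.
  have TT : 0 <= T <= T by rewrite lexx andbT.
  by rewrite lt_neqAle (rad_ge0 lm TT) andbT -r2 eq_sym -ET.
have pE t : T <= t -> psi l' t = psi l2 t by move=> /= Tt; rewrite ltNge Tt.
have D1 : der (rad l') (fun t => mu * cos (psi l' t)) 0 (T + h).
  apply: (@der_cat _ _ _ 0 T).
    apply: eq_der_oo (der_rad mu0 lm) => t /andP[t0 tT]; first by rewrite /= tT.
    by rewrite /= tT.
  by apply: eq_der_oo Dr => t /andP[t0 tT]; rewrite ?l'l2// pE// ltW.
have follows t : 0 <= t < T + h -> psi l' t = response mu l' m t.
  move=> /andP[t0 th]; have [tT|Tt] := ltP t T.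
    have [e1 e2] := l'l t (ltW tT).
    have [e3 e4] := @eq_rel_angle l' l m t e1 e2.
    rewrite /response e3 e4 e1 /= tT; apply: fl; by rewrite t0.
  rewrite pE// fp; last by rewrite Tt ltW.
  by have [e1 e2] := same t Tt; rewrite /response e1 e2 l'l2.
exists l'; split; last first.
  by split => t /andP[t0 tT] /=; rewrite tT.
split => //; first by lin.
- apply: lady_motionP.
  + by rewrite /= T0; case: lm => -[].
  + by rewrite /= T0; case: lm => -[].
  + apply: (@bm_cat _ _ _ T).
      by apply: bm_oo (bm_psi lm) _ => t /andP[t0 tT] /=; rewrite tT.
    by apply: bm_oo mp _ => t /andP[t0 tT]; rewrite pE// ltW.
  + move=> t /andP[t0 th]; have [tT|Tt] := ltP t T.
      by rewrite /= tT; case: lm => _ [_ +] _ _ _; apply; rewrite t0 ltW.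
    by rewrite pE// fp ?Tt//; exact: response_itv.
  + move=> t /andP[t0 th]; have [tT|/ltW Tt] := leP t T.
      by rewrite /= tT; case: lm => _ _ + _ _; apply; rewrite t0.
    by rewrite l'l2//; apply: r1; rewrite Tt.
  + exact: D1.
  + move=> a b a0 ab bT rp.
    have left : a <= T -> der (azi l') (fun t => mu / rad l' t * sin (psi l' t)) a (Num.min b T).
      move=> aT.
      have rp' t : a <= t <= Num.min b T -> 0 < rad l t.
        move=> /andP[t1]; rewrite le_min => /andP[t2 t3].
        by have [<- _] := l'l t t3; apply: rp; rewrite t1.
      have bT' : Num.min b T <= T by rewrite ge_min lexx orbT.
      apply: eq_der_oo (der_azi_rad mu0 lm a0 bT' rp') => t.
        by move=> /andP[t1]; rewrite le_min => /andP[t2 t3]; rewrite /= t3.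
      move=> /andP[t1]; rewrite lt_min => /andP[t2 t3].
      by rewrite /= t3 (ltW t3).
    have right : T <= b -> der (azi l') (fun t => mu / rad l' t * sin (psi l' t)) (Num.max a T) b.
      move=> Tb.
      have rp' t : Num.max a T <= t <= b -> 0 < rad l' t.
        by rewrite ge_max -andbA => /and3P[t1 t2 t3]; apply: rp; rewrite t1.
      have aT' : T <= Num.max a T by rewrite le_max lexx orbT.
      have ab' : Num.max a T <= b by rewrite ge_max ab.
      have rp2 t : Num.max a T <= t <= b -> 0 < rad l2 t.
        move=> tab; rewrite -l'l2; first exact: rp'.
        by case/andP: tab => + _; exact: le_trans.
      have D := Da _ _ aT' ab' bT rp2.
      apply: eq_der_oo D => t tab; have /andP[t1 t2] := tab.
        by rewrite a'l2//; [exact: le_trans t1|exact: rp'].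
      have Tt : T <= t by apply: le_trans (ltW t1).
      by rewrite l'l2// pE.
    have [bT'|Tb] := leP b T.
      by have := left (le_trans ab bT'); rewrite (min_idPl bT').
    have [aT|Ta] := leP a T.
      have := left aT; rewrite (min_idPr (ltW Tb)) => D.
      have := right (ltW Tb); rewrite (max_idPr aT) => D'.
      exact: der_cat D D'.
    by have := right (ltW Tb); rewrite (max_idPl (ltW Ta)).
move=> t /andP[t0 th]; have [tT|Tt] := ltP t T.
  have [e1 e2] := l'l t (ltW tT); have [e3 _] := @eq_rel_angle l' l m t e1 e2.
  by rewrite /at_E e1 e3; apply: nE; rewrite t0.
move: Tt; rewrite le_eqVlt => /predU1P[<-|Tt].
  have [e1 e2] := l'l T (lexx _); have [e3 _] := @eq_rel_angle l' l m T e1 e2.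
  by rewrite /at_E e1 e3.
by have [e1 _] := same t (ltW Tt); rewrite /at_E l'l2 ?(ltW Tt)// e1; apply: nE2; rewrite Tt.
Qed.

End plays.

(** * Continuation opposite M *)

Section opposite.
Context {R : realType}.
Implicit Types (a b c d e h t s w x y z u A B T mu : R) (l : @lady R) (m : @man R).
Local Notation pi := (@trigo.pi R).

Lemma asin_clampE x : asin (clamp x) = pi / 2 - acl x.
Proof. by have := acosE_asin (clamp_itv x); rewrite /acl => <-; ring. Qed.

Lemma bm_cvg_comp (G : R -> R) (f : R -> R) a b C : continuous G ->
  (forall x, `|G x| <= C) -> bm f a b -> bm (fun t => G (f t)) a b.
Proof.
move=> cG GC [mf _]; split; last by exists C.
by apply: measurableT_comp mf; exact: continuous_measurable_fun.
Qed.

Lemma sqrt_le x mu : 0 < mu -> 0 <= Num.sqrt (mu ^+ 2 - x ^+ 2) <= mu.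
Proof.
move=> mu0; rewrite sqrtr_ge0 /=.
rewrite -[X in _ <= X](ger0_norm (ltW mu0)) -sqrtr_sqr ler_wsqrtr//.
by have := sqr_ge0 x; lin.
Qed.

(** The radius has to solve rad' = sqrt (mu^2 - (rad w)^2), continuous in rad but only measurable in
    time: a case for [usc_ode]. *)
Lemma extend_opposite mu r0 th0 m T l : 0 < mu -> mu < 1 ->
  (forall S, man_motion S m) -> play mu r0 th0 m T l ->
  rel_angle l m T = pi -> rad l T < mu ->
  exists2 h : R, 0 < h & exists l', play mu r0 th0 m (T + h) l' /\ lady_agree T l l'.
Proof.
move=> mu0 mu1 mm pl an rmu; have [T0 lm fl nE] := pl.
have TT : 0 <= T <= T by rewrite T0 lexx.
have rT0 := rad_ge0 lm TT.
(* At speed mu this covers half the distance to radius mu, so E is not reached. *)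
pose h := (mu - rad l T) / (2 * mu).
have h0 : 0 < h by rewrite divr_gt0 ?mulr_gt0// subr_gt0.
have muh : mu * h = (mu - rad l T) / 2 by rewrite /h; field; rewrite gt_eqF.
exists h => //.
have Th : T <= T + h by lin.
have Dp := derW (der_pos (mm (T + h))) T0 (lexx _).
have [bo _] := Dp.
have w1 t : T <= t <= T + h -> -1 <= omega m t <= 1.
  by move=> tT; case: (mm (T + h)) => _ _ + _; apply; lin.
pose g t x := Num.sqrt (mu ^+ 2 - (x * omega m t) ^+ 2).
have g1 t x : 0 <= g t x <= mu by exact: sqrt_le.
have gK t x : `|g t x| <= mu by have /andP[? ?] := g1 t x; rewrite ger0_norm.
have cg t : continuous (g t).
  move=> x; apply: (continuous_cvg _ (@sqrt_continuous R _)).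
  apply: cvgB; first exact: cvg_cst.
  under eq_fun do rewrite expr2; rewrite expr2.
  by apply: cvgM; apply: cvgM; (exact: cvg_id || exact: cvg_cst).
have cg' t x e : 0 < e -> exists2 d : R, 0 < d &
    forall y, `|y - x| < d -> `|g t x - g t y| < e.
  move=> e0; have := cg t x; move/cvgrPdist_lt => /(_ _ e0) [d /= d0 H].
  by exists d => // y yx; apply: H; rewrite /ball/= distrC.
have [|||p [mp pE]] := @usc_ode R g mu T (T + h) (rad l T) Th gK.
- move=> x.
  have cG : continuous (fun y : R => Num.sqrt (mu ^+ 2 - y ^+ 2)).
    move=> y; apply: (continuous_cvg _ (@sqrt_continuous R _)).
    apply: cvgB; first exact: cvg_cst.
    by under eq_fun do rewrite expr2; rewrite expr2; apply: cvgM; exact: cvg_id.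
  apply: (bm_cvg_comp (C := mu) cG); last exact: bmZ.
  by move=> y; have /andP[? ?] := sqrt_le y mu0; rewrite ger0_norm.
- move=> t x e _ e0; have [d d0 H] := cg' t x e e0.
  by exists d => // y /H; rewrite ltr_norml; lin.
- move=> t x e _ e0; have [d d0 H] := cg' t x e e0.
  exists d => // y hy; have := H y; rewrite ger0_norm; last by lin.
  by rewrite ltr_norml => hh; have := hh (ltac:(lin)); lin.
have Dr : der p (fun t => g t (p t)) T (T + h).
  split => // a b Ta ab bT.
  rewrite !pE ?Ta ?bT ?(le_trans Ta ab) ?(le_trans ab bT)//.
  by rewrite (@ig_cat _ _ T a b)//; [ring|exact: bmW mp (lexx _) bT].
have pT : p T = rad l T by rewrite pE ?lexx// ig0 addr0.
have prange t : T <= t <= T + h -> rad l T <= p t /\ p t < mu.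
  move=> /andP[t1 t2]; have [mg E] := derW Dr (lexx _) t2.
  have := E T t (lexx _) t1 (lexx _); rewrite pT => E1.
  have := ig_ge_cst (M := 0) t1 mg; rewrite -E1 mul0r => k1.
  have := ig_le_cst (M := mu) t1 mg; rewrite -E1 => k2.
  have {}k1 : 0 <= p t - rad l T by apply: k1 => s _; case/andP: (g1 s (p s)).
  have {}k2 : p t - rad l T <= mu * (t - T) by apply: k2 => s _; case/andP: (g1 s (p s)).
  have : mu * (t - T) <= mu * h by rewrite ler_pM2l//; lin.
  by rewrite muh; lin.
(* c is pi up to full turns; at the center it may be chosen afresh. *)
have [c [cA aA]] : exists c, cos c = -1 /\ (0 < rad l T -> azi l T = c + pos m T).
  have [rz|rz] := eqVneq (rad l T) 0.
    by exists pi; rewrite cospi rz ltxx.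
  exists (phi l m T); split; last by rewrite /phi subrK.
  by rewrite -cos_th -rel_angleE// an cospi.
have sA : sin c = 0.
  by apply/eqP; rewrite -sqrf_eq0 sin2cos2 cA sqrrN expr1n subrr.
pose l2 := Lady p (fun t => c + pos m t) (fun t => asin (clamp (p t / mu * omega m t))).
have or t : orient l2 m t = 1.
  by rewrite /orient /= addrK sA lexx orbT.
have re t : rel_angle l2 m t = pi.
  by rewrite /rel_angle /angle /= addrK cA acosN1; case: ifP.
have q1 t : T <= t <= T + h -> -1 <= p t / mu * omega m t <= 1.
  move=> tT; have [p1 p2] := prange t tT; have /andP[u1 u2] := w1 t tT.
  have pt0 : 0 <= p t by exact: le_trans p1.
  have k0 : 0 <= p t / mu by rewrite divr_ge0// ltW.
  have k1 : p t / mu <= 1 by rewrite ler_pdivrMr// mul1r ltW.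
  rewrite -ler_norml normrM (ger0_norm k0) -[X in _ <= X](mul1r 1).
  by apply: ler_pM => //; rewrite ler_norml u1.
apply: (glue_play (l2 := l2)) => //.
- by move=> [E _]; rewrite E ltxx in rmu.
- by move=> /aA ->.
- have k1 : bm (fun t => p t / mu * omega m t) T (T + h).
    apply: bmM bo; have := bmZ mu^-1 (der_bm0 Dr).
    by apply: eq_bm => t _; rewrite mulrC.
  apply: (bm_cvg_comp (C := pi) (G := fun x => asin (clamp x))) k1.
    have -> : (fun x => asin (clamp x)) = fun x : R => pi / 2 - acl x.
      by apply/funext => x; exact: asin_clampE.
    by move=> x; apply: cvgB; [exact: cvg_cst|exact: continuous_acl].
  move=> x; have k := clamp_itv x; have p2 := pi_ge2 R.
  by have := asin_geNpi2 k; have := asin_lepi2 k; rewrite ler_norml; lin.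
- by move=> t /prange[] /=; lin.
- apply: eq_der Dr => // t tT /=; have [_ ->] := cos_asin_clamp (q1 t tT).
  rewrite /g -[X in _ = X * _](sqrt_id (x := mu ^+ 2))//; last exact: ltW.
  rewrite -sqrtrM ?sqr_ge0//; congr Num.sqrt.
  by rewrite !exprMn mulrBr mulr1 exprVn; field; rewrite gt_eqF.
- move=> a b Ta ab bT rp.
  have Dpab := derW (derD (der_cst c T (T + h)) Dp) Ta bT.
  apply: eq_der Dpab => // t tab /=.
  have [|-> _] := cos_asin_clamp (q1 t _); first by lin.
  have := rp t tab; rewrite /= => pt.
  by rewrite add0r; field; rewrite !gt_eqF.
- move=> t tT; rewrite /response or re !mul1r /kL eqxx /=.
  by have [_ /ltW ->] := prange t tT.
by move=> t tT [/= E _]; have [|_] := prange t; [lin|rewrite E ltxx].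
Qed.

End opposite.

(** * Continuation where the feedback is continuous *)

Section outer.
Context {R : realType}.
Implicit Types (a b c d e f h r t s w x y z u A B K T mu : R) (l : @lady R) (m : @man R).
Local Notation pi := (@trigo.pi R).

(** Leads from the derivatives supplied by [peano] to the integral form, by [dini_le] with both
    signs. *)
Lemma strong_der (x v : R -> R) K a b : a <= b -> 0 <= K ->
  (forall s t, a <= s -> s <= t -> `|x t - x s| <= K * (t - s)) ->
  bm v a b ->
  (forall t, a <= t < b -> v s @[s --> t^'+] --> v t) ->
  (forall t, a <= t < b -> forall e, 0 < e -> exists2 d : R, 0 < d &
    forall s, t <= s -> s < t + d -> `|x s - x t - (s - t) * v t| <= e * (s - t)) ->
  der x v a b.
Proof.
move=> ab K0 lx mv cv sd; split => // c c' ac cc' c'b.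
have E : der (ig v a) v a b.
  split => // u u' au uu' u'b.
  by rewrite (@ig_cat _ _ a u u')//; [ring|exact: bmW mv (lexx _) u'b].
have main (sg : R) : `|sg| = 1 -> sg * (x c' - ig v a c') <= sg * (x c - ig v a c).
  move=> sg1; apply: (@dini_le _ (fun t => sg * (x t - ig v a t)) c c' cc').
    move=> t e /andP[ct tc'] e0.
    have tab : a <= t < b by lin.
    have /andP[_ tb] := tab.
    have e2 : 0 < e / 2 by lin.
    have [d d0 H] := sd t tab _ e2.
    have at_ : a <= t by lin.
    have Dt := derW E at_ (lexx b).
    have := der_cvg_rate tb Dt (cv t tab) e2.
    apply: filterS2; last first.
      have N : \forall s \near t^'+, t < s < t + d by apply/near_rightP; exists d.
      exact: N.
    move=> s /andP[s1 s2] h1; have h2 := H s (ltW s1) s2.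
    have : `|sg * ((x s - x t - (s - t) * v t) - (ig v a s - ig v a t - (s - t) * v t))|
        <= e * (s - t).
      rewrite normrM sg1 mul1r; apply: le_trans (ler_normB _ _) _; lin.
    rewrite ler_norml => /andP[_].
    have -> : sg * (x s - x t - (s - t) * v t - (ig v a s - ig v a t - (s - t) * v t)) =
      sg * (x s - ig v a s) - sg * (x t - ig v a t) by ring.
    by lin.
  move=> t e /andP[ct tc'] e0.
  have cx : x s @[s --> t^'-] --> x t.
    by apply: (@lip_cvgl _ _ K t c) => // s hs; apply: lx; lin.
  have ci : ig v a s @[s --> t^'-] --> ig v a t by apply: der_cvgl E _ _; lin.
  have cN : sg * (x s - ig v a s) @[s --> t^'-] --> sg * (x t - ig v a t).
    by apply: cvgM; [exact: cvg_cst|exact: cvgB].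
  move/cvgrPdist_lt : cN => /(_ _ e0); apply: filterS => s.
  by rewrite ltr_norml; lin.
have := main 1 (normr1 _); have := main (-1); rewrite normrN normr1 => /(_ erefl).
have [_ Ec] := derW E ac c'b; have := Ec c c' (lexx _) cc' (lexx _).
by lin.
Qed.

Definition outer_state r f := acl (cos f) < pi \/ 1 < r :> R.

(** Where reflection switches the sign of the angular part, this part vanishes: L heads for the
    center at theta = 0 and, owing to [kap], also at theta = pi with rho > 1. Hence the reflected
    field is continuous. *)
Lemma sin_head0 r f : 0 < r -> outer_state r f -> sin f = 0 ->
  sin (head r (acl (cos f))) = 0.
Proof.
move=> r0 out sf; have p2 := pi_ge2 R.
have : cos f ^+ 2 == 1.
  by have := cos2Dsin2 f; rewrite sf expr0n/= addr0 => ->.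
rewrite sqrf_eq1 => /orP[/eqP E|/eqP E].
  rewrite E acl_ge1// /head /bh.
  have -> : bet r (hat r 0) = pi / 2 by apply: bet_le; rewrite ge_min (ltW r0).
  by rewrite subrr mulr0 subr0 sinpi.
have aE : acl (-1) = pi :> R by rewrite aclE ?acosN1// lexx/=; lin.
case: out => [|r1]; first by rewrite E aE ltxx.
rewrite E aE /head /kap leNgt Gam_lt_pi//= subrr mul0r.
have -> : Num.min 1 0 = 0 :> R by apply/min_idPr; exact: ler01.
by rewrite maxxx mul0r subr0 sinpi.
Qed.

Lemma field_cvg (T : Type) (F : set_system T) {FF : Filter F} (X A : T -> R) r f :
  0 < r -> outer_state r f -> X @ F --> r -> A @ F --> f ->
  (fun i => cos (head (X i) (acl (cos (A i))))) @ F --> cos (head r (acl (cos f))) /\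
  (fun i => sg1 (sin (A i)) * sin (head (X i) (acl (cos (A i))))) @ F -->
    sg1 (sin f) * sin (head r (acl (cos f))).
Proof.
move=> r0 out cX cA.
have /andP[_ apl] := acl_itv (cos f).
have cH : (fun i => head (X i) (acl (cos (A i)))) @ F --> head r (acl (cos f)).
  by apply: head_cvg => //; apply: acl_cvg; exact: cos_cvg.
split; first exact: cos_cvg.
have cS : (fun i => sin (head (X i) (acl (cos (A i))))) @ F -->
    sin (head r (acl (cos f))) by exact: sin_cvg.
have [s0|s0] := eqVneq (sin f) 0.
  move: cS; rewrite sin_head0// mulr0 => /cvgrPdist_lt cS.
  apply/cvgrPdist_lt => e /cS; apply: filterS => i.
  rewrite !sub0r !normrN normrM.
  by case: (sg1P (sin (A i))) => -[_ ->]; rewrite ?normrN normr1 mul1r.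
have c : (fun i => sg1 (sin f) * sin (head (X i) (acl (cos (A i))))) @ F -->
    sg1 (sin f) * sin (head r (acl (cos f))) by apply: cvgM => //; exact: cvg_cst.
apply: cvg_trans c; apply: near_eq_cvg.
have cs : (fun i => sin (A i)) @ F --> sin f by exact: sin_cvg.
move/cvgrPdist_lt : cs => /(_ `|sin f|); rewrite normr_gt0 => /(_ s0).
apply: filterS => i; have [h|h] := leP 0 (sin f).
  rewrite (ger0_norm h) ltr_norml => /andP[h1 h2].
  by rewrite /sg1 h ifT//; lin.
rewrite (ltr0_norm h) ltr_norml => /andP[h1 h2].
by rewrite /sg1 !ifF//; apply/negbTE; rewrite -ltNge//; lin.
Qed.

Section local.
Variables (mu r0 th0 T : R) (m : @man R) (l : @lady R).
Hypotheses (mu0 : 0 < mu) (mu1 : mu < 1) (mm : forall S, man_motion S m)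
  (pl : play mu r0 th0 m T l) (rT : 0 < rad l T)
  (outT : outer_state (rho mu l T) (phi l m T)).

Let T0 : 0 <= T. Proof. by case: pl. Qed.

Let lm : lady_motion mu r0 th0 T l. Proof. by case: pl. Qed.

(* Motions are only constrained at nonnegative times. *)
Let q t : R := pos m (Num.max 0 t).

Let qlip s t : `|q s - q t| <= `|s - t|.
Proof.
wlog st : s t / s <= t.
  by move=> H; have [/H//|/ltW/H] := leP s t; rewrite distrC (distrC t).
have a0 : 0 <= Num.max 0 s by rewrite le_max lexx.
have ab : Num.max 0 s <= Num.max 0 t by rewrite ge_max !le_max lexx st orbT.
have := pos_lip (mm (Num.max 0 t)) a0 ab (lexx _).
rewrite distrC /q => h; apply: le_trans h _; rewrite distrC ger0_norm ?subr_ge0//.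
have [s0|s0] := leP 0 s; have [t0|t0] := leP 0 t; lra.
Qed.

Let q_cvg (U : Type) (F : set_system U) {FF : Filter F} (X : U -> R) t :
  X @ F --> t -> (fun i => q (X i)) @ F --> q t.
Proof.
move=> /cvgrPdist_lt c; apply/cvgrPdist_lt => e /c; apply: filterS => i.
exact: le_lt_trans (qlip _ _).
Qed.

(** [peano] wants a bounded field, so the radius is cut off below at half its value at T, a level
    that is not reached up to T + h. *)
Let r2 := rad l T / 2.
Let cut x := Num.max x r2.
Let cut0 x : 0 < cut x. Proof. by rewrite lt_max /r2 divr_gt0 ?orbT. Qed.
Let f1 t x y := mu * cos (head (cut x / mu) (acl (cos (y - q t)))).
Let f2 t x y := mu / cut x *
  (sg1 (sin (y - q t)) * sin (head (cut x / mu) (acl (cos (y - q t))))).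

Let f_cvg (U : Type) (F : set_system U) {FF : Filter F} (S X Y : U -> R) t x y :
  outer_state (cut x / mu) (y - q t) -> S @ F --> t -> X @ F --> x -> Y @ F --> y ->
  (fun i => f1 (S i) (X i) (Y i)) @ F --> f1 t x y /\
  (fun i => f2 (S i) (X i) (Y i)) @ F --> f2 t x y.
Proof.
move=> out cS cX cY.
have cc : (fun i => cut (X i)) @ F --> cut x by apply: max_cvg => //; exact: cvg_cst.
have cr : (fun i => cut (X i) / mu) @ F --> cut x / mu.
  by apply: cvgM => //; exact: cvg_cst.
have ca : (fun i => Y i - q (S i)) @ F --> y - q t by apply: cvgB => //; exact: q_cvg.
have [c1 c2] := field_cvg (divr_gt0 (cut0 x) mu0) out cr ca.
split; first by apply: cvgM => //; exact: cvg_cst.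
apply: cvgM => //; apply: cvgM; first exact: cvg_cst.
by apply: cvgV => //; rewrite gt_eqF.
Qed.

Let K := mu + mu / r2.

Let f1K t x y : `|f1 t x y| <= K.
Proof.
rewrite normrM gtr0_norm// -[X in _ <= X]addr0 -[mu in X in X <= _]mulr1.
have h : mu * `|cos (head (cut x / mu) (acl (cos (y - q t))))| <= mu.
  by rewrite ler_piMr ?cos_max// ltW.
rewrite mulr1 addr0 /K; apply: le_trans h _.
by rewrite lerDl divr_ge0 ?(ltW mu0)// /r2 ltW// divr_gt0.
Qed.

Let f2K t x y : `|f2 t x y| <= K.
Proof.
have r20 : 0 < r2 by rewrite /r2 divr_gt0.
rewrite /f2 !normrM (gtr0_norm mu0) normfV (gtr0_norm (cut0 x)).
have -> : `|sg1 (sin (y - q t))| = 1.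
  by case: (sg1P (sin (y - q t))) => -[_ ->]; rewrite ?normrN normr1.
rewrite mul1r; apply: (@le_trans _ _ (mu / cut x)).
  by rewrite ler_piMr ?sin_max// divr_ge0 ?(ltW mu0)// ltW.
apply: (@le_trans _ _ (mu / r2)); last by rewrite /K lerDr ltW.
by rewrite ler_pM2l// lef_pV2 ?posrE// /cut le_max lexx orbT.
Qed.

Lemma extend_outer : exists2 h : R, 0 < h &
  exists l', play mu r0 th0 m (T + h) l' /\ lady_agree T l l'.
Proof.
have [_ _ fl nE] := pl.
have K0 : 0 <= K by apply: le_trans (normr_ge0 (f1 0 0 0)) _.
have [x [y [xT yT lx ly D]]] := @peano R f1 f2 K T (rad l T) (azi l T) K0 f1K f2K.
have p2 := pi_ge2 R.
have qE t : T <= t -> q t = pos m t.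
  by move=> Tt; rewrite /q (max_idPr _)//; exact: le_trans Tt.
pose ph t := y t - q t.
have lip_within t B (z : R -> R) : T <= t <= B ->
    (forall a b, T <= a -> a <= b -> `|z b - z a| <= K * (b - a)) ->
    z s @[s --> within `[T, B] (nbhs t)] --> (z t : R).
  move=> tB lz; have : {within `[T, B], continuous z}.
    by apply: (lip_continuous K0) => a b Ta ab bB; exact: lz.
  by move/subspace_continuousP; apply; rewrite /= in_itv.
have right_of t (z : R -> R) : T <= t ->
    (forall a b, T <= a -> a <= b -> `|z b - z a| <= K * (b - a)) ->
    z s @[s --> t^'+] --> (z t : R).
  move=> Tt lz; apply: (@lip_cvgr _ _ K t (t + 1)); first by lra.
  by move=> s hs; apply: lz; lra.
have cphT : ph s @[s --> T^'+] --> phi l m T.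
  rewrite /phi -yT -(qE T)//; apply: cvgB; first exact: right_of.
  by apply: q_cvg; apply: cvg_at_right_filter; exact: cvg_id.
have cxT : x s @[s --> T^'+] --> rad l T by rewrite -xT; exact: right_of.
have N1 : \forall s \near T^'+, r2 < x s.
  move/cvgrPdist_lt : (cxT) => /(_ r2); rewrite /r2 divr_gt0// => /(_ isT).
  by apply: filterS => s; rewrite ltr_norml; lra.
have N2 : \forall s \near T^'+, acl (cos (ph s)) < pi \/ 1 < x s / mu.
  case: outT => [lt|lt].
    have c : acl (cos (ph s)) @[s --> T^'+] --> acl (cos (phi l m T)).
      by apply: acl_cvg; exact: cos_cvg.
    move/cvgrPdist_lt : c => /(_ (pi - acl (cos (phi l m T)))).
    rewrite subr_gt0 => /(_ lt); apply: filterS => s; rewrite ltr_norml => h.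
    by left; lra.
  have c : x s / mu @[s --> T^'+] --> rho mu l T by apply: cvgM => //; exact: cvg_cst.
  move/cvgrPdist_lt : c => /(_ (rho mu l T - 1)).
  rewrite subr_gt0 => /(_ lt); apply: filterS => s; rewrite ltr_norml => h.
  by right; lra.
(* Keeps L in the lake: if rho <= 1 there is room since mu < 1, and if rho > 1 the radius will turn
   out not to grow. *)
have N3 : \forall s \near T^'+, (1 < rho mu l T -> 1 < x s / mu) /\ (rho mu l T <= 1 -> x s <= 1).
  have [ge|lt] := leP (rho mu l T) 1.
    have r1 : rad l T < 1 by apply: le_lt_trans mu1; rewrite -(mul1r mu) -ler_pdivrMr.
    move/cvgrPdist_lt : (cxT) => /(_ (1 - rad l T)); rewrite subr_gt0 => /(_ r1).
    by apply: filterS => s; rewrite ltr_norml => hs; split => // _; lra.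
  have c : x s / mu @[s --> T^'+] --> rho mu l T by apply: cvgM => //; exact: cvg_cst.
  move/cvgrPdist_lt : c => /(_ (rho mu l T - 1)).
  rewrite subr_gt0 => /(_ lt); apply: filterS => s; rewrite ltr_norml => hs.
  by split => // _; lra.
have N123 : \forall s \near T^'+, [/\ r2 < x s, acl (cos (ph s)) < pi \/ 1 < x s / mu &
    (1 < rho mu l T -> 1 < x s / mu) /\ (rho mu l T <= 1 -> x s <= 1)].
  by move: N1 N2 N3; apply: filterS3 => s ? ? ?; split.
move/near_rightP : N123 => [d d0 H].
pose h := d / 2.
have h0 : 0 < h by rewrite divr_gt0.
exists h => //.
have TTh : T <= T + h by lra.
have gt_r2 t : T <= t <= T + h -> r2 < x t.
  move=> /andP[]; rewrite le_eqVlt => /predU1P[<- _|t1 t2].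
    by rewrite xT /r2; have := rT; lra.
  by have [] := H t; rewrite /h in t2; lra.
have outt t : T <= t <= T + h -> outer_state (x t / mu) (ph t).
  move=> /andP[]; rewrite le_eqVlt => /predU1P[<- _|t1 t2].
    by rewrite xT /ph yT qE//.
  by have [|_ h1 _] := H t; [move: t2; rewrite /h; lra|].
have r20 : 0 < r2 by rewrite /r2 divr_gt0.
have x0 t : T <= t <= T + h -> 0 < x t by move=> /gt_r2; exact: lt_trans.
have cutE t : T <= t <= T + h -> cut (x t) = x t.
  by move=> /gt_r2 hh; apply/max_idPl; exact: ltW.
pose v1 t := f1 t (x t) (y t); pose v2 t := f2 t (x t) (y t).
have outc t : T <= t <= T + h -> outer_state (cut (x t) / mu) (y t - q t).
  by move=> tT; rewrite cutE//; exact: outt.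
have cv t : T <= t <= T + h -> v1 s @[s --> within `[T, T + h] (nbhs t)] --> v1 t /\
    v2 s @[s --> within `[T, T + h] (nbhs t)] --> v2 t.
  move=> tT; apply: (f_cvg (outc t tT)); [|exact: lip_within|exact: lip_within].
  by apply: cvg_within_filter; exact: cvg_id.
have cvr t : T <= t < T + h -> v1 s @[s --> t^'+] --> v1 t /\ v2 s @[s --> t^'+] --> v2 t.
  move=> /andP[t1 t2]; have tT : T <= t <= T + h by rewrite t1 ltW.
  apply: (f_cvg (outc t tT)); [|exact: right_of|exact: right_of].
  by apply: cvg_at_right_filter; exact: cvg_id.
have bv1 : bm v1 T (T + h).
  apply: continuous_bm; apply/subspace_continuousP => t.
  by rewrite /= in_itv/= => /cv[].
have bv2 : bm v2 T (T + h).
  apply: continuous_bm; apply/subspace_continuousP => t.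
  by rewrite /= in_itv/= => /cv[].
have joint t : T <= t <= T + h -> forall e, 0 < e -> exists2 d : R, 0 < d &
    forall s p p', `|s - t| < d -> `|p - x t| < d -> `|p' - y t| < d ->
    `|f1 s p p' - f1 t (x t) (y t)| <= e /\ `|f2 s p p' - f2 t (x t) (y t)| <= e.
  move=> tT e e0; pose P0 : R * R * R := (t, x t, y t).
  have [|||c1 c2] := @f_cvg _ (nbhs P0) _ (fun p => p.1.1) (fun p => p.1.2) (fun p => p.2)
      t (x t) (y t) (outc t tT).
  - by apply: (cvg_comp _ _ (@cvg_fst _ _ (nbhs P0.1) (nbhs P0.2) _)); exact: cvg_fst.
  - by apply: (cvg_comp _ _ (@cvg_fst _ _ (nbhs P0.1) (nbhs P0.2) _)); exact: cvg_snd.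
  - exact: cvg_snd.
  move/cvgrPdist_le : c1 => /(_ _ e0) c1; move/cvgrPdist_le : c2 => /(_ _ e0) c2.
  have N : \forall p \near P0,
      `|f1 t (x t) (y t) - f1 p.1.1 p.1.2 p.2| <= e /\
      `|f2 t (x t) (y t) - f2 p.1.1 p.1.2 p.2| <= e by exact: filterI c1 c2.
  move/nbhs_ballP : N => [d' /= d'0 Hd].
  exists d' => // s p p' hs hp hp'.
  have [|k1 k2] := Hd (s, p, p').
    by split; [split|]; rewrite /ball/= distrC.
  by rewrite distrC k1 distrC k2.
have strong t : T <= t < T + h -> forall e, 0 < e -> exists2 d : R, 0 < d &
    forall s, t <= s -> s < t + d ->
      `|x s - x t - (s - t) * v1 t| <= e * (s - t) /\
      `|y s - y t - (s - t) * v2 t| <= e * (s - t).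
  move=> /andP[t1 t2] e e0; have tT : T <= t <= T + h by rewrite t1 ltW.
  have [d' d'0 Hd] := D t t1 (joint t tT) e e0.
  by exists d' => // s ts sd; apply: Hd => //; lra.
have Dx : der x v1 T (T + h).
  apply: (strong_der TTh K0) => //.
    by move=> t /cvr[].
  by move=> t tT e e0; have [d' d'0 Hd] := strong t tT e e0; exists d' => // s ? ?; case: (Hd s).
have Dy : der y v2 T (T + h).
  apply: (strong_der TTh K0) => //.
    by move=> t /cvr[].
  by move=> t tT e e0; have [d' d'0 Hd] := strong t tT e e0; exists d' => // s ? ?; case: (Hd s).
pose l2 := Lady x y (fun t => response mu (Lady x y (fun=> 0)) m t).
have resp t : T <= t <= T + h -> psi l2 t =
    sg1 (sin (ph t)) * head (x t / mu) (acl (cos (ph t))).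
  move=> tT; have /andP[t1 t2] := tT; have xt := x0 t tT.
  rewrite /= /response.
  have E1 : rel_angle (Lady x y (fun=> 0)) m t = acl (cos (ph t)).
    by rewrite rel_angleE ?gt_eqF//= /th /phi /ph qE.
  have E2 : orient (Lady x y (fun=> 0)) m t = sg1 (sin (ph t)).
    by rewrite orientE ?gt_eqF//= /phi /ph qE.
  rewrite E1 E2 /= /kL; case: eqVneq => //= E3; case: leP => //= E4.
  case: (outt t tT) => [|]; first by rewrite E3 ltxx.
  by rewrite ltr_pdivlMr// mul1r ltNge E4.
have cosE t : T <= t <= T + h -> mu * cos (psi l2 t) = v1 t.
  by move=> tT; rewrite resp// cos_sg1 /v1 /f1 cutE.
have sinE t : T <= t <= T + h -> mu / x t * sin (psi l2 t) = v2 t.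
  by move=> tT; rewrite resp// sin_sg1 /v2 /f2 cutE.
have cph t : T <= t <= T + h -> ph s @[s --> within `[T, T + h] (nbhs t)] --> ph t.
  move=> tT; apply: cvgB; first exact: lip_within.
  by apply: q_cvg; apply: cvg_within_filter; exact: cvg_id.
apply: (glue_play (l2 := l2) mu0 pl h0).
- case=> radE angE; case: outT => [|].
    by rewrite -/(th l m T) -rel_angleE ?gt_eqF// angE ltxx.
  by rewrite /rho radE divff ?gt_eqF// ltxx.
- exact: xT.
- by [].
- have b1 : bm ph T (T + h).
    apply: continuous_bm; apply/subspace_continuousP => t.
    by rewrite /= in_itv/=; exact: cph.
  have b2 : bm (fun t => head (x t / mu) (acl (cos (ph t)))) T (T + h).
    apply: continuous_bm; apply/subspace_continuousP => t; rewrite /= in_itv/= => tT.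
    apply: head_cvg.
    + by rewrite divr_gt0// x0.
    + by case/andP: (acl_itv (cos (ph t))).
    + exact: outt.
    + by apply: cvgM; [exact: lip_within|exact: cvg_cst].
    + by apply: acl_cvg; apply: cos_cvg; exact: cph.
  have b3 : bm (fun t => sg1 (sin (ph t))) T (T + h).
    case: b1 => mb1 _; split; first by apply: measurable_sg1; exact: measurable_sin.
    by exists 1 => t _; case: (sg1P (sin (ph t))) => -[_ ->]; rewrite ?normrN normr1.
  by apply: eq_bm (bmM b3 b2) => t tT; rewrite resp.
- move=> t tT; rewrite /= (ltW (x0 t tT)) /=; have /andP[t1 t2] := tT.
  have r1 : rad l T <= 1 by case: lm => _ _ /(_ T) + _ _; rewrite T0 lexx => /(_ isT)/andP[].
  move: t1; rewrite le_eqVlt => /predU1P[<-|t1]; first by rewrite xT.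
  have [ge|lt] := leP (rho mu l T) 1.
    by have [|_ _ [_ ->]] := H t; first by move: t2; rewrite /h; lra.
  have big s : T < s <= t -> 1 < x s / mu.
    by move=> hs; have [|_ _ [-> //]] := H s; first by move: t2; rewrite /h; lra.
  (* For rho > 1 beta is at least acos (1 / rho) >= 0, so the heading does not point outwards. *)
  suff : x t - x T <= 0 * (t - T) by rewrite xT mul0r subr_le0 => /le_trans; apply.
  apply: (der_le_cst (ltW t1) (derW Dx (lexx _) t2)) => s hs.
  have sT : T <= s <= T + h.
    by case/andP: hs => Ts st; rewrite (ltW Ts) (ltW (lt_le_trans st t2)).
  have s1 : 1 < x s / mu by apply: big; case/andP: hs => -> /ltW.
  have s0 : 0 < x s / mu by exact: lt_trans s1.
  rewrite /v1 /f1 cutE// pmulr_rle0// /head.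
  have := kap_itv (x s / mu) (acl (cos (y s - q s))).
  have := bh_itv (acl (cos (y s - q s))) s0; rewrite bmin_ge1 ?(ltW s1)//.
  have [/andP[c0 _] _] := acl_inv (ltW s1).
  set k := kap _ _; set B := bh _ _ => /andP[b1 b2] /andP[k0 k1].
  have e1 : 0 <= k * (pi / 2 - B) by rewrite mulr_ge0// subr_ge0.
  have e2 : k * (pi / 2 - B) <= pi / 2 - B by rewrite ler_piMl// subr_ge0.
  rewrite cosB cospi sinpi mul0r addr0 mulN1r oppr_le0.
  apply: cos_ge0_pihalf; have pi2 := pi_ge2 R.
  by move: c0 b1 e1 e2 pi2; lin_goal.
- by apply: eq_der Dx => // t tT; rewrite cosE.
- move=> a b Ta ab bT rp; apply: eq_der (derW Dy Ta bT) => // t tab.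
  by case/andP: tab => at_ tb; rewrite sinE// (le_trans Ta)//= (le_trans tb).
- by move=> t tT.
- move=> t tT [E1 E2]; rewrite /= in E1.
  have tT' : T <= t <= T + h by case/andP: tT => /ltW tl /ltW; rewrite tl.
  case: (outt t tT') => [|]; last by rewrite E1 divff ?gt_eqF// ltxx.
  move: E2; rewrite rel_angleE; last by rewrite /= gt_eqF// x0.
  by rewrite /th /phi /= /ph qE; [move=> ->; rewrite ltxx|lra].
Qed.

End local.
End outer.

(** * Limits of chains of plays, and completion of a play *)

Section limit.
Context {R : realType}.
Implicit Types (a b c d e h r s t w x y z u A B K T mu : R) (l : @lady R) (m : @man R) (n k : nat).
Local Notation pi := (@trigo.pi R).

Lemma bm_point (f : R -> R) a : bm f a a.
Proof. by apply: bm_oo (bm_cst 0 a a) _ => t ht; lra. Qed.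

Lemma ig_add (f : R -> R) a c b A B : bm f A B -> A <= a -> a <= c -> c <= b -> b <= B ->
  ig f a b = ig f a c + ig f c b.
Proof. by move=> bf Aa ac cb bB; apply: ig_cat => //; exact: bmW bf Aa bB. Qed.

Section chain.
Variables (mu r0 th0 : R) (m : @man R) (T : nat -> R) (l : nat -> @lady R) (Tl : R).
Hypotheses (mu0 : 0 < mu) (pl : forall n, play mu r0 th0 m (T n) (l n))
  (Tmono : forall n k, (n <= k)%N -> T n <= T k)
  (ag : forall n k, (n <= k)%N -> lady_agree (T n) (l n) (l k))
  (TTl : forall n, T n < Tl) (Tlim : forall t, t < Tl -> exists n, t < T n).

Let idx t : nat := xget 0%N [set n | t < T n].

Let idxP t : t < Tl -> t < T (idx t).
Proof. by move=> tT; apply: (@xgetPex _ 0%N [set n | t < T n]); exact: Tlim. Qed.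

Let lm n : lady_motion mu r0 th0 (T n) (l n). Proof. by case: (pl n). Qed.

Let Tl0 : 0 < Tl. Proof. by apply: le_lt_trans (TTl 0); case: (pl 0). Qed.

Let agree n k t : 0 <= t -> t <= T n -> t <= T k ->
  rad (l n) t = rad (l k) t /\ azi (l n) t = azi (l k) t.
Proof.
move=> t0 tn tk; have [nk|/ltnW kn] := leqP n k.
  by case: (ag nk) => H _; apply: H; rewrite t0.
by case: (ag kn) => H _; have [-> ->] := H t (introT andP (conj t0 tk)).
Qed.

Let agree_psi n k t : 0 <= t -> t < T n -> t < T k -> psi (l n) t = psi (l k) t.
Proof.
move=> t0 tn tk; have [nk|/ltnW kn] := leqP n k.
  by case: (ag nk) => _ H; apply: H; rewrite t0.
by case: (ag kn) => _ H; rewrite H// t0.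
Qed.

Let ps t := if t < Tl then psi (l (idx t)) t else 0.

Let psE n t : 0 <= t -> t < T n -> ps t = psi (l n) t.
Proof.
move=> t0 tn; have tl : t < Tl by exact: lt_trans (TTl n).
by rewrite /ps tl; apply: agree_psi => //; exact: idxP.
Qed.

Let bm_ps : bm ps 0 Tl.
Proof.
(* The limit heading is a pointwise limit of these measurable truncations. *)
pose f n t := if t < T n then psi (l n) t else 0.
have bf n : bm (f n) 0 Tl.
  apply: (@bm_cat _ _ _ (T n)).
    by apply: bm_oo (bm_psi (lm n)) _ => t /andP[t1 t2]; rewrite /f t2.
  by apply: bm_oo (bm_cst 0 _ _) _ => t /andP[t1 t2]; rewrite /f ltNge ltW.
have [] // := @ig_cvg _ f ps 0 Tl pi bf.
  move=> n t /andP[t0 tl]; rewrite /f; case: ltP => tn.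
    case: (lm n) => _ [_ /(_ t) H] _ _ _; rewrite ler_norml H// t0 ltW//.
  by rewrite normr0 pi_ge0.
move=> t /andP[t0 tl]; have [lt|ge] := ltP t Tl; last first.
  have -> : ps t = 0 by rewrite /ps ltNge ge.
  have -> : f^~ t = fun=> 0; last exact: cvg_cst.
  by apply/funext => n; rewrite /f ltNge ltW// (lt_le_trans (TTl n)).
have [n0 tn0] := Tlim lt.
apply: cvg_near_cst; exists n0 => // n /= nn.
have tn : t < T n by apply: lt_le_trans tn0 _; exact: Tmono.
by rewrite /f tn (psE (n := n)).
Qed.

Let bm_cos : bm (fun t => mu * cos (ps t)) 0 Tl.
Proof.
apply: bmZ; case: bm_ps => mp _; split; first exact: measurable_cos.
by exists 1 => t _; exact: cos_max.
Qed.

Let rd t := r0 + ig (fun t => mu * cos (ps t)) 0 t.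

Let der_rd : der rd (fun t => mu * cos (ps t)) 0 Tl.
Proof.
split => // a b a0 ab bT; rewrite /rd.
by rewrite (@ig_add _ 0 a b 0 Tl)//; ring.
Qed.

Let rdE n t : 0 <= t -> t <= T n -> rd t = rad (l n) t.
Proof.
move=> t0 tn; have [mr E] := der_rad mu0 (lm n).
have := E 0 t (lexx _) t0 tn; have -> : rad (l n) 0 = r0 by case: (lm n) => -[].
move=> h; have -> : rad (l n) t = r0 + (rad (l n) t - r0) by ring.
rewrite h /rd; congr (_ + _); apply: eq_ig_oo.
- by apply: bmW bm_cos (lexx _) _; apply: le_trans tn (ltW (TTl n)).
- exact: bmW mr (lexx _) tn.
- by move=> s /andP[s1 s2]; rewrite (psE (n := n))// ?(ltW s1)// (lt_le_trans s2).
Qed.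

Let w t := mu / rd t * sin (ps t).

Let bm_w a b : 0 <= a -> b <= Tl -> (forall t, a <= t <= b -> 0 < rd t) -> bm w a b.
Proof.
move=> a0 bT rp; apply: bmM.
  apply: bmZ; have /der_continuous cr := derW der_rd a0 bT.
  apply: continuous_bm; apply/subspace_continuousP => t tab.
  apply: cvgV; first by rewrite gt_eqF// rp//; move: tab; rewrite /= in_itv.
  by move/subspace_continuousP : cr; exact.
case: (bmW bm_ps a0 bT) => mp _; split; first exact: measurable_sin.
by exists 1 => t _; exact: sin_max.
Qed.

(** If L stays away from the center from time c on, the azimuth at [Tl] is found by integrating from
    c. If there is no such c, L is at the center at [Tl], where the azimuth is immaterial. *)
Let good c := 0 <= c < Tl /\ forall t, c <= t <= Tl -> 0 < rd t.

Let c0 := xget 0 good.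

Let az t := if t < Tl then azi (l (idx t)) t
  else azi (l (idx c0)) c0 + ig w c0 Tl.

Let azE n t : 0 <= t -> t <= T n -> az t = azi (l n) t.
Proof.
move=> t0 tn; have tl : t < Tl by exact: le_lt_trans (TTl n).
rewrite /az tl; have [] // := agree t0 _ tn (n := idx t).
by apply: ltW; exact: idxP.
Qed.

Let der_az_lt a b : 0 <= a -> a <= b -> b < Tl ->
  (forall t, a <= t <= b -> 0 < rd t) -> der az w a b.
Proof.
move=> a0 ab bT rp; have [n bn] := Tlim bT.
have rp' t : a <= t <= b -> 0 < rad (l n) t.
  move=> tab; rewrite -rdE ?rp//; first by lra.
  by apply: le_trans (ltW bn); lra.
apply: eq_der_oo (der_azi_rad mu0 (lm n) a0 (ltW bn) rp') => t /andP[t1 t2].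
  by rewrite (azE (n := n))//; [exact: le_trans t1|exact: le_trans (ltW bn)].
have t0 : 0 <= t by apply: le_trans (ltW t1).
have tn : t < T n by apply: lt_trans bn.
by rewrite /w (rdE (n := n))// ?(ltW tn)// (psE (n := n)).
Qed.

Let der_az a b : 0 <= a -> a <= b -> b <= Tl ->
  (forall t, a <= t <= b -> 0 < rd t) -> der az w a b.
Proof.
move=> a0 ab; rewrite le_eqVlt => /predU1P[bE|bT]; last exact: der_az_lt.
subst b; move: ab; rewrite le_eqVlt => /predU1P[aE|aT] rp.
  subst a; split; first exact: bm_point.
  move=> s t s1 st t1; have -> : s = Tl by lra.
  have -> : t = Tl by lra.
  by rewrite subrr ig0.
have bw := bm_w a0 (lexx _) rp.
split => // s t as_ st tT.
have rps u v : s <= u -> v <= Tl -> forall x, u <= x <= v -> 0 < rd x.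
  by move=> su vT x hx; apply: rp; lra.
move: tT; rewrite le_eqVlt => /predU1P[tE|tT]; last first.
  have D : der az w s t by apply: der_az_lt => //; [lra|apply: rps; lra].
  by case: D => _; apply.
subst t; move: st; rewrite le_eqVlt => /predU1P[->|sT]; first by rewrite subrr ig0.
have [/andP[c00 cT] cp] : good c0.
  by apply: (@xgetPex _ 0 good); exists a; split => //; rewrite a0.
pose e := Num.max s c0.
have eT : e < Tl by rewrite gt_max sT.
have se : s <= e by rewrite le_max lexx.
have ce : c0 <= e by rewrite le_max lexx orbT.
have s0 : 0 <= s by lra.
have D1 : der az w c0 e by apply: der_az_lt => // x hx; apply: cp; lra.
have D2 : der az w s e by apply: der_az_lt => //; apply: rps; lra.
have [_ /(_ c0 e (lexx _) ce (lexx _)) E1] := D1.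
have [_ /(_ s e (lexx _) se (lexx _)) E2] := D2.
have cc : 0 <= c0 <= Tl by lra.
have bwc : bm w c0 Tl by apply: bm_w => //; case/andP: cc.
have azT : az Tl = az c0 + ig w c0 Tl by rewrite /az ltxx cT.
rewrite azT (ig_add bwc (lexx _) ce (ltW eT) (lexx _)).
rewrite (ig_add bw as_ se (ltW eT) (lexx _)).
by lra.
Qed.

Lemma play_limit : exists l', play mu r0 th0 m Tl l' /\
  forall n, lady_agree (T n) (l n) l'.
Proof.
pose l' := Lady rd az ps.
exists l'; split; last first.
  move=> n; split => t /andP[t0 tn] /=; first by rewrite (rdE (n := n))// (azE (n := n)).
  by rewrite (psE (n := n)).
have eqn t : 0 <= t < Tl -> exists n, [/\ t < T n, rad l' t = rad (l n) t,
    azi l' t = azi (l n) t & psi l' t = psi (l n) t].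
  move=> /andP[t0 tT]; exists (idx t); have tn := idxP tT; split => //=.
  - by apply: rdE => //; exact: ltW.
  - by apply: azE => //; exact: ltW.
  - exact: psE.
have rng t : 0 <= t < Tl -> 0 <= rd t <= 1.
  move=> tT; have [n [tn + _ _]] := eqn t tT; rewrite /= => ->.
  by case: (lm n) => _ _ + _ _; apply; lra.
split; first exact: ltW.
- apply: lady_motionP => //.
  + by rewrite /= /rd ig0 addr0.
  + have [n [_ _ -> _]] := eqn 0 (introT andP (conj (lexx 0) Tl0)).
    by case: (lm n) => -[].
  + move=> t /andP[t0 tT]; have [lt|ge] := ltP t Tl.
      have [n [tn _ _ ->]] := eqn t (introT andP (conj t0 lt)).
      by case: (lm n) => _ [_ +] _ _ _; apply; lra.
    by rewrite /= /ps ltNge ge /=; have := pi_ge0 R; lra.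
  + move=> t /andP[t0]; rewrite le_eqVlt => /predU1P[->|tT]; last first.
      by apply: rng; rewrite t0.
    have c := der_cvgl der_rd Tl0 (lexx _).
    have N : \forall s \near Tl^'-, 0 <= rd s <= 1.
      by apply/near_leftP; exists Tl => // s hs; apply: rng; lra.
    rewrite /=; apply/andP; split.
      by apply: (ler_cvg_to (cvg_cst 0) c); apply: filterS N => s; lra.
    have c1 : (fun=> 1 : R) s @[s --> Tl^'-] --> (1 : R) by exact: cvg_cst.
    by apply: (ler_cvg_to c c1); apply: filterS N => s; lra.
- move=> t tT; have [n [tn e1 e2 ->]] := eqn t tT.
  have [e3 e4] := @eq_rel_angle _ l' (l n) m t e1 e2.
  rewrite e1 e3 e4; case: (pl n) => _ _ + _; apply; lra.
move=> t tT; have [n [tn e1 e2 _]] := eqn t tT.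
have [e3 _] := @eq_rel_angle _ l' (l n) m t e1 e2.
by rewrite /at_E e1 e3; case: (pl n) => _ _ _; apply; lra.
Qed.

End chain.

Section secures.
Variables (mu r0 th0 : R) (m : @man R).
Hypotheses (mu0 : 0 < mu) (mu1 : mu < 1) (mm : forall S, man_motion S m)
  (th0_itv : 0 <= th0 <= pi).

(** The value has decreased by at least T and is still nonnegative. *)
Lemma play_bound T l : play mu r0 th0 m T l -> T <= vh (r0 / mu) th0.
Proof.
move=> [T0 lm fl nE]; have := value_decreases mu0 lm (mm T) fl nE T0.
rewrite (th_start lm (mm T) th0_itv).
have -> : rho mu l 0 = r0 / mu by rewrite /rho; case: lm => -[->].
have TT : 0 <= T <= T by rewrite T0 lexx.
have := vh_ge (th l m T) (rho_ge0 mu0 lm TT).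
by have /andP[] := acl_itv (2 * rho mu l T - 1); lra.
Qed.

Lemma play_extends T l : play mu r0 th0 m T l -> ~ at_E mu l m T ->
  exists2 h : R, 0 < h & exists l', play mu r0 th0 m (T + h) l' /\ lady_agree T l l'.
Proof.
move=> pl nE; have [T0 lm _ _] := pl.
have TT : 0 <= T <= T by rewrite T0 lexx.
have := rad_ge0 lm TT; rewrite le_eqVlt => /predU1P[rz|rp].
  by apply: extend_opposite => //; [rewrite rel_angle0|rewrite -rz].
have rE : rel_angle l m T = th l m T by rewrite rel_angleE// gt_eqF.
have /andP[_] := th_itv l m T; rewrite le_eqVlt => /predU1P[tE|lt]; last first.
  by apply: (extend_outer mu0 mu1 mm pl rp); left.
have [r1|r1|r1] := ltgtP (rad l T) mu.
- by apply: extend_opposite => //; rewrite rE.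
- apply: (extend_outer mu0 mu1 mm pl rp); right.
  by rewrite /rho ltr_pdivlMr// mul1r.
- by exfalso; apply: nE; split => //; rewrite rE.
Qed.

Lemma agree_trans T T' l l' l'' : T <= T' -> lady_agree T l l' ->
  lady_agree T' l' l'' -> lady_agree T l l''.
Proof.
move=> TT' [H1 H2] [H3 H4]; split => t /andP[t0 tT].
  have [|-> ->] := H1 t; first by rewrite t0.
  by apply: H3; rewrite t0 (le_trans tT).
rewrite H2 ?t0// H4// t0; exact: lt_le_trans TT'.
Qed.

(** If E were never reached, every play could be prolonged. Each step of a chain takes at least half
    of the prolongation that is possible; lengths are bounded by [play_bound], and the limit play
    could be prolonged beyond what the steps allow. *)
Lemma play_completes T l : play mu r0 th0 m T l ->
  exists T' l', [/\ T <= T', play mu r0 th0 m T' l', lady_agree T l l' & at_E mu l' m T'].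
Proof.
move=> pl; apply: contrapT => none.
pose ok (p : R * lady) := [/\ T <= p.1, play mu r0 th0 m p.1 p.2 & lady_agree T l p.2].
pose ext (p q : R * @lady R) := [/\ p.1 <= q.1, play mu r0 th0 m q.1 q.2
   & lady_agree p.1 p.2 q.2].
have ok_ext p q : ok p -> ext p q -> ok q.
  move=> [h1 h2 h3] [h4 h5 h6]; split => //; first exact: le_trans h4.
  exact: agree_trans h3 h6.
have nE p : ok p -> ~ at_E mu p.2 m p.1.
  by move=> [h1 h2 h3] E; apply: none; exists p.1, p.2.
have strict p : ok p -> exists2 q, ext p q & p.1 < q.1.
  move=> okp; have [h1 h2 h3] := okp; have [h h0 [l' [pl' ag]]] := play_extends h2 (nE p okp).
  exists (p.1 + h, l'); last by rewrite /= ltrDl.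
  by split => //=; rewrite lerDl ltW.
pose S p := [set t | exists2 q, ext p q & t = q.1].
have supS p : ok p -> has_sup (S p).
  move=> okp; split; first by have [q pq _] := strict p okp; exists q.1, q.
  by exists (vh (r0 / mu) th0) => t [q [_ + _] ->]; exact: play_bound.
have step (p : {p : R * lady | ok p}) : exists q : {p : R * lady | ok p},
    [/\ ext (sval p) (sval q), (sval p).1 < (sval q).1
      & (sval p).1 + sup (S (sval p)) <= 2 * (sval q).1].
  case: p => p okp /=; have [q0 pq0 lt0] := strict p okp.
  have le0 : q0.1 <= sup (S p) by apply: ub_le_sup; [exact: (supS p okp).2|exists q0].
  have [|t [q pq ->] lt] := @sup_adherent _ (S p) ((sup (S p) - p.1) / 2) _ (supS p okp).
    by lra.
  by exists (exist _ q (ok_ext p q okp pq)) => /=; split => //; lra.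
have [f fP] := choice step.
have ok0 : ok (T, l) by split.
pose s n := iter n f (exist _ (T, l) ok0).
pose Tn n := (sval (s n)).1; pose ln n := (sval (s n)).2.
have okn n : ok (Tn n, ln n) by rewrite /Tn /ln -surjective_pairing; exact: (svalP (s n)).
have sS n : [/\ ext (sval (s n)) (sval (s n.+1)), Tn n < Tn n.+1
    & Tn n + sup (S (sval (s n))) <= 2 * Tn n.+1] by exact: fP.
have Tmono n k : (n <= k)%N -> Tn n <= Tn k.
  elim: k => [|k IH]; first by rewrite leqn0 => /eqP->.
  rewrite leq_eqVlt => /predU1P[->//|/IH h].
  by have [_ lt _] := sS k; exact: le_trans h (ltW lt).
have agn n k : (n <= k)%N -> lady_agree (Tn n) (ln n) (ln k).
  elim: k => [|k IH]; first by rewrite leqn0 => /eqP->; split.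
  rewrite leq_eqVlt => /predU1P[->|nk]; first by split.
  by have [[_ _ h] _ _] := sS k; exact: agree_trans (Tmono n k nk) (IH nk) h.
have pln n : play mu r0 th0 m (Tn n) (ln n) by have [] := okn n.
have hs : has_sup (range Tn).
  split; first by exists (Tn 0%N), 0%N.
  by exists (vh (r0 / mu) th0) => t [n _ <-]; exact: play_bound (pln n).
pose Tl := sup (range Tn).
have TTl n : Tn n < Tl.
  have [_ lt _] := sS n; apply: lt_le_trans lt _.
  by apply: ub_le_sup; [exact: hs.2|exists n.+1].
have Tlim t : t < Tl -> exists n, t < Tn n.
  move=> tT; have [|x [n _ <-] h] := @sup_adherent _ (range Tn) (Tl - t) _ hs.
    by rewrite subr_gt0.
  by exists n; move: h; rewrite -/Tl; lra.
have [l' [pl' ag']] := play_limit mu0 pln Tmono agn TTl Tlim.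
have okl : ok (Tl, l').
  by split => //=; [exact: ltW (TTl 0%N)|exact: (ag' 0%N)].
have [[T2 l2] [/= h1 h2 h3] h4] := strict _ okl.
have far n : Tn n + T2 <= 2 * Tn n.+1.
  have [_ _ h] := sS n; apply: le_trans h; rewrite lerD2l.
  apply: ub_le_sup; first by apply: (supS _ _).2; exact: (svalP (s n)).
  exists (T2, l2) => //; split => //=; first by apply: le_trans (ltW (TTl n)) h1.
  exact: agree_trans (ltW (TTl n)) (ag' n) h3.
(* The limit play extends to T2 > [Tl]. Once [Tn n] exceeds 2 Tl - T2, the next step would pass
   [Tl]. *)
have [n hn] := Tlim (2 * Tl - T2) (ltac:(rewrite /= in h4; lra)).
by have := far n; have := TTl n.+1; lra.
Qed.

End secures.

Lemma lady_secures_kL mu r0 th0 : 0 < mu -> mu < 1 -> 0 <= th0 <= pi ->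
  lady_secures mu r0 th0 (kL mu) (vh (r0 / mu) th0).
Proof.
move=> mu0 mu1 th0_itv m mm T l T0 lm fl nE.
have pl : play mu r0 th0 m T l by split.
have [T' [l' [TT' pl' ag E]]] := play_completes mu0 mu1 mm th0_itv pl.
have [T'0 lm' fl' nE'] := pl'.
exists T', l'; split => //.
by rewrite TT' (play_bound mu0 mm th0_itv pl').
Qed.

End limit.

(** * Saddle plays *)

Section explicit_saddle.
Context {R : realType}.
Implicit Types (a b c d e h r s t w x y z u A B K T mu : R) (l : @lady R) (m : @man R).
Local Notation pi := (@trigo.pi R).

Lemma lt_or_le (x y : R) : x < y \/ y <= x.
Proof. by case: ltP; [left|right]. Qed.

Lemma le_or_lt (x y : R) : x <= y \/ y < x.
Proof. by case: leP; [left|right]. Qed.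

(* If [th0 <= r0 / mu], L heads for the center and M may wait until the line
   [theta = r / mu] is met; from the center on, L stays opposite M. *)
Lemma saddle_through_center mu r0 th0 : 0 < mu -> mu < 1 -> 0 <= r0 <= 1 ->
  0 <= th0 <= pi -> r0 = 0 \/ th0 <= r0 / mu ->
  let V := pi / 2 + r0 / mu in
  exists l m, [/\ lady_motion mu r0 th0 V l, man_motion V m,
    lady_follows (kL mu) V l m, man_follows (omega_star mu) V l m
    & final_time mu l m V].
Proof.
move=> mu0 mu1 /andP[r00 r01] /andP[th00 th0pi] cas V.
have p2 := pi_ge2 R.
pose p := r0 / mu; have p0 : 0 <= p by rewrite divr_ge0// ltW.
have mup : mu * p = r0 by rewrite mulrC divfK// gt_eqF.
have th0p : 0 < p -> th0 <= p.
  by case: cas => // rz; rewrite /p rz mul0r ltxx.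
(* The time at which rho, falling at unit rate, meets th0; M starts then, and theta = rho until the
   center. For r0 = 0 the angle is arbitrary, hence the maximum. *)
pose t1 := Num.max 0 (p - th0).
have t10 : 0 <= t1 by rewrite le_max lexx.
have t1p : t1 <= p by rewrite ge_max p0; lin.
have t1E : 0 < p -> t1 = p - th0.
  by move=> /th0p h; apply/max_idPr; lin.
have pV : p <= V by rewrite /V -/p; lin.
pose m := Man (fun t => Num.max 0 (t - t1)) (fun t => if t < t1 then 0 else 1).
(* After the center, sin psi = rad / mu and rad' = mu cos psi are solved by psi = t - p. *)
pose l := Lady (fun t => if t <= p then mu * (p - t) else mu * sin (t - p))
  (fun t => if t <= p then th0 else pos m t + pi)
  (fun t => if t < p then pi else t - p).
have mm : man_motion V m.
  apply: man_motionP.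
  - by rewrite /= sub0r; apply/max_idPl; lin.
  - apply: (@der_cat _ _ _ 0 t1).
      apply: eq_der_oo (der_cst 0 0 t1) => t ht /=.
        by apply/esym/max_idPl; lin.
      by rewrite ifT//; lin.
    apply: eq_der_oo (derB (der_id t1 V) (der_cst t1 t1 V)) => t ht /=.
      by apply/esym/max_idPr; lin.
    by rewrite ifF ?subr0//; apply/negbTE; rewrite -leNgt; lin.
  - by move=> t _ /=; case: ifP => _; lin.
have late t : p <= t -> [/\ rad l t = mu * sin (t - p), rel_angle l m t = pi,
    orient l m t = 1, psi l t = t - p & omega m t = 1].
  move=> pt; have radE : rad l t = mu * sin (t - p).
    rewrite /=; case: leP => // tp; have -> : t = p by lin.
    by rewrite subrr sin0 mulr0.
  have om : omega m t = 1 by rewrite /= ifF//; apply/negbTE; rewrite -leNgt; lin.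
  have ps : psi l t = t - p by rewrite /= ltNge pt.
  have [tp|tp] := eqVneq t p.
    have rz : rad l t = 0 by rewrite radE tp subrr sin0 mulr0.
    by split; rewrite ?rel_angle0 ?orient0.
  have lt : p < t by rewrite lt_neqAle eq_sym tp.
  have az : azi l t - pos m t = pi.
    have -> : azi l t = pos m t + pi by rewrite /= leNgt lt.
    by rewrite addrAC subrr add0r.
  split => //; first by rewrite /rel_angle az cospi acosN1 /angle; case: ifP.
  by rewrite /orient az sinpi lexx orbT.
have early t : 0 <= t < p -> [/\ 0 < rad l t, rho mu l t = p - t,
    phi l m t = Num.min th0 (p - t) & psi l t = pi].
  move=> /andP[t0 tp]; have lep := ltW tp.
  have radE : rad l t = mu * (p - t) by rewrite /= lep.
  split.
  - by rewrite radE mulr_gt0// subr_gt0.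
  - by rewrite /rho radE mulrC mulKf// gt_eqF.
  - rewrite /phi /= lep t1E; last by lin.
    have [h|h] := leP th0 (p - t).
      by have -> : Num.max 0 (t - (p - th0)) = 0; [apply/max_idPl|]; lin.
    by have -> : Num.max 0 (t - (p - th0)) = t - (p - th0); [apply/max_idPr|]; lin.
  - by rewrite /= tp.
have Dr : der (rad l) (fun t => mu * cos (psi l t)) 0 V.
  apply: (@der_cat _ _ _ 0 p).
    apply: eq_der_oo (derZ mu (derB (der_cst p 0 p) (der_id 0 p))) => t ht /=.
      by rewrite ifT//; lin.
    by rewrite ifT ?cospi ?sub0r//; lin.
  have D := der_comp (@is_derive_sin R) (@continuous_cos R) (derB (der_id p V) (der_cst p p V)).
  apply: eq_der_oo (derZ mu D) => t ht.
    by have [|-> _ _ _ _] := late t; first by lin.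
  by have [|_ _ _ -> _] := late t; [lin|rewrite subr0 mulr1].
have lm : lady_motion mu r0 th0 V l.
  apply: lady_motionP => //.
  - by rewrite /= p0 subr0.
  - by rewrite /= p0.
  - apply: (@bm_cat _ _ _ p).
      by apply: bm_oo (bm_cst pi 0 p) _ => t ht /=; rewrite ifT//; lin.
    apply: bm_oo (bmB (der_bm0 (der_id p V)) (bm_cst p p V)) _ => t ht /=.
    by rewrite ifF//; apply/negbTE; rewrite -leNgt; lin.
  - move=> t /andP[t0 tV] /=; case: ltP => tp; first by move: p2; lin_goal.
    by move: tV tp p2; rewrite /V -/p; lin_goal.
  - move=> t /andP[t0 tV]; have [tp|pt] := le_or_lt t p.
      rewrite /= tp mulr_ge0 ?subr_ge0 ?(ltW mu0)//= mulrBr mup.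
      by have := mulr_ge0 (ltW mu0) t0; lin.
    have [|-> _ _ _ _] := late t; first by lin.
    have s0 : 0 <= sin (t - p) by apply: sin_ge0_pi; move: tV; rewrite /V -/p; lin.
    rewrite mulr_ge0 ?(ltW mu0)//=; apply: le_trans (ltW mu1).
    by rewrite ler_piMr ?sin_le1// ltW.
  - move=> a b a0 ab bV rp.
    have [bp|pb] := lt_or_le b p.
      apply: eq_der (der_cst th0 a b) => t tab /=.
        by rewrite ifT//; lin.
      by rewrite (_ : t < p) ?sinpi ?mulr0//; lin.
    have [ap|pa] := le_or_lt a p.
      by have := rp p (introT andP (conj ap pb)); rewrite /= lexx subrr mulr0 ltxx.
    have D := derD (derB (der_id a b) (der_cst t1 a b)) (der_cst pi a b).
    apply: eq_der D => t tab.
      rewrite /= ifF; last by apply/negbTE; rewrite -ltNge; lin.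
      by have -> : Num.max 0 (t - t1) = t - t1 by apply/max_idPr; lin.
    have rt := rp t tab; have [|radE _ _ -> _] := late t; first by lin.
    rewrite radE in rt *; rewrite subr0 addr0.
    have st : sin (t - p) != 0 by move: rt; rewrite pmulr_rgt0// => /gt_eqF->.
    by field; rewrite st gt_eqF.
have omE t : omega m t = if t < t1 then 0 else 1 by [].
clearbody l m.
have acute t : 0 <= t < p -> [/\ 0 <= phi l m t <= pi, th l m t = phi l m t,
    phi l m t <= rho mu l t & 0 <= sin (phi l m t)].
  move=> tp; have [_ -> -> _] := early t tp; have /andP[t0 tp'] := tp.
  have h : 0 <= Num.min th0 (p - t) <= pi.
    by rewrite le_min ge_min th0pi th00 /= subr_ge0 ltW.
  have e : phi l m t = Num.min th0 (p - t) by have [_ _ ->] := early t tp.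
  split => //; first by rewrite /th e acl_cos.
    by rewrite ge_min lexx orbT.
  exact: sin_ge0_pi.
exists l, m; split => //.
- move=> t /andP[t0 tV]; have [tp|pt] := lt_or_le t p.
    have tp' : 0 <= t < p by rewrite t0.
    have [rp rE _ ->] := early t tp'; have [ph1 thE ph2 ph3] := acute t tp'.
    rewrite orientE ?gt_eqF// rel_angleE ?gt_eqF// /sg1 ph3 !mul1r /kL thE.
    have rho0 : 0 < rho mu l t by exact: rho_gt0.
    rewrite ifF; last first.
      apply/negbTE/negP => /andP[/eqP E rm].
      move: ph2; rewrite E /rho ler_pdivlMr//.
      have : mu * 1 < pi * mu by rewrite mulrC ltr_pM2r//; move: p2; lin_goal.
      by lin.
    rewrite -/(rho mu l t) /head /bh bet_le ?subrr ?mulr0 ?subr0//.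
    by rewrite ge_min ph2.
  have [radE -> -> -> ->] := late t pt; rewrite !mul1r /kL eqxx andTb.
  have sm : rad l t <= mu by rewrite radE ler_piMr ?sin_le1// ltW.
  rewrite sm mulr1 radE mulrC mulKf ?gt_eqF// clampE ?sin_geN1 ?sin_le1//.
  by rewrite sinK// in_itv/=; move: tV; rewrite /V -/p; lin.
- move=> t /andP[t0 tV]; have [tp|pt] := lt_or_le t p.
    have tp' : 0 <= t < p by rewrite t0.
    have [rp rE phE _] := early t tp'; have [ph1 thE ph2 ph3] := acute t tp'.
    rewrite orientE ?gt_eqF// rel_angleE ?gt_eqF// /sg1 ph3 mul1r thE.
    rewrite /omega_star -/(rho mu l t) ltNge ph2 /=.
    case: eqVneq => [E|ne]; last by rewrite /= omE; case: ifP => _; lin_goal.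
    have pp : 0 < p by exact: le_lt_trans tp.
    rewrite omE ifT// t1E//; suff : th0 <= 0 by move: tp; lin_goal.
    by move: E; rewrite phE; case: (leP th0 (p - t)) => h; move: tp; lin_goal.
  have [radE -> -> _ ->] := late t pt; rewrite !mul1r /omega_star.
  have -> : rad l t / mu < pi.
    rewrite radE mulrC mulKf ?gt_eqF//.
    by have := sin_le1 (t - p); lin.
  by [].
split; first by rewrite /V -/p; lin.
  have [radE re _ _ _] := late V pV; split => //.
  move: radE; have -> : V - p = pi / 2 by rewrite /V -/p; ring.
  by rewrite sin_pihalf mulr1.
move=> t /andP[t0 tV] [E1 E2]; have [tp|pt] := lt_or_le t p.
  have tp' : 0 <= t < p by rewrite t0.
  have [rp rE phE _] := early t tp'; have [ph1 thE ph2 ph3] := acute t tp'.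
  move: E2; rewrite rel_angleE ?gt_eqF// thE => E2.
  by move: ph2 p2; rewrite E2 /rho E1 divff ?gt_eqF//; lin_goal.
have [radE _ _ _ _] := late t pt.
have : sin (t - p) < 1.
  have -> : sin (t - p) = cos (pi / 2 - (t - p)).
    by rewrite cosB cos_pihalf sin_pihalf mul0r add0r mul1r.
  by rewrite -[X in _ < X]cos0 lt_cos; move: tV; rewrite /V -/p; lin.
rewrite -(ltr_pM2l mu0) -radE E1 mulr1 ltxx//.
Qed.

End explicit_saddle.

(** * Saddle plays from outside the zone *)

Section saddle.
Context {R : realType}.
Implicit Types (a b c d e h r s t w x y z u A B K T mu : R) (l : @lady R) (m : @man R).
Local Notation pi := (@trigo.pi R).

(** Strictness shows in [good_left] that L does not pass through the center. *)
Lemma vv_lt r b : 0 < r -> bmin r <= b < pi / 2 -> vv r b < pi / 2 + r.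
Proof.
move=> r0 bi; have al1 := al_lt_pihalf r0 bi; have /andP[al0 _] := al_itv r b.
have p2 := pi_ge2 R.
have h : sin (pi - za r b) < pi - za r b by apply: sin_lt; move: al1; rewrite /al; lin.
have e : sin (pi - za r b) = sin (za r b).
  by rewrite sinB cospi sinpi mul0r sub0r mulN1r opprK.
have : r * sin b <= r by rewrite ler_piMr ?sin_le1// ltW.
by rewrite /vv /tl /al; lin.
Qed.

Lemma response_outer mu l m t : 0 < mu -> 0 < rad l t ->
  outer_state (rho mu l t) (phi l m t) ->
  response mu l m t = sg1 (sin (phi l m t)) * head (rho mu l t) (th l m t).
Proof.
move=> mu0 rt out; rewrite /response rel_angleE ?gt_eqF// orientE ?gt_eqF//.
congr (_ * _); rewrite /kL ifF//; apply/negbTE/negP => /andP[/eqP E rm].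
case: out => [|]; first by rewrite -/(th l m t) E ltxx.
by rewrite /rho ltr_pdivlMr// mul1r ltNge rm.
Qed.

Section play.
Variables (mu r0 th0 T : R) (l : @lady R).
Let m : @man R := Man id (fun=> 1).
Hypotheses (mu0 : 0 < mu) (mu1 : mu < 1) (pl : play mu r0 th0 m T l).

Lemma man_unit S : man_motion S m.
Proof.
apply: man_motionP => //; first exact: der_id.
by move=> t _ /=; lin.
Qed.

Let T0 : 0 <= T. Proof. by case: pl. Qed.
Let lm : lady_motion mu r0 th0 T l. Proof. by case: pl. Qed.
Let fl : lady_follows (kL mu) T l m. Proof. by case: pl. Qed.
Let nE t : 0 <= t < T -> ~ at_E mu l m t.
Proof. by case: pl => _ _ _; apply. Qed.
Let mm := man_unit T.

(** In these states omega = 1 needs no reflection and is the control that [omega_star] prescribes.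
    The last condition says that theta = pi occurs only where L copies M. *)
Let good t := [/\ 0 < rad l t, rho mu l t < th l m t, 0 <= sin (phi l m t)
  & th l m t = pi -> rho mu l t <= 1].

Let sin_phi t : 0 <= sin (phi l m t) -> sin (phi l m t) = sin (th l m t).
Proof. by move=> h; rewrite sin_th ger0_norm. Qed.

(** At theta = pi the conditions are not open, and [opposite_stays] takes over. *)
Lemma good_right t : 0 <= t < T -> good t -> \forall s \near t^'+, good s.
Proof.
move=> tT [rt gap s0 st]; have /andP[t0 tT'] := tT.
have p2 := pi_ge2 R.
have rp := rho_gt0 mu0 rt.
have [d d0 [dT rpos D]] := near_data mu0 lm mm tT rt.
have N0 : \forall s \near t^'+, 0 < rad l s.
  by apply/near_rightP; exists d => // s hs; apply: rpos; lin.
have cth := th_cvg_right mu0 lm mm tT rt.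
have crho := rho_cvg_right mu0 lm tT.
have cg : (th l m s - rho mu l s) @[s --> t^'+] --> (th l m t - rho mu l t).
  exact: cvgB.
move/cvgrPdist_lt : cg => /(_ (th l m t - rho mu l t)); rewrite subr_gt0 => /(_ gap) N1.
have /andP[_] := th_itv l m t; rewrite le_eqVlt => /predU1P[tE|lt].
  have r1 : rho mu l t < 1.
    rewrite lt_neqAle st// andbT; apply/eqP => E.
    apply: (nE tT); split; last by rewrite rel_angleE ?gt_eqF.
    by rewrite -[LHS](divfK (x := mu)) ?gt_eqF// -/(rho mu l t) E mul1r.
  have [d' d'0 [_ H]] := opposite_stays mu0 lm mm fl tT rt tE r1.
  apply/near_rightP; exists d' => // s hs.
  have [|h1 h2 h3] := H s; first by lin.
  split => //; [by rewrite h2; lin| |by move=> _; exact: ltW].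
  have : `|sin (phi l m s)| = 0 by rewrite -sin_th h2 sinpi.
  by move/eqP; rewrite normr_eq0 => /eqP->.
have sp : 0 < sin (phi l m t).
  by rewrite sin_phi// sin_gt0_pi//; lin.
have tD : t <= t + d by lin.
have Dphi := der_phi mu0 lm mm t0 dT rpos.
have cs : sin (phi l m s) @[s --> t^'+] --> sin (phi l m t).
  by apply: sin_cvg; apply: der_cvgr Dphi _ _; lin.
move/cvgrPdist_lt : cs => /(_ _ sp) N2.
move/cvgrPdist_lt : cth => /(_ (pi - th l m t)); rewrite subr_gt0 => /(_ lt) N3.
apply: (filterS2 _ _ (filterI N0 N1) (filterI N2 N3)) => s [n0 n1] [n2 n3].
move: n1 n2 n3; rewrite !ltr_norml => n1 n2 n3.
by split => //; [lin|lin|lin].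
Qed.

Lemma good_left t : 0 < t -> t < T -> (forall s, 0 <= s < t -> good s) -> good t.
Proof.
move=> t0 tT gs; have tT' : 0 <= t <= T by lin.
have p2 := pi_ge2 R.
(* Swimming to the center takes at least rho a, and the value there is pi / 2; so the value at a
   would be at least pi / 2 + rho a, against [vv_lt]. *)
have rt : 0 < rad l t.
  rewrite lt_neqAle (rad_ge0 lm tT') andbT; apply/eqP => rz.
  (* Being at most 1/2 before t gives rho a <= 1, where [hat] leaves the angle unchanged. *)
  pose a := Num.max 0 (t - 2^-1).
  have h2 : 0 < 2^-1 :> R by rewrite invr_gt0.
  have a0 : 0 <= a by rewrite le_max lexx.
  have at_ : a < t by rewrite gt_max t0 /=; lin.
  have ta : t - a <= 2^-1 by rewrite lerBlDr -lerBlDl le_max lexx orbT.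
  have := @value_interval R mu r0 th0 T l m mu0 lm mm fl nE a t a0 (ltW at_) (ltW tT).
  have rps s : a < s < t -> 0 < rad l s by move=> hs; case: (gs s) => //; lin.
  move=> /(_ rps); have [|ra gap _ _] := gs a; first by rewrite a0.
  have rp := rho_gt0 mu0 ra.
  rewrite {1}/rho -rz mul0r vh0 => h.
  have := rho_lip mu0 lm a0 (ltW at_) (ltW tT).
  rewrite {1}/rho -rz mul0r sub0r normrN (gtr0_norm rp) => h3.
  have r01 : 0 < rho mu l a <= 1 by rewrite rp; lin.
  have /andP[_ thpi] := th_itv l m a.
  have hE : hat (rho mu l a) (th l m a) = th l m a.
    by rewrite /hat Gam_le1//; apply/min_idPl.
  have := bh_itv (th l m a) rp; rewrite /bh hE => /andP[b1 b2].
  have bi : bmin (rho mu l a) <= bet (rho mu l a) (th l m a) < pi / 2.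
    rewrite b1 lt_neqAle b2 andbT; apply/eqP => E.
    have := Th_bet rp thpi; rewrite E Th_pihalf => E2.
    by move: gap; rewrite [X in X < _]E2 gt_max ltxx.
  by have := vv_lt rp bi; move: h; rewrite /vh /bh hE; lin.
have rp := rho_gt0 mu0 rt.
have [d d0 Hd] := der_th mu0 lm mm tT' rt.
pose A := Num.max 0 (t - d).
have A0 : 0 <= A by rewrite le_max lexx.
have At : A < t by rewrite gt_max t0 /=; lin.
have [||rpos D] := Hd A t A0 (ltW tT); first by rewrite le_max lexx orbT.
  by lin.
have cth : th l m s @[s --> t^'-] --> th l m t by apply: der_cvgl D _ _.
have crho : rho mu l s @[s --> t^'-] --> rho mu l t.
  by apply: der_cvgl (der_rho mu0 lm) _ _ => //; exact: ltW.
have N0 : \forall s \near t^'-, A < s < t.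
  by apply/near_leftP; exists (t - A); [rewrite subr_gt0|move=> s hs; lin].
have gA s : A < s < t -> good s by move=> hs; apply: gs; lin.
have Dphi := der_phi mu0 lm mm A0 (ltW tT) rpos.
have cphi : phi l m s @[s --> t^'-] --> phi l m t by apply: der_cvgl Dphi _ _.
have sph : 0 <= sin (phi l m t).
  have c1 : (fun=> 0 : R) s @[s --> t^'-] --> (0 : R) by exact: cvg_cst.
  apply: (ler_cvg_to c1 (sin_cvg cphi)).
  by apply: filterS N0 => s /gA[].
have gap0 : rho mu l t <= th l m t.
  by apply: (ler_cvg_to crho cth); apply: filterS N0 => s /gA[_ h _ _]; exact: ltW.
have /andP[_ thpi] := th_itv l m t.
pose H s := head (rho mu l s) (th l m s).
have near_out : outer_state (rho mu l t) (phi l m t) ->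
    (H s @[s --> t^'-] --> H t) /\
    \forall s \near t^'-, th' mu l m s = sin (H s) / rho mu l s - 1 /\
      cos (psi l s) = cos (H s).
  move=> out; split; first exact: head_cvg.
  have N1 : \forall s \near t^'-, outer_state (rho mu l s) (phi l m s).
    case: out => [lt|lt].
      move/cvgrPdist_lt : cth => /(_ (pi - th l m t)); rewrite subr_gt0 => /(_ lt).
      apply: filterS => s; rewrite ltr_norml => h; left.
      by rewrite -/(th l m s); lin.
    move/cvgrPdist_lt : crho => /(_ (rho mu l t - 1)); rewrite subr_gt0 => /(_ lt).
    by apply: filterS => s; rewrite ltr_norml => h; right; lin.
  apply: filterS2 N0 N1 => s hs outs.
  have [rs _ s0 _] := gA s hs.
  have ps : psi l s = H s.
    have sT : 0 <= s < T by lin.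
    by rewrite (fl sT) -/(response mu l m s) response_outer// /sg1 s0 mul1r.
  by rewrite /th' ps /sg1 s0 mul1r.
have H0 s : 0 <= H s <= pi by exact: head_itv.
split => //.
  (* At theta = rho the heading H is pi. With H = pi - 2 g the rate of theta - rho is 2 sin g (cos g
     / rho - sin g), nonnegative for small g, so the gap cannot close. *)
  rewrite lt_neqAle gap0 andbT; apply/eqP => E.
  have out : outer_state (rho mu l t) (phi l m t).
    have [lt|ge] := ltP (th l m t) pi; first by left.
    by right; rewrite E; lin.
  have [cH N1] := near_out out.
  have Ht : H t = pi.
    rewrite /H /head /bh bet_le ?subrr ?mulr0 ?subr0//.
    by rewrite ge_min E lexx.
  rewrite Ht in cH.
  have c2 : (pi - H s) / 2 @[s --> t^'-] --> (0 : R).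
    suff : (pi - H s) / 2 @[s --> t^'-] --> (pi - pi) / 2 by rewrite subrr mul0r.
    by apply: cvgM; [apply: cvgB => //; exact: cvg_cst|exact: cvg_cst].
  have c3 : cos ((pi - H s) / 2) / rho mu l s - sin ((pi - H s) / 2) @[s --> t^'-]
      --> (rho mu l t)^-1.
    suff : cos ((pi - H s) / 2) / rho mu l s - sin ((pi - H s) / 2) @[s --> t^'-]
      --> cos 0 / rho mu l t - sin 0 by rewrite cos0 sin0 mul1r subr0.
    apply: cvgB; last exact: sin_cvg.
    apply: cvgM; first exact: cos_cvg.
    by apply: cvgV => //; rewrite gt_eqF.
  have ri : 0 < (rho mu l t)^-1 by rewrite invr_gt0.
  move/cvgrPdist_lt : c3 => /(_ _ ri) N2.
  have N012 : \forall s \near t^'-, [/\ A < s < t,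
      th' mu l m s = sin (H s) / rho mu l s - 1 /\ cos (psi l s) = cos (H s)
    & `|(rho mu l t)^-1 - (cos ((pi - H s) / 2) / rho mu l s - sin ((pi - H s) / 2))|
      < (rho mu l t)^-1].
    by apply: filterS3 N0 N1 N2 => s ? ? ?; split.
  move/near_leftP : N012 => [e e0 He].
  pose a := Num.max ((A + t) / 2) (t - e / 2).
  have a1 : (A + t) / 2 <= a by rewrite le_max lexx.
  have a2 : t - e / 2 <= a by rewrite le_max lexx orbT.
  have a3 : a < t by rewrite gt_max; lin.
  have Aa : A <= a by lin.
  have Dg := derB (derW D Aa (lexx t)) (derW (der_rho mu0 lm) (le_trans A0 Aa) (ltW tT)).
  have [|_ ga _ _] := gA a; first by lin.
  have := der_ge_cst (c := 0) (ltW a3) Dg; rewrite mul0r subr_ge0 -E subrr => h.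
  suff : th l m a - rho mu l a <= 0 by rewrite subr_le0 leNgt ga.
  apply: h => s hs; have [|/andP[s1 s2] [-> ->] h3] := He s; first by lin.
  have [rs _ _ _] := gA s (introT andP (conj s1 s2)).
  have rps := rho_gt0 mu0 rs.
  set g := (pi - H s) / 2 in h3.
  have HE : H s = pi - 2 * g by rewrite /g; field.
  have /andP[g1 g2] : 0 <= g <= pi / 2 by rewrite /g; have := H0 s; lin_goal.
  have g3 : 0 <= sin g by apply: sin_ge0_pi; move: g1 g2; lin_goal.
  have e2 : 2 * g / 2 = g by field.
  have e3 : sin (H s) = 2 * (sin g * cos g).
    by rewrite HE sinB sinpi cospi mul0r sub0r mulN1r opprK sin2half e2.
  have e4 : cos (H s) = 2 * sin g ^+ 2 - 1.
    rewrite HE cosB sinpi cospi mul0r addr0 mulN1r cos2half e2 sin2cos2; ring.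
  have -> : sin (H s) / rho mu l s - 1 - cos (H s) =
      2 * (sin g * (cos g / rho mu l s - sin g)).
    by rewrite e3 e4; field; rewrite gt_eqF.
  rewrite mulr_ge0// mulr_ge0//.
  by move: h3; rewrite ltr_norml; lin_goal.
(* For rho > 1 the heading at theta = pi is radial, so theta falls at nearly unit rate just before t
   and cannot rise to pi. *)
move=> tE; rewrite leNgt; apply/negP => r1.
have out : outer_state (rho mu l t) (phi l m t) by right.
have [cH N1] := near_out out.
have sph0 : sin (phi l m t) = 0 by rewrite sin_phi// tE sinpi.
have c3 : sin (H s) / rho mu l s @[s --> t^'-] --> sin (H t) / rho mu l t.
  apply: cvgM; first exact: sin_cvg.
  by apply: cvgV => //; rewrite gt_eqF.
have Hs0 : sin (H t) = 0 by rewrite /H /th; exact: sin_head0.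
rewrite Hs0 mul0r in c3.
have h2 : 0 < 2^-1 :> R by rewrite invr_gt0.
move/cvgrPdist_lt : c3 => /(_ _ h2) N2.
have N012 : \forall s \near t^'-, [/\ A < s < t,
    th' mu l m s = sin (H s) / rho mu l s - 1 /\ cos (psi l s) = cos (H s)
  & `|0 - sin (H s) / rho mu l s| < 2^-1].
  by apply: filterS3 N0 N1 N2 => s ? ? ?; split.
move/near_leftP : N012 => [e e0 He].
pose a := Num.max ((A + t) / 2) (t - e / 2).
have a1 : (A + t) / 2 <= a by rewrite le_max lexx.
have a2 : t - e / 2 <= a by rewrite le_max lexx orbT.
have a3 : a < t by rewrite gt_max; lin.
have Aa : A <= a by lin.
have := der_le_cst (c := - 2^-1) (ltW a3) (derW D Aa (lexx t)); rewrite tE => h.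
have /andP[_ tha] := th_itv l m a.
have : pi - th l m a <= - 2^-1 * (t - a).
  apply: h => s hs; have [|_ [-> _] h3] := He s; first by lin.
  by move: h3; rewrite ltr_norml; lin_goal.
have : 0 < 2^-1 * (t - a) by rewrite mulr_gt0// subr_gt0.
by move: tha; lin_goal.
Qed.

Lemma good_play : good 0 -> forall t, 0 <= t < T -> good t.
Proof.
move=> g0 t /andP[t0 tT]; apply: contrapT => bad.
have [|t1 [/andP[t10 t1t] bad1 before]] := @first_time R (fun t => ~ good t) 0 t t0 bad.
  move=> s /andP[s0 st] /contrapT gs; have sT : 0 <= s < T by lin.
  by apply: filterS (good_right sT gs) => u gu; apply.
have [tz|tnz] := eqVneq t1 0; first by rewrite tz in bad1.
apply: bad1; apply: good_left; [by rewrite lt_neqAle eq_sym tnz|lin|].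
by move=> s hs; apply: contrapT; exact: before.
Qed.

Lemma good_follows : good 0 -> man_follows (omega_star mu) T l m.
Proof.
move=> g0 t tT; have [rt gap s0 _] := good_play g0 tT.
rewrite rel_angleE ?gt_eqF// orientE ?gt_eqF// /sg1 s0 /omega_star.
by rewrite -/(rho mu l t) gap mulr1.
Qed.

End play.

(** No explicit play is needed: the feedback of L against omega = 1 is completed to a play, whose
    length is V because both bounds apply to it. *)
Lemma saddle_outside mu r0 th0 : 0 < mu -> mu < 1 -> 0 < r0 <= 1 ->
  r0 / mu < th0 <= pi -> (th0 = pi -> r0 <= mu) ->
  th0 <= Gam (r0 / mu) ->
  let V := vv (r0 / mu) (bet (r0 / mu) th0) in
  exists l m, [/\ lady_motion mu r0 th0 V l, man_motion V m,
    lady_follows (kL mu) V l m, man_follows (omega_star mu) V l m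
    & final_time mu l m V].
Proof.
move=> mu0 mu1 /andP[r00 r01] /andP[rth thpi] thE G V.
have p0 : 0 < r0 / mu by rewrite divr_gt0.
have th0_itv : 0 <= th0 <= pi by rewrite thpi andbT; lin.
have pi0 := pi_ge0 R.
pose m : @man R := Man id (fun=> 1).
(* The play of length 0, from which [play_completes] starts. *)
pose l0 : @lady R := Lady (fun=> r0) (fun=> th0) (fun=> 0).
have pt (f f' : R -> R) a b : 0 <= a -> a <= b -> b <= 0 -> der f f' a b.
  move=> a0 ab b0; have -> : a = b by lin.
  split; first exact: bm_point.
  move=> s t s0 st t0; have -> : s = t by lin.
  by rewrite subrr ig0.
have pl0 : play mu r0 th0 m 0 l0.
  split => //; last 2 first.
  - by move=> t ht; lin.
  - by move=> t ht; lin.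
  apply: lady_motionP => //.
  - exact: bm_point.
  - by move=> t _ /=; lin.
  - by move=> t _ /=; rewrite r01 ltW.
  - exact: pt.
  - by move=> a b a0 ab b0 _; exact: pt.
have mm S : man_motion S m by exact: man_unit.
have [T [l [T0 pl ag E]]] := play_completes mu0 mu1 mm th0_itv pl0.
have [_ lm fl nE] := pl.
have thE0 : th l m 0 = th0 by exact: (th_start lm (mm T) th0_itv).
have r0E : rad l 0 = r0 by case: lm => -[].
have a0E : azi l 0 = th0 by case: lm => -[].
have fm : man_follows (omega_star mu) T l m.
  apply: (good_follows mu0 pl).
  rewrite -/m /rho thE0 r0E; split => //.
    by rewrite /phi a0E /= subr0 sin_ge0_pi.
  by move=> /thE; rewrite ler_pdivrMr// mul1r.
have ft : final_time mu l m T by [].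
have lb := man_lower_bound mu0 T0 lm (mm T) th0_itv fm ft.
have ub := play_bound mu0 mm th0_itv pl.
have TV : T = V.
  apply/le_anti; rewrite lb andbT; apply: le_trans ub _.
  by rewrite /vh /bh /hat (min_idPl G).
by exists l, m; rewrite -TV.
Qed.

End saddle.

Theorem theorem1 (R : realType) (mu_crit mu : R)
  (mu_crit01 : 0 < mu_crit < 1) (theta_T_mu_crit : theta_T mu_crit = 0)
  (mu_range : mu_crit < mu < 1) :
  (forall r theta : R, below_barrier mu r theta -> r != 0 -> theta != pi ->
     r / mu < theta ->
     least_switch_radius mu r theta (inward mu r theta) (s_star mu r theta)) /\
  exists k : R -> R -> R -> R,
    [/\ lady_feedback k,
        forall r theta w : R, below_barrier mu r theta ->
          angle r theta = theta -> omega_star mu r theta w ->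
          (cos (k r theta w), sin (k r theta w)) = psi_star mu r theta
      & forall r theta : R, below_barrier mu r theta ->
          saddle_point mu r theta k (omega_star mu)
            (tf_star mu r (angle r theta))].
Proof.
have /andP[c0 _] := mu_crit01; have /andP[cmu mu1] := mu_range.
have mu0 : 0 < mu by exact: lt_trans cmu.
split.
  move=> r th [/andP[r0 _] /andP[_ thpi] _] rn0 _ rth.
  by apply: s_starP => //; [rewrite lt_neqAle eq_sym rn0|rewrite rth].
exists (kL mu); split; first exact: kL_feedback.
  by move=> r th w bb an om; exact: kL_psi_star.
move=> r th bb; have [/andP[r0 r1] th_itv _] := bb.
have LS := lady_secures_kL (r0 := r) mu0 mu1 th_itv.
have MS := man_secures_omega_star (r0 := r) mu0 th_itv.
(* At the center both bounds equal pi / 2 for every theta, in accordance with [angle]. *)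
have [rz|rn0] := eqVneq r 0.
  have vv0 b : vv 0 b = pi / 2 :> R.
    by rewrite /vv /al /tl /za !mul0r mulr0 sub0r aclE ?acosN1 ?sinpi ?mul0r ?addr0// lexx/=; lin.
  rewrite rz mul0r vh0 vv0 in LS MS *.
  rewrite /angle eqxx tf_star_center; split => //.
  have := saddle_through_center (r0 := 0) mu0 mu1 _ th_itv (or_introl erefl).
  by rewrite mul0r addr0; apply; rewrite lexx ler01.
have rp : 0 < r by rewrite lt_neqAle eq_sym rn0.
have [G piE] := below_barrier_state mu0 rp bb.
have -> : angle r th = th by rewrite /angle (negbTE rn0).
rewrite tf_starE//.
have vE : vh (r / mu) th = vv (r / mu) (bet (r / mu) th).
  by rewrite /vh /bh /hat (min_idPl G).
rewrite vE in LS; split => //.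
have [le|lt] := leP th (r / mu).
  rewrite bet_le// vv_pihalf; apply: saddle_through_center => //.
    by rewrite r0.
  by right.
apply: saddle_outside => //; first by rewrite rp.
by rewrite lt; case/andP: th_itv.
Qed.
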